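(* Let $G$ be a connected Lie group and $\widetilde F$ a Minkowski norm on its Lie algebra $\mathfrak g$. For $X\in\mathfrak g\setminus\{0\}$ let $U\in\mathfrak g$ be such that $X\in G(U)$, where $G(U)=\{\mathrm{Ad}(a)U\mid a\in G\}$ is the adjoint orbit of $U$, and let $gG_U\in G/G_U$ be the unique coset with $\rho(gG_U)=X$. Then $X$ is a geodesic vector (of the left-invariant Finsler metric $F$ on $G$ induced by $\widetilde F$) if and only if $gG_U$ is a critical point of $q=Q\circ\rho$, the restricted Minkowski norm on $G/G_U$.
   Context: A Minkowski norm on $\mathfrak g$ is a continuous function $\widetilde F:\mathfrak g\to[0,\infty)$ that is $C^\infty$ on $\mathfrak g\setminus\{0\}$, satisfies $\widetilde F(tZ)=t\widetilde F(Z)$ for $t\ge0$ (reversibility is not assumed), and is such that for every $y\in\mathfrak g\setminus\{0\}$ the symmetric bilinear form $g_y(u,v)=\frac12\frac{\partial^2}{\partial s\,\partial t}[\widetilde F^2(y+su+tv)]|_{s=t=0}$ is positive definite. It induces the left-invariant Finsler metric $F(x,W)=\widetilde F(dL_{x^{-1}}W)$, $x\in G$, $W\in T_xG$, where $L_x$ is left translation by $x$. Geodesics of $F$ are parametrized with constant speed: a curve $\sigma$ with nonzero velocity is a geodesic if in local coordinates $\ddot\sigma^i+\dot\sigma^j\dot\sigma^k\,\Gamma^i_{jk}(\sigma,\dot\sigma)=0$, where $\Gamma^i_{jk}(x,y)$ are the Chern connection coefficients of $F$. A vector $X\in\mathfrak g\setminus\{0\}$ is a geodesic vector if $t\mapsto\exp(tX)$,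 $t\in\mathbb R_+=[0,\infty)$, is a geodesic of $F$. For $U\in\mathfrak g$, $G_U=\{a\in G\mid \mathrm{Ad}(a)U=U\}$ is the isotropy subgroup at $U$ under the adjoint action, $G/G_U$ is the manifold of left cosets with its canonical smooth structure, and $\rho:G/G_U\to G(U)\subset\mathfrak g$, $\rho(aG_U)=\mathrm{Ad}(a)U$, is the canonical bijection (an injective immersion into $\mathfrak g$). Let $Q(Z)=\widetilde F^2(Z)$ for $Z\in\mathfrak g$; the function $q=Q\circ\rho:G/G_U\to\mathbb R$ is called the restricted Minkowski norm on $G/G_U$. *)

(* Defs.v *)
From HB Require Import structures.
From mathcomp Require Import all_boot all_order all_algebra.
From mathcomp Require Import all_classical all_reals all_analysis.

Set Implicit Arguments.
Unset Strict Implicit.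
Unset Printing Implicit Defensive.

Import Order.TTheory GRing.Theory Num.Theory.
Import numFieldNormedType.Exports.

Local Open Scope classical_set_scope.
Local Open Scope ring_scope.

(* [f] is C^k (resp. C^oo) on the open set [A] of a finite-dimensional space:
   all iterated directional derivatives up to order k (resp. of all orders)
   exist and are continuous at every point of [A]. *)
Fixpoint C_on (R : realType) (V W : normedModType R) (k : nat)
    (f : V -> W) (A : set V) : Prop :=
  (forall x, A x -> {for x, continuous f}) /\
  if k is k'.+1 then
    forall v, (forall x, A x -> derivable f x v) /\ C_on k' ('D_v f) A
  else True.

Definition smooth_on (R : realType) (V W : normedModType R)
  (f : V -> W) (A : set V) : Prop := forall k, C_on k f A.

Section Manifold.
Context {R : realType}.

(* A chart is a homeomorphism from the open set [chart_dom] onto an open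
   subset of R^n; the values of [chart_map] (resp. [chart_inv]) outside of
   [chart_dom] (resp. of its image) are irrelevant. *)
Record chart (T : topologicalType) (n : nat) := Chart {
  chart_dom : set T ;
  chart_map :> T -> 'rV[R]_n ;
  chart_inv : 'rV[R]_n -> T ;
  chart_dom_open : open chart_dom ;
  chart_cod_open : open (chart_map @` chart_dom) ;
  chart_mapK : forall p, chart_dom p -> chart_inv (chart_map p) = p ;
  chart_map_continuous :
    forall p, chart_dom p -> {for p, continuous chart_map} ;
  chart_inv_continuous :
    forall x, (chart_map @` chart_dom) x -> {for x, continuous chart_inv}
}.

Record smooth_structure (T : topologicalType) (n : nat) := SmoothStructure {
  atlas : set (chart T n) ;
  atlas_cover : forall p, exists2 c, atlas c & chart_dom c p ;
  atlas_compat : forall c c', atlas c -> atlas c' ->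
    smooth_on (c' \o chart_inv c) (c @` (chart_dom c `&` chart_dom c')) ;
  manifold_hausdorff : hausdorff_space T ;
  manifold_second_countable : @second_countable T
}.

(* The differential of [f] at [p], read in a chart [c] at [p] and a chart [c']
   at [f p].  Throughout, tangent vectors at a point are represented by their
   components in a chart at that point. *)
Definition tangent_map (T T' : topologicalType) (n n' : nat)
    (c : chart T n) (c' : chart T' n') (f : T -> T') (p : T) :
    'rV[R]_n -> 'rV[R]_n' :=
  'd (c' \o f \o chart_inv c) (c p).

Definition smooth_map (T T' : topologicalType) (n n' : nat)
    (M : smooth_structure T n) (M' : smooth_structure T' n')
    (f : T -> T') : Prop :=
  continuous f /\
  forall c c', atlas M c -> atlas M' c' ->
    smooth_on (c' \o f \o chart_inv c)
      (c @` (chart_dom c `&` f @^-1` chart_dom c')).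

Definition submersion (T T' : topologicalType) (n n' : nat)
    (M : smooth_structure T n) (M' : smooth_structure T' n')
    (f : T -> T') : Prop :=
  smooth_map M M' f /\
  forall p c c', atlas M c -> atlas M' c' ->
    chart_dom c p -> chart_dom c' (f p) ->
    forall w, exists v, tangent_map c c' f p v = w.

Definition critical_point (T : topologicalType) (n : nat)
    (M : smooth_structure T n) (q : T -> R) (p : T) : Prop :=
  forall c, atlas M c -> chart_dom c p ->
    differentiable (q \o chart_inv c) (c p) /\
    forall v, 'd (q \o chart_inv c) (c p) v = 0.

Definition smooth_curve (T : topologicalType) (n : nat)
    (M : smooth_structure T n) (sigma : R -> T) : Prop :=
  continuous sigma /\
  forall c, atlas M c -> smooth_on (c \o sigma) (sigma @^-1` chart_dom c).

End Manifold.
Arguments chart : clear implicits.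
Arguments smooth_structure : clear implicits.

Section Finsler.
Context {R : realType} {n : nat}.

(* g_y(u, v) = 1/2 d^2/dsdt F^2(y + s u + t v) at s = t = 0 *)
Definition fundamental_form (F : 'rV[R]_n -> R) (y u v : 'rV[R]_n) : R :=
  2^-1 * derive1 (fun s : R => derive1 (fun t : R =>
            F (y + s *: u + t *: v) ^+ 2) 0) 0.

Definition minkowski_norm (F : 'rV[R]_n -> R) : Prop :=
  [/\ forall z, 0 <= F z,
      continuous F,
      smooth_on F [set z | z != 0],
      forall (t : R) z, 0 <= t -> F (t *: z) = t * F z &
      forall y, y != 0 -> forall u, u != 0 -> 0 < fundamental_form F y u u].

(* Here F x y is the expression of a Finsler metric in local coordinates: x is
   the coordinate vector of the point and y the component vector of the tangent
   vector. *)
Variable F : 'rV[R]_n -> 'rV[R]_n -> R.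
Local Notation e i := (delta_mx 0 i : 'rV[R]_n).

Definition dx (k : 'I_n) (f : 'rV[R]_n -> 'rV[R]_n -> R)
  (x y : 'rV[R]_n) : R := 'D_(e k) (fun x' => f x' y) x.
Definition dy (k : 'I_n) (f : 'rV[R]_n -> 'rV[R]_n -> R)
  (x y : 'rV[R]_n) : R := 'D_(e k) (f x) y.

Definition metric (i j : 'I_n) (x y : 'rV[R]_n) : R :=
  fundamental_form (F x) y (e i) (e j).

Definition inverse_metric (i j : 'I_n) (x y : 'rV[R]_n) : R :=
  invmx (\matrix_(k, l) metric k l x y) i j.

Definition formal_christoffel (i j k : 'I_n) (x y : 'rV[R]_n) : R :=
  2^-1 * \sum_s inverse_metric i s x y *
    (dx k (metric s j) x y - dx s (metric j k) x y + dx j (metric k s) x y).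

(* C^i_jk, the Cartan tensor C_sjk = 1/2 dg_sj/dy^k with its first index raised *)
Definition cartan (i j k : 'I_n) (x y : 'rV[R]_n) : R :=
  \sum_s inverse_metric i s x y * (2^-1 * dy k (metric s j) x y).

(* N^i_j = gamma^i_jk y^k - C^i_jk gamma^k_rs y^r y^s *)
Definition nonlinear_connection (i j : 'I_n) (x y : 'rV[R]_n) : R :=
  \sum_k formal_christoffel i j k x y * y 0 k
  - \sum_k \sum_r \sum_s
      cartan i j k x y * formal_christoffel k r s x y * y 0 r * y 0 s.

(* delta/delta x^k = d/dx^k - N^m_k d/dy^m *)
Definition delta_dx (k : 'I_n) (f : 'rV[R]_n -> 'rV[R]_n -> R)
    (x y : 'rV[R]_n) : R :=
  dx k f x y - \sum_m nonlinear_connection m k x y * dy m f x y.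

Definition chern_coefficient (i j k : 'I_n) (x y : 'rV[R]_n) : R :=
  2^-1 * \sum_s inverse_metric i s x y *
    (delta_dx k (metric s j) x y - delta_dx s (metric j k) x y
     + delta_dx j (metric k s) x y).

End Finsler.

(* A Finsler metric on a manifold is given by its expressions in the charts.
   The curve is defined on R but the geodesic equation is only required on the
   interval [I]. *)
Definition geodesic_on (R : realType) (T : topologicalType) (n : nat)
    (M : smooth_structure R T n)
    (F : chart R T n -> 'rV[R]_n -> 'rV[R]_n -> R)
    (I : set R) (sigma : R -> T) : Prop :=
  smooth_curve M sigma /\
  forall t, I t -> forall c, atlas M c -> chart_dom c (sigma t) ->
    let x := c (sigma t) in
    let x' := derive1 (c \o sigma) t in
    let x'' := derive1n 2 (c \o sigma) t in
    x' != 0 /\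
    forall i, x'' 0 i + \sum_j \sum_k
      x' 0 j * x' 0 k * chern_coefficient (F c) i j k x x' = 0.

(* Only a group carrying a topology: the continuity of the group operations is
   part of [is_lie_group]. *)
#[short(type="topGroupType")]
HB.structure Definition TopGroup := {G of Group G & Topological G}.

Section Cosets.
Context {G : topGroupType}.
Variable H : set G.

Definition lcoset_set (a : G) : set G := [set (a * h)%g | h in H].

Record lcosets : Type := Lcosets {
  lcosets_set : set G ;
  lcosetsP : exists a, lcosets_set = lcoset_set a
}.

Definition lcoset (a : G) : lcosets :=
  @Lcosets (lcoset_set a) (ex_intro _ a erefl).

Definition lcoset_repr (C : lcosets) : G := projT1 (cid (lcosetsP C)).

HB.instance Definition _ := gen_eqMixin lcosets.
HB.instance Definition _ := gen_choiceMixin lcosets.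

Definition lcosets_open (A : set lcosets) : Prop := open (lcoset @^-1` A).

Lemma lcosets_openT : lcosets_open setT.
Proof. by rewrite /lcosets_open preimage_setT; exact: openT. Qed.

Lemma lcosets_openI (A B : set lcosets) :
  lcosets_open A -> lcosets_open B -> lcosets_open (A `&` B).
Proof. exact: openI. Qed.

Lemma lcosets_open_bigU (J : Type) (f : J -> set lcosets) :
  (forall j, lcosets_open (f j)) -> lcosets_open (\bigcup_j f j).
Proof.
by move=> fO; rewrite /lcosets_open preimage_bigcup; apply: bigcup_open => j _; exact: fO.
Qed.

(* the quotient topology *)
HB.instance Definition _ := isOpenTopological.Build lcosets
  lcosets_openT lcosets_openI lcosets_open_bigU.

End Cosets.

Section LieGroup.
Context {R : realType} {G : topGroupType} {n : nat}.
Variable M : smooth_structure R G n.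

Definition is_lie_group : Prop :=
  [/\ continuous (fun p : G * G => (p.1 * p.2)%g),
      forall c1 c2 c, atlas M c1 -> atlas M c2 -> atlas M c ->
        smooth_on (fun z : 'rV[R]_n * 'rV[R]_n =>
                     c (chart_inv c1 z.1 * chart_inv c2 z.2)%g)
          [set (c1 p.1, c2 p.2) | p in
            [set p : G * G | [/\ chart_dom c1 p.1, chart_dom c2 p.2 &
                                 chart_dom c (p.1 * p.2)%g]]] &
      smooth_map M M (fun a : G => a^-1%g)].

(* [e] is a chart at the identity, through which the Lie algebra T_1 G is
   identified with R^n. *)
Variable e : chart R G n.

Definition Ad (a : G) : 'rV[R]_n -> 'rV[R]_n :=
  tangent_map e e (fun x => a * x * a^-1)%g 1%g.

Definition Ad_orbit (U : 'rV[R]_n) : set 'rV[R]_n := [set Ad a U | a in setT].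

Definition isotropy (U : 'rV[R]_n) : set G := [set a | Ad a U = U].

(* rho (a G_U) = Ad(a) U, which does not depend on the representative [a] *)
Definition rho (U : 'rV[R]_n) (C : lcosets (isotropy U)) : 'rV[R]_n :=
  Ad (lcoset_repr C) U.

Definition restricted_norm (F : 'rV[R]_n -> R) (U : 'rV[R]_n)
  (C : lcosets (isotropy U)) : R := F (rho C) ^+ 2.

(* The canonical smooth structure of G/H is the unique one for which the
   projection G -> G/H is a smooth submersion. *)
Definition canonical_structure (H : set G) (m : nat)
    (MH : smooth_structure R (lcosets H) m) : Prop :=
  submersion M MH (@lcoset G H).

Definition one_parameter_subgroup (X : 'rV[R]_n) (sigma : R -> G) : Prop :=
  [/\ smooth_curve M sigma,
      forall s t, sigma (s + t) = (sigma s * sigma t)%g &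
      derive1 (e \o sigma) 0 = X].

(* exp X = sigma 1, where sigma is the one-parameter subgroup with velocity X *)
Definition lie_exp (X : 'rV[R]_n) : G :=
  xget 1%g [set a | exists2 sigma, one_parameter_subgroup X sigma & a = sigma 1].

(* F(x, W) = F (dL_{x^-1} W), in the coordinates of the chart [c] *)
Definition left_invariant_finsler (F : 'rV[R]_n -> R) (c : chart R G n)
    (x y : 'rV[R]_n) : R :=
  let a := chart_inv c x in F (tangent_map c e (fun b => a^-1 * b)%g a y).

Definition geodesic_vector (F : 'rV[R]_n -> R) (X : 'rV[R]_n) : Prop :=
  X != 0 /\
  geodesic_on M (left_invariant_finsler F) [set t | 0 <= t]
    (fun t => lie_exp (t *: X)).

End LieGroup.

(* Main.v *)
Require Import Defs.
From HB Require Import structures.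
From mathcomp Require Import all_boot all_order all_algebra.
From mathcomp Require Import all_classical all_reals all_analysis.
From mathcomp Require Import ring lra.
Set Implicit Arguments.
Unset Strict Implicit.
Unset Printing Implicit Defensive.
Import Order.TTheory GRing.Theory Num.Theory.
Import numFieldNormedType.Exports.
Local Open Scope classical_set_scope.
Local Open Scope ring_scope.

(** A curve is a geodesic exactly when it satisfies the Euler-Lagrange equation of the
energy E = F ^ 2. Contracting the Chern coefficients twice with the velocity y removes
every term that contains the Cartan tensor, because the metric coefficients are
homogeneous of degree 0 in y; what remains is the spray of E ([chern_contract]), and
multiplying by the invertible metric matrix gives the Euler-Lagrange equation
([spray_equation], [euler_lagrange]).

Let sigma t = exp (t X), and let k be a curve in G with k 0 = 1. Left translations are
isometries, so the curve t |-> sigma t * k s has at every time the energy of its velocity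
brought back to 1, namely F (Ad (k s)^-1 X) ^ 2; and the variation field at s = 0,
brought back to 1, is the constant k'(0). The first variation formula
([first_variation]) therefore identifies the defect of sigma in the Euler-Lagrange
equation, tested on that field, with the derivative of F (Ad (k s)^-1 X) ^ 2 at s = 0
([euler_lagrange_defect]). This derivative does not mention t, and every tangent vector
at sigma t comes from some k: sigma is a geodesic if and only if F ^ 2 is stationary at X
along the adjoint orbit of X ([geodesic_iff_stationary]).

Write X = Ad g U. Then F (Ad (k s)^-1 X) ^ 2 is the restricted norm at the coset of
(k s)^-1 * g. A critical point of the restricted norm makes it stationary by the chain
rule ([stationary_of_critical]). Conversely, stationarity says that the function
a |-> F (Ad a U) ^ 2 on G has zero differential at g, and this descends to the quotient
because the projection is a submersion ([critical_of_stationary],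
[differential_descends]).

Two bodies of theory carry this. Smoothness is given by iterated directional
derivatives; on a space with a finite frame, continuous directional derivatives give
strict differentiability ([C1_strict_diff]), whence the chain rule, the symmetry of
second derivatives and a local surjectivity theorem ([local_surjectivity]). The
exponential map is only known through one-parameter subgroups, whose existence is proved
by taking the limit of the 2 ^ k-th powers of t X / 2 ^ k ([local_exponential],
[homomorphism_exists]); a second-order tangency argument gives uniqueness
([tangent_doubling_unique]), and left-invariance gives smoothness
([homomorphism_smooth]). *)

(** * Classes C^k defined by directional derivatives *)

Section Differentiation.
Context {R : realType}.

Lemma C_on_continuous (V W : normedModType R) k (f : V -> W) A x :
  C_on k f A -> A x -> {for x, continuous f}.
Proof. by case: k => [|k] [+ _] => /[apply]. Qed.

Lemma C_on_derivable (V W : normedModType R) k (f : V -> W) A x v :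
  C_on k.+1 f A -> A x -> derivable f x v.
Proof. by move=> [_ /(_ v)[+ _]] => /[apply]. Qed.

Lemma C_on_derive (V W : normedModType R) k (f : V -> W) A v :
  C_on k.+1 f A -> C_on k ('D_v f) A.
Proof. by move=> [_ /(_ v)[_ +]]. Qed.

Lemma C_on_sub (V W : normedModType R) k (f : V -> W) A B :
  A `<=` B -> C_on k f B -> C_on k f A.
Proof.
move=> AB; elim: k f => [|k IH] f [fc fd]; split=> //.
- by move=> x /AB; exact: fc.
- by move=> x /AB; exact: fc.
- move=> v; have [dv Cv] := fd v; split; first by move=> x /AB; exact: dv.
  exact: IH.
Qed.

Lemma C_onS (V W : normedModType R) k (f : V -> W) A :
  C_on k.+1 f A -> C_on k f A.
Proof.
elim: k f => [|k IH] f [fc fd]; split=> //.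
by move=> v; have [dv Cv] := fd v; split => //; exact: IH.
Qed.

Lemma C_on_ext (V W : normedModType R) k (f g : V -> W) A :
  open A -> (forall x, A x -> f x = g x) -> C_on k f A -> C_on k g A.
Proof.
move=> oA; elim: k f g => [|k IH] f g fg [fc fd].
  have nfg x : A x -> {near x, f =1 g}.
    by move=> Ax; near=> z; apply: fg; near: z; exact: open_nbhs_nbhs.
  split=> // x Ax; rewrite /prop_for /continuous_at -fg//.
  by apply: cvg_trans (fc x Ax); apply: near_eq_cvg; exact: nfg.
have nfg x : A x -> {near x, f =1 g}.
  by move=> Ax; near=> z; apply: fg; near: z; exact: open_nbhs_nbhs.
split.
  move=> x Ax; rewrite /prop_for /continuous_at -fg//.
  by apply: cvg_trans (fc x Ax); apply: near_eq_cvg; exact: nfg.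
move=> v; have [dv Cv] := fd v; split.
  by move=> x Ax; apply: near_eq_derivable (dv x Ax); exact: nfg.
apply: IH Cv => x Ax; apply: near_eq_derive; exact: nfg.
Unshelve. all: by end_near. Qed.

Lemma C_on_cst (V W : normedModType R) k (w : W) (A : set V) :
  C_on k (fun=> w) A.
Proof.
elim: k w => [|k IH] w; split => //; try by move=> x _; exact: cvg_cst.
move=> v; split; first by move=> x _; exact: derivable_cst.
have -> : 'D_v (fun=> w : W) = fun=> 0 :> W by apply/funext => x; exact: derive_cst.
exact: IH.
Qed.

Definition bounded_linear (V W : normedModType R) (L : V -> W) :=
  (forall a x y, L (a *: x + y) = a *: L x + L y) /\
  exists2 K : R, 0 < K & forall x, `|L x| <= K * `|x|.

Section BoundedLinear.
Context {V W : normedModType R} {L : V -> W} (bL : bounded_linear L).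

Lemma bounded_linear0 : L 0 = 0.
Proof.
by case: bL => /(_ (-1) 0 0) + _; rewrite !scaleN1r oppr0 addr0 addNr.
Qed.

Lemma bounded_linearZ a x : L (a *: x) = a *: L x.
Proof.
by case: bL => /(_ a x 0) + _; rewrite addr0 bounded_linear0 addr0.
Qed.

Lemma bounded_linearD x y : L (x + y) = L x + L y.
Proof. by case: bL => /(_ 1 x y) + _; rewrite !scale1r. Qed.

Lemma bounded_linearB x y : L (x - y) = L x - L y.
Proof.
by rewrite bounded_linearD -(scaleN1r y) bounded_linearZ scaleN1r.
Qed.

End BoundedLinear.

Lemma bounded_linear_continuous (V W : normedModType R) (L : V -> W) :
  bounded_linear L -> continuous L.
Proof.
move=> bL x; have [lL [K K0 LK]] := bL; apply/cvgrPdist_lt => e e0.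
near=> y; rewrite -(bounded_linearB bL) (le_lt_trans (LK _))// -ltr_pdivlMl//.
by near: y; apply: cvgr_dist_lt; rewrite // mulr_gt0// invr_gt0.
Unshelve. all: by end_near. Qed.

Lemma is_derive_linear_comp (V W Z : normedModType R) (L : W -> Z) (f : V -> W) x v :
  bounded_linear L -> derivable f x v -> is_derive x v (L \o f) (L ('D_v f x)).
Proof.
move=> bL df; have Lc := bounded_linear_continuous bL.
have [lL _] := bL.
have H : (fun h => h^-1 *: (((L \o f) \o shift x) (h *: v) - (L \o f) x)) @ 0^'
   --> L ('D_v f x).
  have -> : (fun h => h^-1 *: (((L \o f) \o shift x) (h *: v) - (L \o f) x)) =
    L \o (fun h => h^-1 *: ((f \o shift x) (h *: v) - f x)).
    apply/funext => h /=.
    by rewrite (bounded_linearZ bL) (bounded_linearB bL).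
  by apply: cvg_comp; [exact: df|exact: Lc].
by split; [apply/cvg_ex; eexists; exact: H|exact: cvg_lim].
Qed.

Lemma C_on_linear_comp (V W Z : normedModType R) (L : W -> Z) k (f : V -> W) A :
  open A -> bounded_linear L -> C_on k f A -> C_on k (L \o f) A.
Proof.
move=> oA bL; elim: k f => [|k IH] f Cf.
  split=> // x Ax; apply: continuous_comp; first exact: C_on_continuous Cf Ax.
  exact: bounded_linear_continuous.
split.
  move=> x Ax; apply: continuous_comp; first exact: C_on_continuous Cf Ax.
  exact: bounded_linear_continuous.
move=> v; split.
  move=> x Ax; have [] := is_derive_linear_comp bL (C_on_derivable (v:=v) Cf Ax).
  by [].
apply: (C_on_ext oA _ (IH _ (C_on_derive v Cf))) => x Ax.
by have [_ ->] := is_derive_linear_comp bL (C_on_derivable (v:=v) Cf Ax).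
Qed.

Lemma C_on_linear (V W : normedModType R) (L : V -> W) k A :
  bounded_linear L -> C_on k L A.
Proof.
move=> bL; apply: (@C_on_sub _ _ _ _ _ setT) => //.
have Lc := bounded_linear_continuous bL.
have [lL _] := bL.
case: k => [|k]; first by split=> // x _; exact: Lc.
split=> [x _|v]; first exact: Lc.
have H x : (fun h => h^-1 *: ((L \o shift x) (h *: v) - L x)) @ 0^' --> L v.
  apply: cvg_near_cst; near=> h => /=.
  by rewrite lL addrK scalerA mulVf ?scale1r//; near: h; exact: nbhs_dnbhs_neq.
split; first by move=> x _; apply/cvg_ex; eexists; exact: H.
have -> : 'D_v L = fun=> L v by apply/funext => x; apply: cvg_lim => //; exact: H.
exact: C_on_cst.
Unshelve. all: by end_near. Qed.

Lemma C_onD (V W : normedModType R) k (f g : V -> W) A : open A ->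
  C_on k f A -> C_on k g A -> C_on k (fun x => f x + g x) A.
Proof.
move=> oA; elim: k f g => [|k IH] f g Cf Cg.
  by split=> // x Ax; apply: continuousD; [exact: C_on_continuous Cf Ax|exact: C_on_continuous Cg Ax].
split.
  by move=> x Ax; apply: continuousD; [exact: C_on_continuous Cf Ax|exact: C_on_continuous Cg Ax].
move=> v; have df x (Ax : A x) := C_on_derivable (v:=v) Cf Ax.
have dg x (Ax : A x) := C_on_derivable (v:=v) Cg Ax.
split.
  by move=> x Ax; apply: derivableD; [exact: df|exact: dg].
apply: (C_on_ext oA _ (IH _ _ (C_on_derive v Cf) (C_on_derive v Cg))) => x Ax.
by rewrite [RHS]deriveD//; [exact: df|exact: dg].
Qed.

Lemma C_onM (V : normedModType R) k (f g : V -> R) A : open A ->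
  C_on k f A -> C_on k g A -> C_on k (fun x => f x * g x) A.
Proof.
move=> oA; elim: k f g => [|k IH] f g Cf Cg.
  by split=> // x Ax; apply: continuousM; [exact: C_on_continuous Cf Ax|exact: C_on_continuous Cg Ax].
split.
  by move=> x Ax; apply: continuousM; [exact: C_on_continuous Cf Ax|exact: C_on_continuous Cg Ax].
move=> v; have df x (Ax : A x) := C_on_derivable (v:=v) Cf Ax.
have dg x (Ax : A x) := C_on_derivable (v:=v) Cg Ax.
split.
  by move=> x Ax; apply: derivableM; [exact: df|exact: dg].
apply: (C_on_ext oA _ (C_onD oA (IH _ _ (C_onS Cf) (C_on_derive v Cg)) (IH _ _ (C_onS Cg) (C_on_derive v Cf)))) => x Ax.
by rewrite [RHS]deriveM//; [exact: df|exact: dg].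
Qed.

Lemma C_on_sum (V W : normedModType R) k (I : Type) (r : seq I) (f : I -> V -> W) A : open A ->
  (forall i, C_on k (f i) A) -> C_on k (fun x => \sum_(i <- r) f i x) A.
Proof.
move=> oA Cf; elim: r => [|i r IH].
  by apply: (C_on_ext oA _ (C_on_cst _ 0 _)) => x _; rewrite big_nil.
by apply: (C_on_ext oA _ (C_onD oA (Cf i) IH)) => x _; rewrite big_cons.
Qed.

Lemma is_derive_pair (V W Z : normedModType R) (f : V -> W) (g : V -> Z) x v :
  derivable f x v -> derivable g x v ->
  is_derive x v (fun x => (f x, g x)) ('D_v f x, 'D_v g x).
Proof.
move=> df dg.
have H : (fun h => h^-1 *: (((fun x => (f x, g x)) \o shift x) (h *: v) - (f x, g x))) @ 0^'
   --> ('D_v f x, 'D_v g x).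
  exact: (cvg_pair df dg).
by split; [apply/cvg_ex; eexists; exact: H|exact: cvg_lim].
Qed.

Lemma C_on_pair (V W Z : normedModType R) k (f : V -> W) (g : V -> Z) A : open A ->
  C_on k f A -> C_on k g A -> C_on k (fun x => (f x, g x)) A.
Proof.
move=> oA; elim: k f g => [|k IH] f g Cf Cg.
  split=> // x Ax.
  exact: (cvg_pair (C_on_continuous Cf Ax) (C_on_continuous Cg Ax)).
split.
  move=> x Ax; exact: (cvg_pair (C_on_continuous Cf Ax) (C_on_continuous Cg Ax)).
move=> v; have df x (Ax : A x) := C_on_derivable (v:=v) Cf Ax.
have dg x (Ax : A x) := C_on_derivable (v:=v) Cg Ax.
split.
  by move=> x Ax; have [] := is_derive_pair (df _ Ax) (dg _ Ax).
apply: (C_on_ext oA _ (IH _ _ (C_on_derive v Cf) (C_on_derive v Cg))) => x Ax.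
by have [_ ->] := is_derive_pair (df _ Ax) (dg _ Ax).
Qed.

Lemma cvg_rV (T : Type) (F : set_system T) {FF : ProperFilter F} n (f : T -> 'rV[R]_n) (l : 'rV[R]_n) :
  (forall j, (fun x => f x 0 j) @ F --> l 0 j) -> f @ F --> l.
Proof.
move=> fl; apply/cvgrPdist_le => e e0; near=> x.
rewrite /Num.Def.normr/= mx_normrE (bigmax_le _ (ltW e0))//= => -[i j] _ /=.
rewrite ord1 !mxE; move: j; near: x; apply: filter_forall => j.
exact: (cvgrPdist_le _ _).1.
Unshelve. all: by end_near. Qed.

Lemma bounded_linear_coord n (j : 'I_n) : bounded_linear (fun x : 'rV[R]_n => x 0 j).
Proof.
split; first by move=> a x y; rewrite !mxE.
exists 1 => // x; rewrite mul1r [leRHS]/Num.Def.normr/= mx_normrE.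
exact: (le_bigmax _ (fun i : 'I_1 * 'I_n => `|x i.1 i.2|) (ord0, j)).
Qed.

Lemma C_on_rV (V : normedModType R) n k (f : V -> 'rV[R]_n) A : open A ->
  (forall j, C_on k (fun x => f x 0 j) A) -> C_on k f A.
Proof.
move=> oA; elim: k f => [|k IH] f Cf.
  split=> // x Ax; apply: cvg_rV => j; exact: C_on_continuous (Cf j) Ax.
split; first by move=> x Ax; apply: cvg_rV => j; exact: C_on_continuous (Cf j) Ax.
have df v x (Ax : A x) : derivable f x v.
  by apply/derivable_mxP => i j; rewrite ord1; exact: C_on_derivable (Cf j) Ax.
move=> v; split; first by move=> x Ax; exact: df.
apply: IH => j; apply: (C_on_ext oA _ (C_on_derive v (Cf j))) => x Ax.
by rewrite derive_mx ?mxE//; exact: df.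
Qed.

(** * Frames and strict differentiability *)

(** A finite generating family with bounded coordinate forms: the shape of finite
dimension that passes to products without choosing bases. *)
Definition framed (V : normedModType R) := exists N (b : 'I_N -> V) (l : 'I_N -> V -> R),
  (forall i, bounded_linear (l i)) /\ forall v, v = \sum_i l i v *: b i.

Lemma framed_rV n : framed 'rV[R]_n.
Proof.
exists n, (fun i => delta_mx 0 i), (fun i (v : 'rV[R]_n) => v 0 i); split.
  by move=> i; exact: bounded_linear_coord.
by move=> v; exact: row_sum_delta.
Qed.

Lemma framed_R : framed R.
Proof.
exists 1%N, (fun=> 1), (fun i v => v); split.
  by move=> _; split=> //; exists 1 => // x; rewrite mul1r.
by move=> v; rewrite big_ord1 [RHS]mulr1.
Qed.

Lemma bounded_linear_fst (V W : normedModType R) : bounded_linear (fun z : V * W => z.1).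
Proof.
split=> //; exists 1 => // z; rewrite mul1r [leRHS]prod_normE.
by rewrite le_max lexx.
Qed.

Lemma bounded_linear_snd (V W : normedModType R) : bounded_linear (fun z : V * W => z.2).
Proof.
split=> //; exists 1 => // z; rewrite mul1r [leRHS]prod_normE.
by rewrite le_max lexx orbT.
Qed.

Lemma bounded_linear_comp (V W Z : normedModType R) (L : V -> W) (M : W -> Z) :
  bounded_linear L -> bounded_linear M -> bounded_linear (M \o L).
Proof.
move=> [lL [K K0 LK]] [lM [H H0 MH]]; split; first by move=> a x y /=; rewrite lL lM.
exists (H * K); first exact: mulr_gt0.
by move=> x /=; rewrite (le_trans (MH _))// -mulrA ler_pM2l.
Qed.

Lemma framed_prod (V W : normedModType R) :
  framed V -> framed W -> framed (V * W)%type.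
Proof.
move=> [N [b [l [lb lv]]]] [N' [b' [l' [lb' lv']]]].
exists (N + N')%N,
  (fun i => match fintype.split i with inl j => (b j, 0) | inr j => (0, b' j) end),
  (fun i (z : V * W) => match fintype.split i with inl j => l j z.1 | inr j => l' j z.2 end).
split.
  move=> i; case: fintype.split => j.
    exact: (bounded_linear_comp (bounded_linear_fst _ _) (lb j)).
  exact: (bounded_linear_comp (bounded_linear_snd _ _) (lb' j)).
move=> [v w]; rewrite big_split_ord/=.
under eq_bigr => i _.
  rewrite (_ : fintype.split (lshift N' i) = inl i); last exact: (unsplitK (inl i)).
  over.
under [X in _ + X]eq_bigr => i _.
  rewrite (_ : fintype.split (rshift N i) = inr i); last exact: (unsplitK (inr i)).
  over.
rewrite /=.
have E1 : \sum_(i < N) l i v *: ((b i, 0) : V * W) = (v, 0).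
  rewrite [in RHS](lv v); elim/big_rec2: _ => [//|i y1 y2 _ ->].
  by congr pair => /=; rewrite scaler0 addr0.
have E2 : \sum_(i < N') l' i w *: ((0, b' i) : V * W) = (0, w).
  rewrite [in RHS](lv' w); elim/big_rec2: _ => [//|i y1 y2 _ ->].
  by congr pair => /=; rewrite scaler0 addr0.
by rewrite E1 E2; congr pair => /=; rewrite ?addr0 ?add0r.
Qed.

Lemma is_derive_line (V W : normedModType R) (f : V -> W) (x v : V) (t : R) :
  derivable f (x + t *: v) v ->
  is_derive t 1 (fun s : R => f (x + s *: v)) ('D_v f (x + t *: v)).
Proof.
move=> df.
have E : (fun h : R => h^-1 *: (((fun s : R => f (x + s *: v)) \o shift t) (h *: (1 : R)) -
    f (x + t *: v))) = (fun h => h^-1 *: ((f \o shift (x + t *: v)) (h *: v) - f (x + t *: v))).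
  apply/funext => h /=; congr (_ *: (f _ - _)).
  by rewrite [_%:A]mulr1 scalerDl addrCA.
split; first by rewrite /derivable E.
by rewrite /derive E.
Qed.

Lemma MVT_line (V : normedModType R) (f : V -> R) (x v : V) :
  (forall t : R, 0 <= t <= 1 -> derivable f (x + t *: v) v) ->
  exists2 t : R, 0 <= t <= 1 & f (x + v) - f x = 'D_v f (x + t *: v).
Proof.
move=> df.
have [|||t] := @MVT_segment R (fun s => f (x + s *: v))
    (fun s => 'D_v f (x + s *: v)) 0 1.
- by rewrite ler01.
- move=> t; rewrite in_itv/= => /andP[t0 t1].
  by apply: is_derive_line; apply: df; rewrite !ltW.
- apply: continuous_in_subspaceT => t /[1!inE] /=; rewrite in_itv/= => t01.
  apply: differentiable_continuous; apply/derivable1_diffP.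
  by have [] := is_derive_line (df _ t01).
- rewrite in_itv/= => t01; rewrite scale1r scale0r addr0 subr0 mulr1 => E.
  by exists t.
Qed.

(** On the line through x the factor a is a change of variable, so the chain rule on R
applies. *)
Lemma is_derive_scalev (V W : normedModType R) (f : V -> W) (x v : V) (a : R) :
  derivable f x v -> is_derive x (a *: v) f (a *: 'D_v f x).
Proof.
move=> df.
pose g (s : R) := f (x + s *: v).
have E w : (fun h : R => h^-1 *: ((f \o shift x) (h *: w) - f x)) =
   (fun h => h^-1 *: (((fun s : R => f (x + s *: w)) \o shift 0) (h *: (1 : R)) - f (x + (0 : R) *: w))).
  apply/funext => h /=; rewrite scale0r !addr0 [x + _]addrC.
  by rewrite [h *: 1]mulr1.
have dg : differentiable g 0.
  by apply/derivable1_diffP; rewrite /derivable /g -E.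
have gE : 'D_v f x = 'd g 0 1 by rewrite -deriveE// /derive -E.
have Eg : (fun s : R => f (x + s *: (a *: v))) = g \o (fun s : R => a *: s).
  by apply/funext => s /=; rewrite /g scalerA mulrC.
have dga : differentiable (g \o (fun s : R => a *: s)) 0.
  by apply: differentiable_comp => //; rewrite scaler0.
split; first by rewrite /derivable E -/(derivable _ _ _) Eg; apply/derivable1_diffP.
have -> : 'D_(a *: v) f x = 'D_1 (fun s : R => f (x + s *: (a *: v))) 0.
  by rewrite /derive E.
rewrite Eg deriveE; last exact: dga.
rewrite diff_comp; [|by []|by rewrite scaler0].
rewrite diff_val scaler0 gE.
exact: linearZ.
Qed.

Lemma near_normP (V : normedModType R) (x : V) (P : V -> Prop) :
  (\forall z \near x, P z) <->
  exists2 d : R, 0 < d & forall z, `|z - x| < d -> P z.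
Proof.
split.
  move=> /nbhs_normP[d /= d0 dP]; exists d => // z zx; apply: dP => /=.
  by rewrite distrC.
move=> [d d0 dP]; apply/nbhs_normP; exists d => // z /= zx; apply: dP.
by rewrite distrC.
Qed.

Lemma bounded_linear_frame (V : normedModType R) N (c : 'I_N -> R) (l : 'I_N -> V -> R) :
  (forall i, bounded_linear (l i)) -> (forall i, 0 <= c i) ->
  exists2 K : R, 0 < K & forall v, \sum_i `|l i v| * c i <= K * `|v|.
Proof.
move=> bl c0; pose K i := s2val (cid2 (bl i).2).
have K0 i : 0 < K i by rewrite /K; case: cid2.
have KP i v : `|l i v| <= K i * `|v| by rewrite /K; case: cid2.
exists (\sum_i K i * c i + 1).
  by rewrite ltr_wpDl// sumr_ge0// => i _; rewrite mulr_ge0// ltW.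
move=> v; rewrite mulrDl mul1r ler_wpDr//.
by rewrite mulr_suml ler_sum// => i _; rewrite mulrAC ler_wpM2r.
Qed.

(** Mean value theorem along the polygonal path from w to u that changes one frame
coordinate at a time; continuity of the derivatives at x makes the error of each step
small uniformly in both end points. *)
Lemma strict_diff_frame (V : normedModType R) N (b : 'I_N -> V) (l : 'I_N -> V -> R)
  (f : V -> R) (x : V) :
  (forall i, bounded_linear (l i)) -> (forall v, v = \sum_i l i v *: b i) ->
  (\forall z \near x, forall i, derivable f z (b i)) ->
  (forall i, {for x, continuous ('D_(b i) f)}) ->
  forall e : R, 0 < e -> exists2 d : R, 0 < d &
    forall u w, `|u - x| < d -> `|w - x| < d ->
    `|f u - f w - \sum_i l i (u - w) * 'D_(b i) f x| <= e * `|u - w|.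
Proof.
move=> bl lv df cf e e0.
have [K K0 KP] := bounded_linear_frame bl (fun i => addr_ge0 (normr_ge0 (b i)) ler01).
have : \forall z \near x, (forall i, derivable f z (b i)) /\
   (forall i, `|'D_(b i) f x - 'D_(b i) f z| <= e / K).
  near=> z; split; first by near: z.
  move=> i; apply: ltW; move: i; near: z; apply: filter_forall => i.
  by apply: cvgr_dist_lt; [exact: cf|exact: divr_gt0].
move=> /near_normP[d d0 dP].
(* This radius keeps the polygonal path within d of x: it deviates from w by at most
   K |u - w|, and |u - w| is at most twice the radius. *)
exists (d / (1 + 2 * K)); first by rewrite divr_gt0// addr_gt0// mulr_gt0.
move=> u w ux wx.
(* The k-th vertex of the path: the first k coordinates are those of u. *)
pose z (k : nat) := w + \sum_(i < N | (i < k)%N) l i (u - w) *: b i.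
have uw : `|u - w| <= 2 * (d / (1 + 2 * K)).
  rewrite -(subrKA x) mulr_natl mulr2n (le_trans (ler_normD _ _))// lerD ?ltW//.
  by rewrite distrC.
have small (c : 'I_N -> R) : (forall i, `|c i| <= `|l i (u - w)|) ->
    `|w + \sum_i c i *: b i - x| < d.
  move=> cl; rewrite addrAC (le_lt_trans (ler_normD _ _))//.
  have dE : d = d / (1 + 2 * K) + K * (2 * (d / (1 + 2 * K))).
    by field; rewrite gt_eqF// addr_gt0// mulr_gt0.
  rewrite [ltRHS]dE ltr_leD// (le_trans (ler_norm_sum _ _ _))//.
  apply: (@le_trans _ _ (K * `|u - w|)); last by rewrite ler_pM2l.
  apply: le_trans (KP _); apply: ler_sum => i _.
  by rewrite normrZ ler_pM// lerDl.
have step (i : 'I_N) : `|f (z i.+1) - f (z i) - l i (u - w) * 'D_(b i) f x| <=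
   e / K * (`|l i (u - w)| * (`|b i| + 1)).
  have zS : z i.+1 = z i + l i (u - w) *: b i.
    rewrite /z -addrA; congr (_ + _); rewrite (bigD1 i)//= addrC; congr (_ + _).
    by apply: eq_bigl => j; rewrite ltnS [in RHS]ltn_neqAle andbC.
  have zt (t : R) : 0 <= t <= 1 -> `|z i + t *: (l i (u - w) *: b i) - x| < d.
    move=> /andP[t0 t1].
    pose c (j : 'I_N) := if (j < i)%N then l j (u - w) else if j == i then t * l i (u - w) else 0.
    have -> : z i + t *: (l i (u - w) *: b i) = w + \sum_j c j *: b j.
      rewrite /z -addrA; congr (_ + _).
      rewrite [RHS](bigID (fun j : 'I_N => (j < i)%N))/=; congr (_ + _).
        by apply: eq_bigr => j ji; rewrite /c ji.
      rewrite (bigD1 i) ?ltnn//= /c ltnn eqxx scalerA big1 ?addr0// => j /andP[/negbTE -> /negbTE ->].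
      by rewrite scale0r.
    apply: small => j; rewrite /c; case: ifP => // _; case: eqP => [->|_].
      by rewrite normrM ler_piMl// ger0_norm.
    by rewrite normr0.
  have [|t t01 Et] := @MVT_line _ f (z i) (l i (u - w) *: b i).
    move=> t t01; have [Dt _] := dP _ (zt t t01).
    by have [] := is_derive_scalev (l i (u - w)) (Dt i).
  have [Dt bt] := dP _ (zt t t01).
  have [_ DE] := is_derive_scalev (l i (u - w)) (Dt i).
  rewrite zS Et DE -mulrBr normrM mulrCA ler_wpM2l//.
  rewrite distrC (le_trans (bt i))// ler_peMr ?lerDr//.
  by rewrite divr_ge0// ltW.
have zN : z N = u.
  rewrite /z; under eq_bigl do rewrite ltn_ord.
  by rewrite -lv addrC subrK.
have z0 : z 0%N = w by rewrite /z big_pred0 ?addr0.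
have -> : f u - f w = \sum_(i < N) (f (z i.+1) - f (z i)).
  by rewrite -zN -[in LHS]z0 -(big_mkord predT (fun i => f (z i.+1) - f (z i))) telescope_sumr.
rewrite -sumrB (le_trans (ler_norm_sum _ _ _))//.
apply: (@le_trans _ _ (\sum_i e / K * (`|l i (u - w)| * (`|b i| + 1)))).
  exact: ler_sum.
by rewrite -mulr_sumr -mulrA ler_pM2l// ler_pdivrMl.
Unshelve. all: by end_near. Qed.

Lemma bounded_linear_diff (V W : normedModType R) (f : V -> W) x :
  differentiable f x -> bounded_linear ('d f x).
Proof.
move=> df; split; first by move=> a u w; rewrite linearP.
have /linear_bounded_continuous/linear_boundedP : continuous ('d f x).
  exact: diff_continuous.
move=> H; near +oo_R => r; exists r => //; near: r.
exact: H.
Unshelve. all: by end_near. Qed.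

Lemma differentiable_estimate (V W : normedModType R) (f : V -> W) x :
  differentiable f x -> forall e : R, 0 < e ->
  \forall u \near x, `|f u - f x - 'd f x (u - x)| <= e * `|u - x|.
Proof.
move=> /diff_locally/eqaddoP + e e0 => /(_ e e0).
rewrite [X in _ -> X](near_shift (0 : V) x) /=; apply: filterS => u /=.
by rewrite !fctE /= subr0 addrK opprD addrA.
Qed.

Lemma differentiable_of_estimate (V W : normedModType R) (f L : V -> W) x :
  bounded_linear L ->
  (forall e : R, 0 < e ->
    \forall u \near x, `|f u - f x - L (u - x)| <= e * `|u - x|) ->
  differentiable f x /\ 'd f x = L :> (V -> W).
Proof.
move=> bL H; have Lc := bounded_linear_continuous bL.
have lin : linear L by case: bL.
pose lL := GRing.isLinear.Build _ _ _ _ _ lin.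
pose LL : {linear _ -> _} := HB.pack L lL.
have E : f \o shift x = cst (f x) + LL +o_ 0 id.
  apply/eqaddoP => e e0; have := H e e0.
  rewrite (near_shift 0) /=; apply: filterS => u /=.
  by rewrite !fctE /= subr0 addrK opprD addrA.
have D : 'd f x = LL :> (V -> W) by apply: diff_unique.
split; last by rewrite D.
by apply/diff_locallyP; rewrite D; split.
Qed.

(** Differentiability with both end points free. It yields the local Lipschitz and
contraction estimates that differentiability at x alone does not. *)
Definition strict_diff (V W : normedModType R) (f L : V -> W) (x : V) :=
  forall e : R, 0 < e -> \forall z \near (x, x),
    `|f z.1 - f z.2 - L (z.1 - z.2)| <= e * `|z.1 - z.2|.

Lemma strict_diff_differentiable (V W : normedModType R) (f L : V -> W) x :
  bounded_linear L -> strict_diff f L x ->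
  differentiable f x /\ 'd f x = L :> (V -> W).
Proof.
move=> bL sL; apply: differentiable_of_estimate => // e e0.
have [[P Q]/= [Px Qx]] := sL e e0.
move=> PQ; near=> u; apply: (PQ (u, x)); split => /=; first by near: u.
exact: nbhs_singleton.
Unshelve. all: by end_near. Qed.

Lemma C_on_near (V W : normedModType R) k (f : V -> W) A x v : open A ->
  C_on k.+1 f A -> A x -> \forall z \near x, derivable f z v.
Proof.
move=> oA Cf Ax; near=> z; apply: C_on_derivable Cf _; near: z.
exact: open_nbhs_nbhs.
Unshelve. all: by end_near. Qed.

Lemma C1_strict_diffR (V : normedModType R) (f : V -> R) (A : set V) x :
  framed V -> open A -> C_on 1 f A -> A x ->
  differentiable f x /\ strict_diff f ('d f x) x.
Proof.
move=> [N [b [l [bl lv]]]] oA Cf Ax.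
have H := @strict_diff_frame _ _ b l f x bl lv.
have H1 : \forall z \near x, forall i, derivable f z (b i).
  by apply: filter_forall => i; exact: C_on_near Cf Ax.
have H2 i : {for x, continuous ('D_(b i) f)}.
  exact: C_on_continuous (C_on_derive (b i) Cf) Ax.
pose L v := \sum_i l i v * 'D_(b i) f x.
have bL : bounded_linear L.
  split.
    move=> a u v; rewrite /L scaler_sumr -big_split/=; apply: eq_bigr => i _.
    by rewrite (bl i).1 mulrDl scalerAl.
  have [K K0 KP] := bounded_linear_frame bl (fun i => normr_ge0 ('D_(b i) f x)).
  exists K => // v; apply: le_trans (KP v); rewrite (le_trans (ler_norm_sum _ _ _))//.
  by apply: ler_sum => i _; rewrite normrM.
have sL : strict_diff f L x.
  move=> e e0; have [d d0 dP] := H H1 H2 e e0.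
  near=> z; apply: dP; rewrite distrC; near: z; rewrite near_nbhs.
    by exists (ball x d, setT) => /=; [split; [exact: nbhsx_ballx|exact: filterT]|
       move=> z [/= + _]; rewrite -ball_normE].
  by exists (setT, ball x d) => /=; [split; [exact: filterT|exact: nbhsx_ballx]|
       move=> z [/= _ +]; rewrite -ball_normE].
have [df ->] := strict_diff_differentiable bL sL.
by split.
Unshelve. all: by end_near. Qed.

Lemma C1_strict_diff (V : normedModType R) n (f : V -> 'rV[R]_n) (A : set V) x :
  framed V -> open A -> C_on 1 f A -> A x ->
  differentiable f x /\ strict_diff f ('d f x) x.
Proof.
move=> fV oA Cf Ax.
have Cj j : C_on 1 (fun z => f z 0 j) A.
  exact: (C_on_linear_comp oA (bounded_linear_coord j) Cf).
have Dj j := C1_strict_diffR fV oA (Cj j) Ax.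
pose L v := \row_j 'd (fun z => f z 0 j) x v.
have bL : bounded_linear L.
  split.
    by move=> a u v; apply/rowP => j; rewrite !mxE linearP.
  have bj j := bounded_linear_diff (Dj j).1.
  have [K K0 KP] := bounded_linear_frame bj (fun=> ler01).
  exists K => // v; apply: le_trans (KP v).
  rewrite [leLHS]/Num.Def.normr/= mx_normrE; apply: bigmax_le => /=.
    by apply: sumr_ge0 => j _; rewrite mulr1.
  move=> [i j] _; rewrite mxE (bigD1 j)//= mulr1 lerDl.
  by apply: sumr_ge0 => k _; rewrite mulr1.
have sL : strict_diff f L x.
  move=> e e0; near=> z.
  rewrite [leLHS]/Num.Def.normr/= mx_normrE; apply: bigmax_le => /=.
    by rewrite mulr_ge0// ltW.
  move=> [i j] _; rewrite !mxE ord1 /=; move: j; near: z; apply: filter_forall => j.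
  exact: (Dj j).2.
have [df ->] := strict_diff_differentiable bL sL.
by split.
Unshelve. all: by end_near. Qed.

Lemma C1_differentiable (V : normedModType R) n (f : V -> 'rV[R]_n) (A : set V) k x :
  framed V -> open A -> C_on k.+1 f A -> A x -> differentiable f x.
Proof.
move=> fV oA Cf Ax; apply: (C1_strict_diff fV oA _ Ax).1.
by elim: k Cf => // k IH /C_onS.
Qed.

Lemma C1_differentiableR (V : normedModType R) (f : V -> R) (A : set V) k x :
  framed V -> open A -> C_on k.+1 f A -> A x -> differentiable f x.
Proof.
move=> fV oA Cf Ax; apply: (C1_strict_diffR fV oA _ Ax).1.
by elim: k Cf => // k IH /C_onS.
Qed.

(** Restricting f to the line through x in the direction v reduces this to the chain rule
for differentiable functions on R. *)
Lemma is_derive_comp (V W Z : normedModType R) (f : V -> W) (g : W -> Z) x v :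
  derivable f x v -> differentiable g (f x) ->
  is_derive x v (g \o f) ('d g (f x) ('D_v f x)).
Proof.
move=> df dg.
have E (Y : normedModType R) (h : V -> Y) : (fun a : R => a^-1 *: ((h \o shift x) (a *: v) - h x)) =
   (fun a : R => a^-1 *: (((fun s : R => h (x + s *: v)) \o shift 0) (a *: (1 : R)) - h (x + (0 : R) *: v))).
  apply/funext => a /=; rewrite scale0r !addr0 [x + _]addrC.
  by rewrite [a *: 1]mulr1.
pose p (s : R) := f (x + s *: v).
have dp : differentiable p 0.
  by apply/derivable1_diffP; rewrite /derivable /p -E.
have p0 : p 0 = f x by rewrite /p scale0r addr0.
have dgp : differentiable (g \o p) 0.
  by apply: differentiable_comp; rewrite ?p0.
split; first by rewrite /derivable E; apply/derivable1_diffP.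
have -> : 'D_v (g \o f) x = 'D_1 (g \o p) 0 by rewrite /derive E.
have -> : 'D_v f x = 'D_1 p 0 by rewrite /derive E.
rewrite deriveE; last exact: dgp.
by rewrite diff_comp ?p0// deriveE.
Qed.

(** The derivative of the composite along v is the sum over a frame of W of
[l i ('D_v f)] times ['D_(b i) g \o f], products of functions that are of class C^k by
induction. *)
Lemma C_on_compR (V W : normedModType R) k (f : V -> W) (g : W -> R) A B :
  framed W -> open A -> open B -> (forall x, A x -> B (f x)) ->
  C_on k f A -> C_on k g B -> C_on k (g \o f) A.
Proof.
move=> fW oA oB AB; have [N [b [l [bl lv]]]] := fW.
elim: k g => [|k IH] g Cf Cg.
  split=> // x Ax; apply: continuous_comp; first exact: C_on_continuous Cf Ax.
  exact: C_on_continuous Cg (AB _ Ax).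
split.
  move=> x Ax; apply: continuous_comp; first exact: C_on_continuous Cf Ax.
  exact: C_on_continuous Cg (AB _ Ax).
move=> v.
have dg x (Ax : A x) : differentiable g (f x).
  exact: C1_differentiableR fW oB Cg (AB _ Ax).
have H x (Ax : A x) : is_derive x v (g \o f) (\sum_i l i ('D_v f x) * 'D_(b i) g (f x)).
  have [D1 D2] := is_derive_comp (C_on_derivable (v:=v) Cf Ax) (dg x Ax).
  split=> //; rewrite D2 [in LHS](lv ('D_v f x)) linear_sum; apply: eq_bigr => i _.
  by rewrite linearZ/= (deriveE _ (dg x Ax)).
split; first by move=> x Ax; have [] := H x Ax.
have C : C_on k (fun x => \sum_i l i ('D_v f x) * 'D_(b i) g (f x)) A.
  apply: C_on_sum => // i; apply: C_onM => //.
    apply: (C_on_linear_comp oA (bl i)); exact: C_on_derive Cf.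
  by apply: (IH ('D_(b i) g)); [exact: C_onS|exact: C_on_derive].
by apply: (C_on_ext oA _ C) => x Ax; have [_ ->] := H x Ax.
Qed.

Lemma C_on_comp (V W : normedModType R) n k (f : V -> W) (g : W -> 'rV[R]_n) A B :
  framed W -> open A -> open B -> (forall x, A x -> B (f x)) ->
  C_on k f A -> C_on k g B -> C_on k (g \o f) A.
Proof.
move=> fW oA oB AB Cf Cg; apply: C_on_rV => // j.
apply: (@C_on_compR _ _ _ f (fun y => g y 0 j) A B) => //.
exact: (C_on_linear_comp oB (bounded_linear_coord j) Cg).
Qed.

Lemma is_derive_translate (V W : normedModType R) (f : V -> W) (x c v : V) :
  derivable f (x + c) v -> is_derive x v (fun z => f (z + c)) ('D_v f (x + c)).
Proof.
move=> df.
have E : (fun h : R => h^-1 *: (((fun z => f (z + c)) \o shift x) (h *: v) -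
    f (x + c))) = (fun h => h^-1 *: ((f \o shift (x + c)) (h *: v) - f (x + c))).
  by apply/funext => h /=; rewrite addrA.
split; first by rewrite /derivable E.
by rewrite /derive E.
Qed.

(** The second difference of f along u and v is symmetric in u and v. The mean value
theorem turns it into an increment of a first derivative, and strict differentiability
of that derivative evaluates it up to o(h ^ 2) in either order. *)
Lemma C2_derive_sym (V : normedModType R) (f : V -> R) (A : set V) x u v :
  framed V -> open A -> C_on 2 f A -> A x -> 'D_u ('D_v f) x = 'D_v ('D_u f) x.
Proof.
move=> fV oA Cf Ax.
(* The second difference of f at x with steps h a and h b. *)
pose Dl (a b : V) (h : R) := f (x + h *: a + h *: b) - f (x + h *: a) - f (x + h *: b) + f x.
have DlC a b h : Dl a b h = Dl b a h.
  rewrite /Dl [x + _ + _]addrAC; congr (_ + _); exact: addrAC.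
have key (a b : V) (e : R) : 0 < e ->
    \forall h \near (0 : R), `|Dl a b h - h ^+ 2 * 'D_a ('D_b f) x| <= e * h ^+ 2.
  move=> e0.
  have [df sf] := C1_strict_diffR fV oA (C_on_derive b Cf) Ax.
  have : 0 < e / (`|a| + 1) by rewrite divr_gt0// ltr_wpDl.
  move=> /sf [[P Q]/= [/near_normP[d1 d10 d1P] /near_normP[d2 d20 d2P]] PQ].
  have /near_normP[d3 d30 d3P] : \forall z \near x, A z by exact: open_nbhs_nbhs.
  have hs : \forall h \near (0 : R), `|h| < Num.min d1 (Num.min d2 d3) / (`|a| + `|b| + 1).
    apply: nbhs0_lt.
    by rewrite divr_gt0 ?lt_min ?d10 ?d20// ltr_wpDl// addr_ge0.
  near=> h.
  have hab : `|h| * (`|a| + `|b| + 1) < Num.min d1 (Num.min d2 d3).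
    rewrite -ltr_pdivlMr; last by rewrite ltr_wpDl// addr_ge0.
    by near: h.
  have nb (s t : R) : 0 <= s <= 1 -> 0 <= t <= 1 ->
      `|x + (s * h) *: a + t *: (h *: b) - x| < Num.min d1 (Num.min d2 d3).
    move=> /andP[s0 s1] /andP[t0 t1]; apply: le_lt_trans hab.
    rewrite addrAC [x + _]addrC addrK (le_trans (ler_normD _ _))//.
    rewrite !normrZ (ger0_norm s0) (ger0_norm t0).
    have H1 : s * (`|h| * `|a|) <= `|h| * `|a| by rewrite ler_piMl// mulr_ge0.
    have H2 : t * (`|h| * `|b|) <= `|h| * `|b| by rewrite ler_piMl// mulr_ge0.
    have H3 := normr_ge0 h.
    by lra.
  have I0 : (0 <= (0 : R) <= 1) by rewrite lexx ler01.
  have I1 : (0 <= (1 : R) <= 1) by rewrite lexx ler01.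
  have mm (d : V) : `|d| < Num.min d1 (Num.min d2 d3) -> [/\ `|d| < d1, `|d| < d2 & `|d| < d3] :> Prop.
    by rewrite !lt_min => /andP[-> /andP[-> ->]].
  have Az (t s : R) : 0 <= s <= 1 -> 0 <= t <= 1 -> A (x + t *: (h *: b) + s *: (h *: a)).
    move=> s01 t01; apply: d3P; have [_ _] := mm _ (nb s t s01 t01).
    by rewrite -scalerA [x + s *: _ + _]addrAC.
  have Dg t : 0 <= t <= 1 -> is_derive (x + t *: (h *: b)) (h *: b) (fun z => f (z + h *: a) - f z)
      (h * ('D_b f (x + t *: (h *: b) + h *: a) - 'D_b f (x + t *: (h *: b)))).
    move=> t01; rewrite mulrBr; apply: is_deriveB.
      have := Az t 1 I1 t01; rewrite scale1r => A1.
      have D1 := C_on_derivable (v := b) Cf A1.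
      have [D2 D3] := is_derive_scalev h D1.
      by have := is_derive_translate D2; rewrite D3.
    have := Az t 0 I0 t01; rewrite scale0r addr0 => A1.
    exact: is_derive_scalev (C_on_derivable (v := b) Cf A1).
  have [|t t01] := @MVT_line _ (fun z => f (z + h *: a) - f z) x (h *: b).
    by move=> t /Dg[].
  have [_ ->] := Dg t t01 => E.
  have -> : Dl a b h = h * ('D_b f (x + t *: (h *: b) + h *: a) - 'D_b f (x + t *: (h *: b))).
    by rewrite -E /Dl [x + h *: a + h *: b]addrAC; ring.
  rewrite expr2 -mulrA -mulrBr normrM.
  have := PQ (x + t *: (h *: b) + h *: a, x + t *: (h *: b)).
  rewrite /= [X in 'd _ _ X](_ : _ = h *: a); last by rewrite addrC addKr.
  rewrite [X in _ * `|X|](_ : _ = h *: a); last by rewrite addrC addKr.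
  have -> : 'd ('D_b f) x (h *: a) = h * 'D_a ('D_b f) x by rewrite linearZ/= (deriveE _ df).
  move=> H.
  have {}H : `|'D_b f (x + t *: (h *: b) + h *: a) - 'D_b f (x + t *: (h *: b)) -
      h * 'D_a ('D_b f) x| <= e / (`|a| + 1) * `|h *: a|.
    apply: H; split => /=.
      apply: d1P; have [+ _ _] := mm _ (nb 1 t I1 t01).
      by rewrite mul1r [x + h *: a + _]addrAC.
    apply: d2P; have [_ + _] := mm _ (nb 0 t I0 t01).
    by rewrite mul0r scale0r addr0.
  apply: (@le_trans _ _ (`|h| * (e / (`|a| + 1) * `|h *: a|))).
    by rewrite ler_wpM2l.
  rewrite normrZ.
  have -> : e * (h * h) = e * (`|h| * `|h|).
    by rewrite -normrM ger0_norm// -expr2 sqr_ge0.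
  rewrite [leLHS](_ : _ = e * (`|h| * `|h|) * (`|a| / (`|a| + 1))); last by ring.
  rewrite ler_piMr ?mulr_ge0//; first exact: ltW.
  by rewrite ler_pdivrMr ?ltr_wpDl// mul1r lerDl.
have K1 := key u v; have K2 := key v u.
have {DlC} D12 h := DlC u v h.
move: (Dl u v) (Dl v u) ('D_u ('D_v f) x) ('D_v ('D_u f) x) D12 K1 K2 => d1 d2 a b D12 K1 K2.
apply/eqP; rewrite -subr_eq0 -normr_le0; apply/ler_addgt0Pr => e e0.
rewrite add0r.
have e2 : 0 < e / 2 by rewrite divr_gt0.
have k1 := nbhs_dnbhs (K1 _ e2); have k2 := nbhs_dnbhs (K2 _ e2).
have hn : \forall h \near (0 : R)^', h != 0 by exact: nbhs_dnbhs_neq.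
have [h [[hN0 {}k1] {}k2]] := filter_ex (filterI (filterI hn k1) k2).
have h0 : 0 < h ^+ 2 by rewrite exprn_even_gt0.
rewrite -(ler_pM2l h0) -[X in X * `|_|](ger0_norm (ltW h0)) -normrM mulrBr.
rewrite -(subrKA (d1 h)) (le_trans (ler_normD _ _))// {2}D12 distrC.
lra.
Unshelve. all: by end_near. Qed.

(** * Smoothness at a point *)

Section SmoothAt.

Definition smooth_at (V W : normedModType R) (f : V -> W) (x : V) :=
  exists2 A : set V, open A /\ A x & smooth_on f A.

Context {V W : normedModType R}.
Implicit Types (f g : V -> W) (x : V).

Lemma smooth_at_near_on f (A : set V) x :
  (\forall z \near x, A z) -> smooth_on f A -> smooth_at f x.
Proof.
move=> nA sf; exists A^°; first by split; [exact: open_interior|].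
by move=> k; apply: C_on_sub (sf k); exact: interior_subset.
Qed.

Lemma smooth_at_near f x : smooth_at f x -> \forall z \near x, smooth_at f z.
Proof.
move=> [A [oA Ax] sf]; near=> z; exists A => //; split=> //.
by near: z; exact: open_nbhs_nbhs.
Unshelve. all: by end_near. Qed.

(** The derivatives in [C_on] are those of f on the whole space, so that the condition
is a conjunction over the points of A. *)
Lemma C_on_pointwise k f A :
  (forall x, A x -> C_on k f [set x]) -> C_on k f A.
Proof.
elim: k f => [|k IH] f Cf.
  by split=> // x Ax; apply: C_on_continuous (Cf _ Ax) _.
split; first by move=> x Ax; apply: C_on_continuous (Cf _ Ax) _.
move=> v; split; first by move=> x Ax; apply: C_on_derivable (Cf _ Ax) _.
by apply: IH => x Ax; exact: C_on_derive (Cf _ Ax).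
Qed.

Lemma smooth_at_on f A : (forall x, A x -> smooth_at f x) -> smooth_on f A.
Proof.
move=> H k; apply: C_on_pointwise => x /H[B [oB Bx] sf].
by apply: C_on_sub (sf k) => _ ->.
Qed.

Lemma smooth_at_ext f g x :
  (\forall z \near x, f z = g z) -> smooth_at f x -> smooth_at g x.
Proof.
move=> fg [A [oA Ax] sf].
exists (A `&` [set z | f z = g z]^°).
  by split; [apply: openI => //; exact: open_interior|split].
move=> k; apply: (C_on_ext (f := f)).
- by apply: openI => //; exact: open_interior.
- by move=> z [_ /interior_subset].
- by apply: C_on_sub (sf k) => z [].
Qed.

Lemma smooth_at_continuous f x : smooth_at f x -> {for x, continuous f}.
Proof. by move=> [A [oA Ax] /(_ 0%N)/C_on_continuous]; apply. Qed.

Lemma smooth_at_derivable f x v : smooth_at f x -> derivable f x v.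
Proof. by move=> [A [oA Ax] /(_ 1%N)/C_on_derivable]; apply. Qed.

Lemma smooth_at_derive f x v : smooth_at f x -> smooth_at ('D_v f) x.
Proof.
by move=> [A [oA Ax] sf]; exists A => // k; exact: C_on_derive (sf k.+1).
Qed.

Lemma smooth_at_cst (w : W) x : smooth_at (fun=> w) x.
Proof.
by exists setT; [split=> //; exact: openT|move=> k; exact: C_on_cst].
Qed.

Lemma smooth_at_linear (L : V -> W) x : bounded_linear L -> smooth_at L x.
Proof.
by move=> bL; exists setT; [split=> //; exact: openT|move=> k; exact: C_on_linear].
Qed.

Lemma smooth_atD f g x :
  smooth_at f x -> smooth_at g x -> smooth_at (fun z => f z + g z) x.
Proof.
move=> [A [oA Ax] sf] [B [oB Bx] sg].
exists (A `&` B); first by split; [exact: openI|].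
move=> k; apply: C_onD; first exact: openI.
  by apply: C_on_sub (sf k) => z [].
by apply: C_on_sub (sg k) => z [].
Qed.

Lemma smooth_at_sum (I : Type) (r : seq I) (f : I -> V -> W) x :
  (forall i, smooth_at (f i) x) -> smooth_at (fun z => \sum_(i <- r) f i z) x.
Proof.
move=> sf; elim: r => [|i r IH].
  by apply: smooth_at_ext (smooth_at_cst 0 x); near=> z; rewrite big_nil.
apply: smooth_at_ext (smooth_atD (sf i) IH); near=> z; by rewrite big_cons.
Unshelve. all: by end_near. Qed.

End SmoothAt.

Lemma smooth_atM (V : normedModType R) (f g : V -> R) x :
  smooth_at f x -> smooth_at g x -> smooth_at (fun z => f z * g z) x.
Proof.
move=> [A [oA Ax] sf] [B [oB Bx] sg].
exists (A `&` B); first by split; [exact: openI|].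
move=> k; apply: C_onM; first exact: openI.
  by apply: C_on_sub (sf k) => z [].
by apply: C_on_sub (sg k) => z [].
Qed.

Lemma smooth_at_pair (V W Z : normedModType R) (f : V -> W) (g : V -> Z) x :
  smooth_at f x -> smooth_at g x -> smooth_at (fun z => (f z, g z)) x.
Proof.
move=> [A [oA Ax] sf] [B [oB Bx] sg].
exists (A `&` B); first by split; [exact: openI|].
move=> k; apply: C_on_pair; first exact: openI.
  by apply: C_on_sub (sf k) => z [].
by apply: C_on_sub (sg k) => z [].
Qed.

Lemma smooth_at_rV (V : normedModType R) n (f : V -> 'rV[R]_n) x :
  (forall j, smooth_at (fun z => f z 0 j) x) -> smooth_at f x.
Proof.
move=> sf; pose A j := s2val (cid2 (sf j)).
have A1 j : open (A j) /\ A j x by rewrite /A; case: cid2.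
have A2 j : smooth_on (fun z => f z 0 j) (A j) by rewrite /A; case: cid2.
have AN : \forall z \near x, forall j, A j z.
  by apply: filter_forall => j; apply: open_nbhs_nbhs; exact: A1.
exists [set z | forall j, A j z]^°; first by split; [exact: open_interior|].
move=> k; apply: C_on_rV; first exact: open_interior.
by move=> j; apply: C_on_sub (A2 j k) => z /interior_subset; exact.
Qed.

Lemma smooth_at_coord (V : normedModType R) n (f : V -> 'rV[R]_n) x j :
  smooth_at f x -> smooth_at (fun z => f z 0 j) x.
Proof.
move=> [A [oA Ax] sf]; exists A => // k.
exact: (C_on_linear_comp oA (bounded_linear_coord j) (sf k)).
Qed.

Lemma smooth_at_compR (V W : normedModType R) (f : V -> W) (g : W -> R) x :
  framed W -> smooth_at f x -> smooth_at g (f x) -> smooth_at (g \o f) x.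
Proof.
move=> fW sf [B [oB Bx] sg].
have nB : \forall z \near x, B (f z).
  by apply: (smooth_at_continuous sf); exact: open_nbhs_nbhs.
have [A [oA Ax] sfA] := sf.
exists (A `&` [set z | B (f z)]^°).
  by split; [apply: openI => //; exact: open_interior|].
move=> k; apply: (@C_on_compR _ _ _ f g _ B) => //.
- by apply: openI => //; exact: open_interior.
- by move=> z [_ /interior_subset].
- by apply: C_on_sub (sfA k) => z [].
Qed.

Lemma smooth_at_comp (V W : normedModType R) n (f : V -> W) (g : W -> 'rV[R]_n) x :
  framed W -> smooth_at f x -> smooth_at g (f x) -> smooth_at (g \o f) x.
Proof.
move=> fW sf sg; apply: smooth_at_rV => j.
by apply: (@smooth_at_compR _ _ f (fun z => g z 0 j)) => //; exact: smooth_at_coord.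
Qed.

Lemma smooth_at_diff (V : normedModType R) n (f : V -> 'rV[R]_n) x :
  framed V -> smooth_at f x -> differentiable f x.
Proof.
by move=> fV [A [oA Ax] sf]; exact: C1_differentiable fV oA (sf 1%N) Ax.
Qed.

Lemma smooth_at_diffR (V : normedModType R) (f : V -> R) x :
  framed V -> smooth_at f x -> differentiable f x.
Proof.
by move=> fV [A [oA Ax] sf]; exact: C1_differentiableR fV oA (sf 1%N) Ax.
Qed.

Lemma smooth_at_strict (V : normedModType R) n (f : V -> 'rV[R]_n) x :
  framed V -> smooth_at f x -> strict_diff f ('d f x) x.
Proof.
by move=> fV [A [oA Ax] sf]; exact: (C1_strict_diff fV oA (sf 1%N) Ax).2.
Qed.

Lemma smooth_at_derive_symR (V : normedModType R) (f : V -> R) x u v :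
  framed V -> smooth_at f x -> 'D_u ('D_v f) x = 'D_v ('D_u f) x.
Proof.
by move=> fV [A [oA Ax] sf]; exact: C2_derive_sym fV oA (sf 2%N) Ax.
Qed.

Lemma derive_coord (V : normedModType R) n (f : V -> 'rV[R]_n) x v j :
  derivable f x v -> 'D_v f x 0 j = 'D_v (fun z => f z 0 j) x.
Proof. by move=> df; rewrite derive_mx// mxE. Qed.

Lemma smooth_at_derive_sym (V : normedModType R) n (f : V -> 'rV[R]_n) x u v :
  framed V -> smooth_at f x -> 'D_u ('D_v f) x = 'D_v ('D_u f) x.
Proof.
move=> fV sf; apply/rowP => j.
have E a b : 'D_a ('D_b f) x 0 j = 'D_a ('D_b (fun z => f z 0 j)) x.
  rewrite derive_coord; last exact: smooth_at_derivable (smooth_at_derive b sf).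
  apply: near_eq_derive; near=> z; apply: derive_coord; apply: smooth_at_derivable.
  by near: z; exact: smooth_at_near.
apply: (etrans (E u v)); apply: esym; apply: (etrans (E v u)).
exact: smooth_at_derive_symR fV (smooth_at_coord j sf).
Unshelve. all: by end_near. Qed.

End Differentiation.

(** * Local surjectivity *)

HB.instance Definition _ (R : realType) (m n : nat) :=
  Uniform_isComplete.Build 'M[R]_(m, n) cauchy_cvg.

Section LocalSurjectivity.
Context {R : realType}.

Lemma bounded_linear_id (V : normedModType R) : bounded_linear (@id V).
Proof. by split=> //; exists 1 => // x; rewrite mul1r. Qed.

Lemma bounded_linear_scalel (V : normedModType R) (v : V) : bounded_linear (fun t : R => t *: v).
Proof.
split; first by move=> a x y; rewrite scalerDl scalerA.
exists (`|v| + 1); first by rewrite ltr_wpDl.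
by move=> x; rewrite normrZ mulrC ler_wpM2r// lerDl.
Qed.

Lemma smooth_at_id (V : normedModType R) (x : V) : smooth_at id x.
Proof. exact: smooth_at_linear (bounded_linear_id V). Qed.

Lemma smooth_at_line (V : normedModType R) (x v : V) t : smooth_at (fun t : R => x + t *: v) t.
Proof.
apply: smooth_atD; first exact: smooth_at_cst.
exact: smooth_at_linear (bounded_linear_scalel v).
Qed.

(** In a frame, the differential applied to v is the sum of [l i v] times
['D_(b i) f], which is smooth in both arguments. *)
Lemma smooth_at_diff_apply (V : normedModType R) n (f : V -> 'rV[R]_n) (x v : V) :
  framed V -> smooth_at f x -> smooth_at (fun p : V * V => 'd f (p.1 : V) p.2) (x, v).
Proof.
move=> fV sf; have [N [b [l [bl lv]]]] := fV.
apply: smooth_at_rV => j.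
apply: (@smooth_at_ext _ _ _ (fun p : V * V => \sum_i l i p.2 * 'D_(b i) f p.1 0 j)).
  have : \forall p \near (x, v), smooth_at f p.1.
    exists ([set z | smooth_at f z], setT) => /=; last by move=> z [].
    by split; [exact: smooth_at_near|exact: filterT].
  apply: filterS => p sp; have df := smooth_at_diff fV sp.
  rewrite [in RHS](lv p.2) linear_sum summxE; apply: eq_bigr => i _.
  by rewrite linearZ mxE (deriveE _ df).
apply: smooth_at_sum => i; apply: smooth_atM.
  exact: smooth_at_linear (bounded_linear_comp (bounded_linear_snd _ _) (bl i)).
apply: smooth_at_coord.
apply: (@smooth_at_comp _ _ _ _ (fun p : V * V => p.1) ('D_(b i) f)) => //.
  exact: smooth_at_linear (bounded_linear_fst _ _).
exact: smooth_at_derive.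
Qed.

(** By the mean value theorem the error is u times an increment of the derivative, which
is Lipschitz at 0. *)
Lemma derivative_quad (f : R -> R) : smooth_at f (0 : R) ->
  exists2 C : R, 0 < C & \forall u \near (0 : R), `|f u - f 0 - u * 'D_1 f 0| <= C * u ^+ 2.
Proof.
move=> sf; have sD := smooth_at_derive (1 : R) sf.
have dD := smooth_at_diffR framed_R sD.
exists (`|'d ('D_1 f) (0 : R) (1 : R)| + 1); first by rewrite ltr_wpDl.
have H1 := differentiable_estimate dD ltr01.
have /near_normP[d d0 dP] : \forall u \near (0 : R), smooth_at f u /\
   `|'D_1 f u - 'D_1 f 0| <= (`|'d ('D_1 f) (0 : R) (1 : R)| + 1) * `|u|.
  apply: filterI; first exact: (smooth_at_near sf).
  apply: filterS H1 => u; rewrite subr0 mul1r => H.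
  rewrite -[X in `|X|](subrK ('d ('D_1 f) (0 : R) u)) (le_trans (ler_normD _ _))//.
  rewrite mulrDl mul1r addrC lerD// -[u in 'd _ _ u]mulr1.
  by rewrite [X in `|X|]linearZ normrM mulrC.
apply/near_normP; exists d => // u; rewrite subr0 => ud.
have ub t : 0 <= t <= 1 -> `|t * u| < d.
  by move=> /andP[t0 t1]; rewrite (le_lt_trans _ ud)// normrM ger0_norm// ler_piMl.
have [|t t01] := @MVT_line _ _ f 0 u.
  move=> t t01; rewrite add0r; have [|+ _] := dP (t *: u); last exact: smooth_at_derivable.
  by rewrite subr0; exact: ub.
rewrite !add0r => ->.
have [|st bt] := dP (t *: u); first by rewrite subr0; exact: ub.
have := is_derive_scalev u (smooth_at_derivable (v := 1 : R) st); rewrite [u *: 1]mulr1 => -[_ ->].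
rewrite -mulrBr normrM -(real_normK (num_real u)) expr2 mulrCA ler_wpM2l//.
apply: (le_trans bt); rewrite ler_wpM2l//.
by case/andP: t01 => t0 t1; rewrite normrM ger0_norm// ler_piMl.
Qed.

Lemma curve_quad n (f : R -> 'rV[R]_n) : smooth_at f (0 : R) ->
  exists2 C : R, 0 < C & \forall u \near (0 : R), `|f u - f 0 - u *: 'D_1 f 0| <= C * u ^+ 2.
Proof.
move=> sf; have H j := derivative_quad (smooth_at_coord j sf).
pose C j := s2val (cid2 (H j)).
have C0 j : 0 < C j by rewrite /C; case: cid2.
have CP j : \forall u \near (0 : R), `|f u 0 j - f 0 0 j - u * 'D_1 (fun z => f z 0 j) 0| <= C j * u ^+ 2.
  by rewrite /C; case: cid2.
exists (\sum_j C j + 1); first by rewrite ltr_wpDl// sumr_ge0// => j _; exact: ltW.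
have HH : \forall u \near (0 : R), forall j, `|f u 0 j - f 0 0 j - u * 'D_1 (fun z => f z 0 j) 0| <= C j * u ^+ 2.
  exact: filter_forall CP.
apply: filterS HH => u Hu.
rewrite [leLHS]/Num.Def.normr/= mx_normrE; apply: bigmax_le => /=.
  by rewrite mulr_ge0 ?sqr_ge0// addr_ge0// sumr_ge0// => j _; exact: ltW.
move=> [i j] _; rewrite ord1 !mxE /= (derive_coord _ (smooth_at_derivable sf)).
rewrite (le_trans (Hu j))// ler_wpM2r ?sqr_ge0//.
rewrite (bigD1 j)//= -addrA lerDl addr_ge0// sumr_ge0// => k _; exact: ltW.
Qed.

Lemma closed_norm_le (V : normedModType R) (r : R) : closed [set v : V | `|v| <= r].
Proof.
rewrite (_ : mkset _ = (fun v : V => `|v|) @^-1` [set x | x <= r])//.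
by apply: preimage_closed; [move=> v _; exact: norm_continuous|exact: closed_le].
Qed.

(** A right inverse S of the differential reduces P x = y to the equation
P (x0 + S a) = y, whose solutions are the fixed points of a - (P (x0 + S a) - y). Strict
differentiability makes this map a 1/2-contraction of the ball of radius 2 |y - P x0|,
and Banach's theorem provides the preimage together with the linear bound. *)
Lemma local_surjectivity n m (P : 'rV[R]_n -> 'rV[R]_m) x0 :
  smooth_at P x0 -> (forall w, exists v, 'd P x0 v = w) ->
  exists2 C : R, 0 < C & \forall y \near P x0, exists2 x, P x = y & `|x - x0| <= C * `|y - P x0|.
Proof.
move=> sP onto.
pose v j := sval (cid (onto (delta_mx 0 j))).
have vE j : 'd P x0 (v j) = delta_mx 0 j by rewrite /v; case: cid.
pose S (w : 'rV[R]_m) := \sum_j w 0 j *: v j.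
have SE w : 'd P x0 (S w) = w.
  rewrite /S linear_sum [RHS]row_sum_delta; apply: eq_bigr => j _.
  by rewrite linearZ vE.
have [K K0 KP] := bounded_linear_frame (@bounded_linear_coord R m) (fun j => normr_ge0 (v j)).
have SK w : `|S w| <= K * `|w|.
  apply: le_trans (KP w); rewrite (le_trans (ler_norm_sum _ _ _))//.
  by apply: ler_sum => j _; rewrite normrZ.
have SB a b : S a - S b = S (a - b).
  by rewrite /S -sumrB; apply: eq_bigr => j _; rewrite !mxE scalerBl.
have K20 : 0 < (2 * K)^-1 by rewrite invr_gt0 mulr_gt0.
have [[A B]/= [/near_normP[d1 d10 d1P] /near_normP[d2 d20 d2P]] AB] :=
  smooth_at_strict (framed_rV n) sP K20.
pose d := Num.min d1 d2.
have d0 : 0 < d by rewrite lt_min d10.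
have st a b : `|a| < d / K -> `|b| < d / K ->
   `|P (x0 + S a) - P (x0 + S b) - (a - b)| <= 2^-1 * `|a - b|.
  move=> ad bd.
  have := AB (x0 + S a, x0 + S b); rewrite /=.
  rewrite [X in 'd _ _ X](_ : _ = S (a - b)); last by rewrite addrAC opprD addrA subrr sub0r addrC SB.
  rewrite SE [X in _ * `|X|](_ : _ = S (a - b)); last by rewrite addrAC opprD addrA subrr sub0r addrC SB.
  have sm c : `|c| < d / K -> `|S c| < d.
    by move=> cd; rewrite (le_lt_trans (SK _))// -ltr_pdivlMl// mulrC.
  move=> H; apply: le_trans (H _) _.
    split => /=.
      by apply: d1P; rewrite addrC addKr (lt_le_trans (sm _ ad))// ge_min lexx.
    by apply: d2P; rewrite addrC addKr (lt_le_trans (sm _ bd))// ge_min lexx orbT.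
  apply: (@le_trans _ _ ((2 * K)^-1 * (K * `|a - b|))); first by rewrite ler_pM2l.
  by rewrite invfM mulrA -(mulrA 2^-1) mulVf ?mulr1// gt_eqF.
exists (2 * K); first by rewrite mulr_gt0.
apply/near_normP; exists (d / K / 4); first by rewrite !divr_gt0.
(* A 1/2-contraction that moves 0 by |y - P x0| preserves the ball of this radius. *)
move=> y yd; pose rho := 2 * `|y - P x0|.
have rd : rho < d / K.
  rewrite /rho; have := divr_gt0 d0 K0; lra.
(* The fixed points of T are the solutions of P (x0 + S a) = y. *)
pose T a := a - (P (x0 + S a) - y).
pose U := [set a : 'rV[R]_m | `|a| <= rho].
have S0 : S 0 = 0 by rewrite /S big1// => j _; rewrite mxE scale0r.
have TL a b : U a -> U b -> `|T a - T b| <= 2^-1 * `|a - b|.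
  move=> /= Ua Ub; rewrite /T.
  have -> : a - (P (x0 + S a) - y) - (b - (P (x0 + S b) - y)) =
     - (P (x0 + S a) - P (x0 + S b) - (a - b)).
    by apply/rowP => j; rewrite !mxE; ring.
  by rewrite normrN; apply: st; [exact: le_lt_trans Ua rd|exact: le_lt_trans Ub rd].
have U0 : U 0 by rewrite /U/= normr0 mulr_ge0.
have TU : {homo T : a / U a >-> U a}.
  move=> a Ua; rewrite /U /=.
  have := TL a 0 Ua U0; rewrite subr0.
  have -> : T 0 = y - P x0 by rewrite /T S0 addr0 sub0r opprB.
  move=> H; rewrite -(subrK (y - P x0) (T a)) (le_trans (ler_normD _ _))//.
  move: Ua H; rewrite /U/= /rho; lra.
have [|||a Ua aT] := @banach_fixed_point R _ U (@mkfun_fun _ _ U U T TU).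
- exists (2^-1)%:nng; split=> /=; first by rewrite invf_lt1 ?ltr1n.
  by move=> [a b] [/= Ua Ub]; exact: TL.
- exact: closed_norm_le.
- by exists 0.
exists (x0 + S a).
  have : a = T a by exact: aT.
  rewrite /T => /eqP; rewrite -subr_eq0 opprD addrA subrr sub0r opprK subr_eq0.
  by move/eqP.
by rewrite [x0 + _]addrC addrK (le_trans (SK _))// [2 * K]mulrC -mulrA ler_pM2l.
Qed.

End LocalSurjectivity.

(** * Smooth maps into manifolds *)

Section Charts.
Context {R : realType} {T : topologicalType} {n : nat}.
Implicit Types (c : chart R T n).

Lemma chart_img c p : chart_dom c p -> (c @` chart_dom c) (c p).
Proof. by move=> cp; exists p. Qed.

Lemma chart_inv_dom c x : (c @` chart_dom c) x -> chart_dom c (chart_inv c x).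
Proof. by move=> [p cp <-]; rewrite chart_mapK. Qed.

Lemma chart_invK c x : (c @` chart_dom c) x -> c (chart_inv c x) = x.
Proof. by move=> [p cp <-]; rewrite chart_mapK. Qed.

Lemma near_chart_img c p : chart_dom c p -> \forall z \near c p, (c @` chart_dom c) z.
Proof.
by move=> cp; apply: open_nbhs_nbhs; split; [exact: chart_cod_open|exact: chart_img].
Qed.

Lemma near_chart_dom c p : chart_dom c p -> \forall q \near p, chart_dom c q.
Proof. by move=> cp; apply: open_nbhs_nbhs; split; [exact: chart_dom_open|]. Qed.

Lemma near_chart_image c p (B : set T) : chart_dom c p -> nbhs p B ->
  \forall z \near c p, (c @` (chart_dom c `&` B)) z.
Proof.
move=> cp nB.
have ci : {for c p, continuous (chart_inv c)}.
  exact: chart_inv_continuous (chart_img cp).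
have : \forall z \near c p, B (chart_inv c z).
  by apply: ci; rewrite chart_mapK.
apply: filterS2 (near_chart_img cp) => z cz Bz.
exists (chart_inv c z); last exact: chart_invK.
by split => //; exact: chart_inv_dom.
Qed.

End Charts.

Section Msmooth.
Context {R : realType} {T : topologicalType} {n : nat} (M : smooth_structure R T n).
Implicit Types (c : chart R T n).

(** Smoothness at a point of a map from a normed space into a manifold. Curves, inverse
charts and families of group elements are all of this kind, and composing them through
this notion avoids tracking the domains of the charts. *)
Definition msmooth (V : normedModType R) (a : V -> T) (v : V) :=
  {for v, continuous a} /\
  forall c, atlas M c -> chart_dom c (a v) -> smooth_at (c \o a) v.

Lemma msmooth_near_dom (V : normedModType R) (a : V -> T) (v : V) c :
  msmooth a v -> chart_dom c (a v) -> \forall z \near v, chart_dom c (a z).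
Proof. by move=> [ac _] cv; apply: ac; exact: near_chart_dom. Qed.

Lemma smooth_at_transition c c' p : atlas M c -> atlas M c' ->
  chart_dom c p -> chart_dom c' p -> smooth_at (c' \o chart_inv c) (c p).
Proof.
move=> Mc Mc' cp c'p; apply: smooth_at_near_on (atlas_compat Mc Mc').
by apply: near_chart_image => //; exact: near_chart_dom.
Qed.

Lemma msmooth_of_chart (V : normedModType R) (a : V -> T) (v : V) c :
  {for v, continuous a} -> atlas M c -> chart_dom c (a v) ->
  smooth_at (c \o a) v -> msmooth a v.
Proof.
move=> ac Mc cv sa; split=> // c' Mc' c'v.
apply: (@smooth_at_ext _ _ _ ((c' \o chart_inv c) \o (c \o a))).
  have : \forall z \near v, chart_dom c (a z) by apply: ac; exact: near_chart_dom.
  by apply: filterS => z cz /=; rewrite chart_mapK.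
apply: smooth_at_comp sa _; first exact: framed_rV.
exact: smooth_at_transition.
Qed.

Lemma msmooth_chart_inv c x : atlas M c -> (c @` chart_dom c) x ->
  msmooth (chart_inv c) x.
Proof.
move=> Mc cx; apply: (@msmooth_of_chart _ _ _ c) => //.
- exact: chart_inv_continuous.
- exact: chart_inv_dom.
- apply: smooth_at_ext (smooth_at_id x).
  have : \forall z \near x, (c @` chart_dom c) z.
    by apply: open_nbhs_nbhs; split; [exact: chart_cod_open|].
  by apply: filterS => z cz /=; rewrite chart_invK.
Qed.

Lemma msmooth_comp (V W : normedModType R) (f : V -> W) (a : W -> T) (v : V) :
  framed W -> smooth_at f v -> msmooth a (f v) -> msmooth (a \o f) v.
Proof.
move=> fW sf [ac sa]; split.
  by apply: continuous_comp; [exact: smooth_at_continuous|exact: ac].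
move=> c Mc cv; apply: (@smooth_at_comp _ _ _ _ f (c \o a)) => //.
exact: sa.
Qed.

Lemma msmooth_cst (V : normedModType R) (p : T) (v : V) : msmooth (fun=> p) v.
Proof.
split; first exact: cvg_cst.
by move=> c Mc cp; exact: smooth_at_cst.
Qed.

End Msmooth.

Section MsmoothMap.
Context {R : realType} {T T' : topologicalType} {n n' : nat}.
Variables (M : smooth_structure R T n) (M' : smooth_structure R T' n').

Lemma smooth_map_at (f : T -> T') (c : chart R T n) (c' : chart R T' n') p : smooth_map M M' f ->
  atlas M c -> atlas M' c' -> chart_dom c p -> chart_dom c' (f p) ->
  smooth_at (c' \o f \o chart_inv c) (c p).
Proof.
move=> [fc sf] Mc Mc' cp c'p; apply: smooth_at_near_on (sf c c' Mc Mc').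
apply: near_chart_image => //; apply: fc; exact: near_chart_dom.
Qed.

Lemma msmooth_map (V : normedModType R) (f : T -> T') (a : V -> T) (v : V) :
  smooth_map M M' f -> msmooth M a v -> msmooth M' (f \o a) v.
Proof.
move=> sf sa; have [ac sac] := sa; split.
  by apply: continuous_comp => //; exact: sf.1.
move=> c' Mc' c'v; have [c Mc cv] := atlas_cover M (a v).
apply: (@smooth_at_ext _ _ _ ((c' \o f \o chart_inv c) \o (c \o a))).
  by apply: filterS (msmooth_near_dom sa cv) => z cz /=; rewrite chart_mapK.
apply: smooth_at_comp; [exact: framed_rV|exact: sac|].
exact: smooth_map_at.
Qed.

(** The chain rule in the form used below: a tangent map is evaluated by differentiating
the image of an explicit family a. *)
Lemma tangent_chain (V : normedModType R) (f : T -> T') (a : V -> T) (v w : V) (c : chart R T n) (c' : chart R T' n') :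
  framed V -> atlas M c -> atlas M' c' ->
  msmooth M a v -> msmooth M' (f \o chart_inv c) (c (a v)) ->
  chart_dom c (a v) -> chart_dom c' (f (a v)) ->
  smooth_at (c' \o f \o a) v /\
  'D_w (c' \o f \o a) v = tangent_map c c' f (a v) ('D_w (c \o a) v).
Proof.
move=> fV Mc Mc' sa sf cv c'v.
have nE : \forall z \near v, ((c' \o f \o chart_inv c) \o (c \o a)) z = (c' \o f \o a) z.
  by apply: filterS (msmooth_near_dom sa cv) => z cz /=; rewrite chart_mapK.
have s1 : smooth_at (c \o a) v by apply: sa.2.
have s2 : smooth_at (c' \o f \o chart_inv c) (c (a v)).
  by apply: sf.2 => //=; rewrite chart_mapK.
split; first by apply: smooth_at_ext nE _; apply: smooth_at_comp => //; exact: framed_rV.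
rewrite -(near_eq_derive _ nE).
have dg : differentiable (c' \o f \o chart_inv c) ((c \o a) v).
  by apply: smooth_at_diff s2; exact: framed_rV.
by have [_ ->] := is_derive_comp (smooth_at_derivable (v := w) s1) dg.
Qed.

Lemma tangent_mapE (f : T -> T') p (c : chart R T n) (c' : chart R T' n') w :
  msmooth M' (f \o chart_inv c) (c p) -> atlas M' c' -> chart_dom c p -> chart_dom c' (f p) ->
  tangent_map c c' f p w = 'D_w (c' \o f \o chart_inv c) (c p).
Proof.
move=> sf Mc' cp c'p; rewrite deriveE//.
apply: smooth_at_diff; first exact: framed_rV.
by apply: sf.2 => //=; rewrite chart_mapK.
Qed.

End MsmoothMap.

Lemma tangent_map_comp {R : realType} {T T' T'' : topologicalType} {n n' n'' : nat}
  (M : smooth_structure R T n) (M' : smooth_structure R T' n') (M'' : smooth_structure R T'' n'')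
  (f : T -> T') (h : T' -> T'') p (c : chart R T n) (c' : chart R T' n') (c'' : chart R T'' n'') w :
  atlas M c -> atlas M' c' -> atlas M'' c'' ->
  msmooth M' (f \o chart_inv c) (c p) -> msmooth M'' (h \o chart_inv c') (c' (f p)) ->
  chart_dom c p -> chart_dom c' (f p) -> chart_dom c'' (h (f p)) ->
  tangent_map c c'' (h \o f) p w = tangent_map c' c'' h (f p) (tangent_map c c' f p w).
Proof.
move=> Mc Mc' Mc'' sf sh cp c'p c''p.
have E : (f \o chart_inv c) (c p) = f p by rewrite /= chart_mapK.
have := @tangent_chain _ _ _ _ _ M' M'' _ h (f \o chart_inv c) (c p) w c' c'' (framed_rV n).
rewrite E => /(_ Mc' Mc'' sf sh c'p c''p) [s1 D].
rewrite (tangent_mapE w sf)// -D /tangent_map -deriveE//.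
exact: smooth_at_diff (framed_rV n) s1.
Qed.

Section Lie.
Context {R : realType} {G : topGroupType} {n : nat}.
Variable (M : smooth_structure R G n).
Hypothesis lieG : is_lie_group M.

Lemma msmooth_mul (V : normedModType R) (a b : V -> G) (v : V) :
  msmooth M a v -> msmooth M b v -> msmooth M (fun z => a z * b z)%g v.
Proof.
move=> sa sb; have [mc ms _] := lieG.
have ac := sa.1; have bc := sb.1.
split.
  have := continuous_comp (cvg_pair ac bc) (mc (a v, b v)); exact.
move=> c Mc cv.
have [c1 Mc1 c1v] := atlas_cover M (a v).
have [c2 Mc2 c2v] := atlas_cover M (b v).
pose F (z : 'rV[R]_n * 'rV[R]_n) := c (chart_inv c1 z.1 * chart_inv c2 z.2)%g.
apply: (@smooth_at_ext _ _ _ (F \o (fun z => (c1 (a z), c2 (b z))))).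
  apply: filterS2 (msmooth_near_dom sa c1v) (msmooth_near_dom sb c2v) => z c1z c2z /=.
  by rewrite /F/= !chart_mapK.
apply: smooth_at_comp.
- exact: framed_prod (framed_rV n) (framed_rV n).
- by apply: smooth_at_pair; [exact: sa.2|exact: sb.2].
- apply: smooth_at_near_on (ms c1 c2 c Mc1 Mc2 Mc) => /=.
  have : \forall p \near (a v, b v), chart_dom c (p.1 * p.2)%g.
    apply: (mc (a v, b v)); exact: near_chart_dom.
  move=> [[P Q]/= [Pa Qb] PQ].
  exists (c1 @` (chart_dom c1 `&` P), c2 @` (chart_dom c2 `&` Q)) => /=.
    by split; exact: near_chart_image.
  move=> [z1 z2] /= [[p [c1p Pp] <-] [q [c2q Qq] <-]].
  by exists (p, q) => //=; split=> //; exact: (PQ (p, q)).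
Qed.

Lemma msmooth_inv (V : normedModType R) (a : V -> G) (v : V) :
  msmooth M a v -> msmooth M (fun z => (a z)^-1)%g v.
Proof. by have [_ _ si] := lieG; move=> /(msmooth_map si). Qed.

Lemma msmooth_lmul (c : chart R G n) x (g : G) : atlas M c -> (c @` chart_dom c) x ->
  msmooth M (fun z : 'rV[R]_n => g * chart_inv c z)%g x.
Proof.
by move=> Mc cx; apply: msmooth_mul; [exact: msmooth_cst|exact: msmooth_chart_inv].
Qed.

End Lie.

(** * Curves tangent to a vector at the identity *)

Section Partial.
Context {R : realType}.

(** Both sides are limits of one and the same difference quotient. *)
Lemma derive_fst (V W Z : normedModType R) (f : V * W -> Z) x y u :
  'D_(u, 0) f (x, y) = 'D_u (fun z => f (z, y)) x.
Proof.
have E : (fun h : R => h^-1 *: ((f \o shift (x, y)) (h *: (u, 0)) - f (x, y))) =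
    (fun h => h^-1 *: (((fun z => f (z, y)) \o shift x) (h *: u) - f (x, y))).
  apply/funext => h /=.
  by congr (_ *: (f _ - _)); congr pair => /=; rewrite scaler0 add0r.
by rewrite /derive E.
Qed.

Lemma derive_snd (V W Z : normedModType R) (f : V * W -> Z) x y u :
  'D_(0, u) f (x, y) = 'D_u (fun z => f (x, z)) y.
Proof.
have E : (fun h : R => h^-1 *: ((f \o shift (x, y)) (h *: (0, u)) - f (x, y))) =
    (fun h => h^-1 *: (((fun z => f (x, z)) \o shift y) (h *: u) - f (x, y))).
  apply/funext => h /=.
  by congr (_ *: (f _ - _)); congr pair => /=; rewrite scaler0 add0r.
by rewrite /derive E.
Qed.

Lemma lipschitz_of_strict (V W : normedModType R) (f L : V -> W) x :
  bounded_linear L -> strict_diff f L x ->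
  exists2 K : R, 0 < K & \forall z \near (x, x), `|f z.1 - f z.2| <= K * `|z.1 - z.2|.
Proof.
move=> [_ [K K0 LK]] /(_ 1 ltr01) sf; exists (K + 1); first by rewrite addr_gt0.
apply: filterS sf => z; rewrite mul1r => H.
rewrite -(subrK (L (z.1 - z.2)) (f z.1 - f z.2)) (le_trans (ler_normD _ _))//.
by rewrite mulrDl mul1r addrC lerD.
Qed.

Lemma quad_cvg (V : normedModType R) (x : R -> V) (X : V) (C : R) :
  (\forall t \near (0 : R), `|x t - t *: X| <= C * t ^+ 2) -> x @ (0 : R) --> (0 : V).
Proof.
move=> Hx; apply/cvgrPdist_lt => e e0.
have K0 : 0 < `|X| + `|C| + 1 by rewrite ltr_wpDl// addr_ge0.
have H1 : \forall t \near (0 : R), `|t| < 1 by exact: nbhs0_lt.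
have H2 : \forall t \near (0 : R), `|t| < e / (`|X| + `|C| + 1).
  by apply: nbhs0_lt; rewrite divr_gt0.
move: Hx H1 H2; apply: filterS3 => t h1 h2.
rewrite ltr_pdivlMr// sub0r normrN => h3.
rewrite -(subrK (t *: X) (x t)) (le_lt_trans (ler_normD _ _))//.
apply: le_lt_trans h3; rewrite addrC normrZ -addrA mulrDr lerD2l.
apply: (le_trans h1); rewrite -(real_normK (num_real t)) expr2 mulrCA ler_wpM2l//.
rewrite (le_trans (ler_norm _))// normrM normr_id (le_trans (_ : _ <= `|C|))//.
  by rewrite ler_piMr// ltW.
by rewrite lerDl.
Qed.

(** Since f is Lipschitz near 0 and x t is O(t ^ 2) away from t X, the expansion may be
computed along the straight line. *)
Lemma quad_comp (V : normedModType R) n (f : V -> 'rV[R]_n) (x : R -> V) (X : V) (C : R) :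
  framed V -> smooth_at f 0 ->
  (\forall t \near (0 : R), `|x t - t *: X| <= C * t ^+ 2) ->
  exists2 C' : R, 0 < C' &
   \forall t \near (0 : R), `|f (x t) - f 0 - t *: 'd f 0 X| <= C' * t ^+ 2.
Proof.
move=> fV sf Hx.
have df := smooth_at_diff fV sf.
have [K K0 [[A B]/= [A0 B0] AB]] := lipschitz_of_strict (bounded_linear_diff df) (smooth_at_strict fV sf).
pose g (t : R) := f (0 + t *: X).
have sg : smooth_at g 0.
  apply: (@smooth_at_comp _ _ _ _ (fun t : R => 0 + t *: X) f) => //.
    exact: smooth_at_line.
  by rewrite scale0r addr0.
have [C1 C10 H1] := curve_quad sg.
have gd : 'D_1 g 0 = 'd f 0 X.
  have := @is_derive_line _ _ _ f 0 X 0; rewrite scale0r addr0 => -[|_ ->].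
    exact: smooth_at_derivable.
  by rewrite deriveE.
have tX : (fun t : R => t *: X) @ (0 : R) --> (0 : V).
  by rewrite -[X in _ --> X](scale0r X); exact: scalel_continuous.
have xc := quad_cvg Hx.
exists (K * (`|C| + 1) + C1); first by rewrite addr_gt0// mulr_gt0// ltr_wpDl.
have nA : \forall t \near (0 : R), A (x t) by exact: xc.
have nB : \forall t \near (0 : R), B (t *: X) by exact: tX.
near=> t.
have h1 : `|f (x t) - f (t *: X)| <= K * `|x t - t *: X|.
  by apply: (AB (x t, t *: X)); split => /=; near: t.
have h2 : `|g t - g 0 - t *: 'D_1 g 0| <= C1 * t ^+ 2 by near: t.
have h3 : `|x t - t *: X| <= C * t ^+ 2 by near: t.
rewrite gd /g scale0r addr0 add0r in h2.
rewrite -addrA -(subrKA (f (t *: X))) (le_trans (ler_normD _ _))//.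
rewrite addrA mulrDl lerD//.
apply: (le_trans h1); rewrite -mulrA ler_pM2l// (le_trans h3)// ler_wpM2r ?sqr_ge0//.
by rewrite (le_trans (ler_norm C))// lerDl.
Unshelve. all: by end_near. Qed.

End Partial.

Section LieLocal.
Context {R : realType} {G : topGroupType} {n : nat}.
Variable (M : smooth_structure R G n).
Hypothesis lieG : is_lie_group M.
Variable (e : chart R G n).
Hypotheses (Me : atlas M e) (e1 : chart_dom e 1%g).

Local Notation o := (e 1%g).
(** The inverse of the chart e, recentred so that 0 corresponds to the identity. *)
Definition param_one (x : 'rV[R]_n) : G := chart_inv e (o + x).
Local Notation P := param_one.

Lemma param_one0 : P 0 = 1%g.
Proof. by rewrite /param_one addr0 chart_mapK. Qed.

Lemma near_center (Q : set 'rV[R]_n) : (\forall z \near o, Q z) -> \forall x \near (0 : 'rV[R]_n), Q (o + x).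
Proof.
by rewrite [X in X -> _](near_shift (0 : 'rV[R]_n)) subr0; apply: filterS => x /=; rewrite addrC.
Qed.

Lemma near_param_one : \forall x \near (0 : 'rV[R]_n), chart_dom e (P x) /\ e (P x) = o + x.
Proof.
have := near_center (near_chart_img e1); apply: filterS => x ex.
by split; [exact: chart_inv_dom|exact: chart_invK].
Qed.

Lemma param_oneK a : chart_dom e a -> P (e a - o) = a.
Proof. by move=> ea; rewrite /param_one addrC subrK chart_mapK. Qed.

Lemma param_one_smooth : msmooth M P 0.
Proof.
apply: (@msmooth_comp _ _ _ _ _ _ (fun x => o + x) (chart_inv e)).
- exact: framed_rV.
- by apply: smooth_atD; [exact: smooth_at_cst|exact: smooth_at_id].
- by apply: msmooth_chart_inv => //; rewrite addr0; exact: chart_img.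
Qed.

Definition local_mul (z : 'rV[R]_n * 'rV[R]_n) := e (P z.1 * P z.2)%g - o.
Definition local_inv (x : 'rV[R]_n) := e (P x)^-1%g - o.

Lemma local_mul_smooth : smooth_at local_mul 0.
Proof.
apply: smooth_atD; last exact: smooth_at_cst.
have : msmooth M (fun z : 'rV[R]_n * 'rV[R]_n => P z.1 * P z.2)%g 0.
  apply: msmooth_mul => //.
    apply: (@msmooth_comp _ _ _ _ _ _ (fun z => z.1) P); [exact: framed_rV| |exact: param_one_smooth].
    exact: smooth_at_linear (bounded_linear_fst _ _).
  apply: (@msmooth_comp _ _ _ _ _ _ (fun z => z.2) P); [exact: framed_rV| |exact: param_one_smooth].
  exact: smooth_at_linear (bounded_linear_snd _ _).
by case=> _; apply => //=; rewrite !param_one0 mulg1.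
Qed.

Lemma local_mul0 : local_mul 0 = 0.
Proof. by rewrite /local_mul !param_one0 mulg1 subrr. Qed.

Lemma framed_rV2 : framed ('rV[R]_n * 'rV[R]_n)%type.
Proof. exact: framed_prod (framed_rV n) (framed_rV n). Qed.

(** The local product restricts to the identity on each axis. *)
Lemma diff_local_mul u v : 'd local_mul 0 (u, v) = u + v.
Proof.
have dm := smooth_at_diff framed_rV2 local_mul_smooth.
have -> : (u, v) = (u, 0) + (0, v) by congr pair => /=; rewrite ?addr0 ?add0r.
rewrite linearD -!deriveE// derive_fst derive_snd.
have E : \forall x \near (0 : 'rV[R]_n), e (P x) - o = x.
  by apply: filterS near_param_one => x [_ ->]; rewrite addrC addKr.
congr (_ + _); rewrite -[RHS](derive_id (0 : 'rV[R]_n)); apply: near_eq_derive;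
  by apply: filterS E => x {2}<-; rewrite /local_mul/= param_one0 ?mulg1 ?mul1g.
Qed.

Lemma local_inv_smooth : smooth_at local_inv 0.
Proof.
apply: smooth_atD; last exact: smooth_at_cst.
by have [_] := msmooth_inv lieG param_one_smooth; apply => //=; rewrite param_one0 invg1.
Qed.

Lemma local_inv0 : local_inv 0 = 0.
Proof. by rewrite /local_inv param_one0 invg1 subrr. Qed.

(** Differentiate the relation x * x^-1 = 1. *)
Lemma diff_local_inv u : 'd local_inv 0 u = - u.
Proof.
have di := smooth_at_diff (framed_rV n) local_inv_smooth.
have dm := smooth_at_diff framed_rV2 local_mul_smooth.
have E : \forall x \near (0 : 'rV[R]_n), (local_mul \o (fun x => (x, local_inv x))) x = 0.
  have : \forall x \near (0 : 'rV[R]_n), chart_dom e (P x)^-1%g.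
    have [ic _] := msmooth_inv lieG param_one_smooth.
    by apply: ic; rewrite param_one0 invg1; exact: near_chart_dom.
  apply: filterS => x ex; rewrite /= /local_mul/= /local_inv.
  by rewrite param_oneK// mulgV subrr.
have dp := @is_derive_pair _ _ _ _ _ _ _ _ (@derivable_id _ _ (0 : 'rV[R]_n) u) (diff_derivable (v := u) di).
have : 'D_u (local_mul \o (fun x => (x, local_inv x))) 0 = 0.
  by rewrite (near_eq_derive _ E) derive_cst.
have dm' : differentiable local_mul (0 : 'rV[R]_n, local_inv 0) by rewrite local_inv0.
have [D1 D2] := dp.
have [_ ->] := is_derive_comp D1 dm'.
rewrite D2 local_inv0 diff_local_mul derive_id deriveE// => /eqP.
by rewrite addrC addr_eq0 => /eqP.
Qed.

(** A curve through 1 with velocity X, the error being O(t ^ 2). An error o(t) would not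
do: comparing 2 ^ k-th powers at t / 2 ^ k multiplies the error by 3 ^ k, which has to be
beaten by 4 ^ - k. *)
Definition tangent (X : 'rV[R]_n) (a : R -> G) := exists C : R,
  \forall t \near (0 : R), chart_dom e (a t) /\ `|e (a t) - o - t *: X| <= C * t ^+ 2.

Lemma tangent_continuous X a : tangent X a -> (fun t => e (a t) - o) @ (0 : R) --> (0 : 'rV[R]_n).
Proof.
by move=> [C H]; apply: (@quad_cvg _ _ _ X C); apply: filterS H => t [].
Qed.

Lemma tangent0 X a : tangent X a -> a 0 = 1%g.
Proof.
move=> [C /nbhs_singleton[ea]]; rewrite scale0r expr0n mulr0 subr0 normr_le0 subr_eq0.
by move=> /eqP E; rewrite -(param_oneK ea) E subrr param_one0.
Qed.

Lemma tangent_cvg X a : tangent X a -> a @ (0 : R) --> (1%g : G).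
Proof.
move=> ta; have [C Ha] := ta; have tc := tangent_continuous ta.
have [Pc _] := param_one_smooth.
have : (P \o (fun t => e (a t) - o)) @ (0 : R) --> P 0.
  exact: (cvg_comp _ _ tc Pc).
rewrite param_one0.
apply: cvg_trans; apply: near_eq_cvg; apply: filterS Ha => t [et _].
by rewrite /= param_oneK.
Qed.

Lemma smooth_tangent (a : R -> G) : a 0 = 1%g -> msmooth M a 0 -> tangent ('D_1 (e \o a) 0) a.
Proof.
move=> a0 sa; have ea0 : chart_dom e (a 0) by rewrite a0.
have [C C0 H] := curve_quad (sa.2 e Me ea0).
exists C; apply: filterS2 (msmooth_near_dom sa ea0) H => t et.
by rewrite /= a0.
Qed.

Lemma tangentM X Y a b : tangent X a -> tangent Y b -> tangent (X + Y) (fun t => a t * b t)%g.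
Proof.
move=> ta tb; have [C Ha] := ta; have [D Hb] := tb.
pose x t := (e (a t) - o, e (b t) - o).
have H : \forall t \near (0 : R), `|x t - t *: (X, Y)| <= Num.max C D * t ^+ 2.
  apply: filterS2 Ha Hb => t [_ h1] [_ h2].
  rewrite prod_normE /= ge_max (le_trans h1) ?(le_trans h2)//.
    by rewrite ler_wpM2r ?sqr_ge0// le_max lexx orbT.
  by rewrite ler_wpM2r ?sqr_ge0// le_max lexx.
have [K K0 HK] := quad_comp framed_rV2 local_mul_smooth H.
exists K; rewrite local_mul0 diff_local_mul in HK.
have dm : \forall t \near (0 : R), chart_dom e (a t * b t)%g.
  have : (fun t => a t * b t)%g @ (0 : R) --> (1 * 1 : G)%g.
    have [mc _ _] := lieG.
    exact: (cvg_comp _ _ (cvg_pair (tangent_cvg ta) (tangent_cvg tb)) (mc (1%g, 1%g))).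
  by apply; rewrite mulg1; exact: near_chart_dom.
near=> t.
have [h2 _] : chart_dom e (a t) /\ `|e (a t) - o - t *: X| <= C * t ^+ 2 by near: t.
have [h3 _] : chart_dom e (b t) /\ `|e (b t) - o - t *: Y| <= D * t ^+ 2 by near: t.
split; first by near: t.
have : `|local_mul (x t) - 0 - t *: (X + Y)| <= K * t ^+ 2 by near: t.
by rewrite subr0 /local_mul /x/= !param_oneK.
Unshelve. all: by end_near. Qed.

Lemma tangentV X a : tangent X a -> tangent (- X) (fun t => (a t)^-1%g).
Proof.
move=> ta; have [C Ha] := ta.
have H : \forall t \near (0 : R), `|e (a t) - o - t *: X| <= C * t ^+ 2.
  by apply: filterS Ha => t [].
have [K K0 HK] := quad_comp (framed_rV n) local_inv_smooth H.
exists K; rewrite local_inv0 diff_local_inv in HK.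
have dm : \forall t \near (0 : R), chart_dom e (a t)^-1%g.
  have : (fun t => (a t)^-1%g) @ (0 : R) --> (1^-1 : G)%g.
    have [_ _ [ic _]] := lieG.
    exact: (cvg_comp _ _ (tangent_cvg ta) (ic 1%g)).
  by apply; rewrite invg1; exact: near_chart_dom.
move: HK Ha dm; apply: filterS3 => t h1 [h2 _] h3; split=> //.
by move: h1; rewrite subr0 /local_inv /= param_oneK.
Qed.

Lemma tangentZ X a k : tangent X a -> tangent (k *: X) (fun t => a (k * t)).
Proof.
move=> [C H]; exists (C * k ^+ 2).
have : \forall t \near (0 : R), (fun t => chart_dom e (a t) /\ `|e (a t) - o - t *: X| <= C * t ^+ 2) (k * t).
  have : (fun t : R => k * t) @ (0 : R) --> (0 : R).
    rewrite -[X in _ --> X](mulr0 k); apply: cvgM; [exact: cvg_cst|exact: cvg_id].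
  by move=> kc; exact: (kc _ H).
by apply: filterS => t /=; rewrite exprMn mulrA scalerA [t * k]mulrC.
Qed.

(** The differential of the squaring map at 1 is multiplication by 2; its Lipschitz
constant near 1 is therefore below 3, and all that matters is 3 < 4. *)
Lemma sqr_lipschitz : exists2 r : R, 0 < r & forall x y : 'rV[R]_n, `|x| < r -> `|y| < r ->
  `|local_mul (x, x) - local_mul (y, y)| <= 3 * `|x - y|.
Proof.
have [[A B]/= [/near_normP[d1 d10 d1P] /near_normP[d2 d20 d2P]] AB] :=
  smooth_at_strict framed_rV2 local_mul_smooth ltr01.
exists (Num.min d1 d2); first by rewrite lt_min d10.
move=> x y; rewrite !lt_min => /andP[x1 _] /andP[_ y2].
have := AB ((x, x), (y, y)).
rewrite /= [X in 'd local_mul 0 X](_ : _ = (x - y, x - y))// diff_local_mul mul1r.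
rewrite [X in _ <= `|X|](_ : _ = (x - y, x - y))// [`|(_, _)|]prod_normE/= maxxx.
have nE (z : 'rV[R]_n) : `|((z, z) : 'rV[R]_n * 'rV[R]_n) - 0| = `|z|.
  by rewrite subr0 prod_normE/= maxxx.
move=> H; rewrite -(subrK (x - y + (x - y)) (local_mul (x, x) - local_mul (y, y))).
rewrite (le_trans (ler_normD _ _))//.
have h1 : `|local_mul (x, x) - local_mul (y, y) - (x - y + (x - y))| <= `|x - y|.
  by apply: H; split; [apply: d1P|apply: d2P]; rewrite nE.
have h2 := ler_normD (x - y) (x - y).
by lra.
Qed.

(** At t / 2 ^ k the two curves differ by O(4 ^ - k); squaring k times, which expands
distances by at most 3 ^ k, bounds their difference at t by a multiple of (3 / 4) ^ k. *)
Lemma tangent_doubling_unique X a b : tangent X a -> tangent X b ->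
  (\forall t \near (0 : R), a (2 * t) = (a t * a t)%g) ->
  (\forall t \near (0 : R), b (2 * t) = (b t * b t)%g) ->
  \forall t \near (0 : R), a t = b t.
Proof.
move=> ta tb; have [r r0 rL] := sqr_lipschitz.
have [C Ha] := ta; have [D Hb] := tb.
have na : \forall t \near (0 : R), `|e (a t) - o| < r.
  by have /cvgr_norm_lt := tangent_continuous ta; apply; rewrite normr0.
have nb : \forall t \near (0 : R), `|e (b t) - o| < r.
  by have /cvgr_norm_lt := tangent_continuous tb; apply; rewrite normr0.
move=> da db.
have : \forall t \near (0 : R), [/\ chart_dom e (a t) /\ `|e (a t) - o - t *: X| <= C * t ^+ 2,
   chart_dom e (b t) /\ `|e (b t) - o - t *: X| <= D * t ^+ 2,
   `|e (a t) - o| < r /\ `|e (b t) - o| < r,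
   a (2 * t) = (a t * a t)%g & b (2 * t) = (b t * b t)%g].
  by near=> t; split; [near: t|near: t|split; near: t|near: t|near: t].
move=> /near_normP[d d0 dP]; apply/near_normP; exists d => // t; rewrite subr0.
have td s (k : nat) : `|s| < d -> `|s / 2 ^+ k| < d.
  move=> sd; rewrite (le_lt_trans _ sd)// normrM ler_piMr// normfV normrX normr_nat.
  by rewrite invf_le1 ?exprn_gt0// exprn_ege1// ler1n.
have dP0 s : `|s| < d -> [/\ chart_dom e (a s) /\ `|e (a s) - o - s *: X| <= C * s ^+ 2,
   chart_dom e (b s) /\ `|e (b s) - o - s *: X| <= D * s ^+ 2,
   `|e (a s) - o| < r /\ `|e (b s) - o| < r,
   a (2 * s) = (a s * a s)%g & b (2 * s) = (b s * b s)%g].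
  by move=> sd; apply: dP; rewrite subr0.
(* One squaring expands the distance of the two curves by at most 3. *)
have step s : `|s| < d -> `|e (a s) - e (b s)| <= 3 * `|e (a (s / 2)) - e (b (s / 2))|.
  move=> sd.
  have [[ea _] [eb _] [ra rb] Ea Eb] := dP0 _ (td s 1%N sd).
  have := rL _ _ ra rb; rewrite /local_mul/= !param_oneK// -Ea -Eb expr1 mulrC divfK ?pnatr_eq0//.
  by rewrite !opprB !addrA !subrK.
have iter k s : `|s| < d -> `|e (a s) - e (b s)| <= 3 ^+ k * `|e (a (s / 2 ^+ k)) - e (b (s / 2 ^+ k))|.
  elim: k => [|k IH] sd; first by rewrite expr0 mul1r divr1.
  apply: (le_trans (IH sd)); rewrite exprSr -mulrA ler_wpM2l ?exprn_ge0//.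
  by rewrite exprSr invfM mulrA; apply: step; exact: td.
move=> tdd.
have bound k : `|e (a t) - e (b t)| <= (C + D) * t ^+ 2 * (3 / 4) ^+ k.
  apply: (le_trans (iter k t tdd)).
  have [[_ h1] [_ h2] _ _ _] := dP0 _ (td t k tdd).
  have h3 : `|e (a (t / 2 ^+ k)) - e (b (t / 2 ^+ k))| <= (C + D) * (t / 2 ^+ k) ^+ 2.
    rewrite mulrDl; apply: le_trans (lerD h1 h2).
    rewrite [X in _ <= _ + X]distrC; apply: le_trans (ler_normD _ _).
    by rewrite subrKA opprB addrA subrK.
  apply: (@le_trans _ _ (3 ^+ k * ((C + D) * (t / 2 ^+ k) ^+ 2))).
    by rewrite ler_wpM2l ?exprn_ge0.
  rewrite expr_div_n exprMn -exprM exprVn.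
  have -> : (4 : R) ^+ k = 2 ^+ (2 * k) by rewrite exprM; congr (_ ^+ _); ring.
  rewrite mulnC; move: (2 ^+ (2 * k)) (3 ^+ k) => p q.
  by rewrite [leLHS](_ : _ = (C + D) * t ^+ 2 * (q / p))//; ring.
have E : e (a t) = e (b t).
  have c0 : (fun k : nat => (C + D) * t ^+ 2 * (3 / 4) ^+ k) @ \oo --> (0 : R).
    rewrite -[X in _ --> X](mulr0 ((C + D) * t ^+ 2)); apply: cvgM; first exact: cvg_cst.
    by apply: cvg_expr; rewrite ger0_norm// ltr_pdivrMr// mul1r ltr_nat.
  apply/eqP; rewrite -subr_eq0 -normr_le0.
  by apply: (cvgr_to_ge c0); apply: nearW => k; exact: bound.
have [[ea _] [eb _] _ _ _] := dP0 _ tdd.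
by rewrite -(chart_mapK ea) -(chart_mapK eb) E.
Unshelve. all: by end_near. Qed.

End LieLocal.

(** * Existence of one-parameter subgroups *)

Lemma near_norm_lt (R : realType) (V : normedModType R) (x : V) (r : R) :
  `|x| < r -> \forall y \near x, `|y| < r.
Proof.
move=> xr; apply/near_normP; exists (r - `|x|); first by rewrite subr_gt0.
move=> z; rewrite ltrBrDr; apply: le_lt_trans.
by rewrite -[in leLHS](subrK x z) ler_normD.
Qed.

Lemma lipschitz_ball_continuous (R : realType) (V W : normedModType R) (f : V -> W) (K r : R) x :
  0 < K -> (forall x y : V, `|x| < r -> `|y| < r -> `|f x - f y| <= K * `|x - y|) ->
  `|x| < r -> {for x, continuous f}.
Proof.
move=> K0 fL xr; apply/cvgrPdist_lt => a a0; near=> y.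
have yr : `|y| < r by near: y; exact: near_norm_lt.
apply: (le_lt_trans (fL _ _ xr yr)); rewrite -ltr_pdivlMl//.
by near: y; apply: cvgr_dist_lt => //; rewrite mulr_gt0 ?invr_gt0.
Unshelve. all: by end_near. Qed.

Section ExpLocal.
Context {R : realType} {G : topGroupType} {n : nat}.
Variable (M : smooth_structure R G n).
Hypothesis lieG : is_lie_group M.
Variable (e : chart R G n).
Hypotheses (Me : atlas M e) (e1 : chart_dom e 1%g).
Local Notation o := (e 1%g).
Local Notation P := (param_one e).
Variable X : 'rV[R]_n.

Definition local_sqr (x : 'rV[R]_n) := local_mul e (x, x).

(** The 2 ^ k-th power of the group element with coordinates (t / 2 ^ k) X: the k-th
approximation of exp (t X). *)
Fixpoint dyadic_power (k : nat) (t : R) : 'rV[R]_n :=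
  if k is k'.+1 then local_sqr (dyadic_power k' (t / 2)) else t *: X.

Lemma geometric_small (B a : R) : 0 < a -> exists k : nat, B * (3 / 4) ^+ k < a.
Proof.
move=> a0.
have c0 : (fun k : nat => B * (3 / 4 : R) ^+ k) @ \oo --> (0 : R).
  rewrite -[X in _ --> X](mulr0 B); apply: cvgM; first exact: cvg_cst.
  by apply: cvg_expr; rewrite ger0_norm// ltr_pdivrMr// mul1r ltr_nat.
have /cvgrPdist_lt/(_ a a0) := c0.
move=> [k _ /(_ k (leqnn k))]; rewrite sub0r normrN => H; exists k.
exact: le_lt_trans (ler_norm _) H.
Qed.

Lemma sqr_half (t : R) : (t / 2) ^+ 2 = t ^+ 2 / 4.
Proof. by rewrite expr_div_n; congr (_ / _); ring. Qed.

(** The radius eps |X| + C eps ^ 2 is chosen so that, for |t| < eps, the dyadic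
powers stay in a ball on which squaring is defined and 3-Lipschitz. *)
Lemma dyadic_power_bounds : exists C eps : R, [/\ 0 < C, 0 < eps,
  forall x y : 'rV[R]_n, `|x| < eps * `|X| + C * eps ^+ 2 -> `|y| < eps * `|X| + C * eps ^+ 2 ->
    `|local_sqr x - local_sqr y| <= 3 * `|x - y|,
  forall x : 'rV[R]_n, `|x| < eps * `|X| + C * eps ^+ 2 ->
    [/\ chart_dom e (P x), e (P x) = o + x & chart_dom e (P x * P x)%g] &
  forall t, `|t| < eps -> `|local_sqr ((t / 2) *: X) - t *: X| <= C * t ^+ 2 / 4 ].
Proof.
have [r r0 rL] := sqr_lipschitz lieG Me e1.
have H0 : \forall t \near (0 : R), `|(t *: X, t *: X) - t *: (X, X)| <= 0 * t ^+ 2.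
  by near=> t; rewrite mul0r normr_le0 subr_eq0.
have [C C0] := quad_comp framed_rV2 (local_mul_smooth lieG Me e1) H0.
rewrite (local_mul0 e1) (diff_local_mul lieG Me e1) => /near_normP[d d0 dP].
have nP : \forall x \near (0 : 'rV[R]_n), [/\ chart_dom e (P x), e (P x) = o + x & chart_dom e (P x * P x)%g].
  have [pc _] : msmooth M (fun x => P x * P x)%g 0.
    by apply: msmooth_mul => //; exact: param_one_smooth.
  have nPP : \forall x \near (0 : 'rV[R]_n), chart_dom e (P x * P x)%g.
    by apply: pc; rewrite param_one0// mulg1; exact: near_chart_dom.
  by move: (near_param_one e1) nPP; apply: filterS2 => x [? ?] ?; split.
move: nP => /near_normP[r' r'0 r'P].
pose rr := Num.min r r'.
have rr0 : 0 < rr by rewrite lt_min r0.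
pose eps := Num.min 1 (Num.min d (rr / (`|X| + C + 1))).
have XC : 0 < `|X| + C + 1 by rewrite addr_gt0// ltr_wpDl.
have eps0 : 0 < eps by rewrite !lt_min ltr01 d0 divr_gt0.
have [eps1 epsd epsr] : [/\ eps <= 1, eps <= d & eps <= rr / (`|X| + C + 1)].
  by rewrite /eps !ge_min !lexx /= !orbT.
have epsrr : eps * `|X| + C * eps ^+ 2 < rr.
  move: epsr; rewrite ler_pdivlMr// => H.
  apply: lt_le_trans H; rewrite !mulrDr mulr1 -addrA ltrD2l.
  rewrite ltr_pwDr// expr2 mulrCA ler_wpM2l ?(ltW eps0)// ler_piMr// ltW//.
have lr (x : 'rV[R]_n) : `|x| < eps * `|X| + C * eps ^+ 2 -> (`|x| < r) /\ (`|x| < r').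
  by move=> /lt_trans/(_ epsrr); rewrite lt_min => /andP.
exists C, eps; split=> //.
- by move=> x y /lr[xr _] /lr[yr _]; exact: rL.
- by move=> x /lr[_ xr]; apply: r'P; rewrite subr0.
- move=> t te; have /dP : `|t / 2 - 0| < d.
    rewrite subr0 normrM normfV (ger0_norm (_ : 0 <= 2))//; lra.
  have -> : (t / 2) *: (X + X) = t *: X.
    by rewrite -mulr2n -[X *+ 2](scaler_nat 2 X) scalerA divfK.
  rewrite subr0 sqr_half.
  by rewrite mulrA.
Unshelve. all: by end_near. Qed.

(** Halving once more changes the k-th dyadic power by at most C t ^ 2 (3 / 4) ^ k, so
the dyadic powers converge uniformly. The limit stays within C t ^ 2 of t X, and it
inherits the doubling relation from the recursion. *)
Lemma local_exponential : exists2 eps : R, 0 < eps & exists2 eta : R -> G, tangent e X eta &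
  forall t : R, `|t| < eps -> {for t, continuous eta} /\
    eta t = (eta (t / 2)%R * eta (t / 2)%R)%g.
Proof.
have [C [eps [C0 eps0 Lip dom quad]]] := dyadic_power_bounds.
pose rho := eps * `|X| + C * eps ^+ 2.
have half (t : R) : `|t| < eps -> `|t / 2| < eps.
  by rewrite normrM normfV (ger0_norm (_ : 0 <= 2))//; have := normr_ge0 t; lra.
have small x t : `|t| < eps -> `|x - t *: X| <= C * t ^+ 2 -> `|x| < rho.
  move=> te xt; rewrite -(subrK (t *: X) x) (le_lt_trans (ler_normD _ _))//.
  rewrite /rho addrC normrZ ler_ltD// ?ler_wpM2r// ?ltW//.
  rewrite (le_lt_trans xt)// ltr_pM2l// -(real_normK (num_real t)) ltr_pXn2r//; exact: ltW.
have c1 k t : `|t| < eps -> `|dyadic_power k t - t *: X| <= C * t ^+ 2.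
  elim: k t => [|k IH] t te /=; first by rewrite subrr normr0 mulr_ge0// ?sqr_ge0// ltW.
  rewrite -(subrKA (local_sqr ((t / 2) *: X))) (le_trans (ler_normD _ _))//.
  have h1 := quad t te.
  have th := half t te.
  have h2 : `|local_sqr (dyadic_power k (t / 2)) - local_sqr ((t / 2) *: X)| <= 3 * `|dyadic_power k (t / 2) - (t / 2) *: X|.
    apply: Lip; first by apply: small (IH _ th).
    by apply: (small _ (t / 2)) => //; rewrite subrr normr0 mulr_ge0// ?sqr_ge0// ltW.
  have h3 := IH _ th; rewrite sqr_half in h3.
  by move: h1 h2 h3; lra.
have sm k t : `|t| < eps -> `|dyadic_power k t| < rho by move=> te; exact: small (c1 k t te).
have c2 k t : `|t| < eps -> `|dyadic_power k.+1 t - dyadic_power k t| <= C * t ^+ 2 * (3 / 4) ^+ k.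
  elim: k t => [|k IH] t te; first by rewrite expr0 mulr1; exact: (c1 1%N).
  rewrite -[dyadic_power k.+2 t]/(local_sqr (dyadic_power k.+1 (t / 2))) -[dyadic_power k.+1 t]/(local_sqr (dyadic_power k (t / 2))).
  have th := half t te.
  apply: (le_trans (Lip _ _ (sm _ _ th) (sm _ _ th))).
  have := IH _ th; rewrite sqr_half [(3 / 4) ^+ k.+1]exprS.
  by move: ((3 / 4) ^+ k) => q; lra.
have c3 k m t : `|t| < eps -> `|dyadic_power (k + m) t - dyadic_power k t| <= 4 * C * t ^+ 2 * ((3 / 4) ^+ k - (3 / 4) ^+ (k + m)).
  move=> te; elim: m => [|m IH]; first by rewrite addn0 !subrr normr0 mulr0.
  rewrite addnS -(subrKA (dyadic_power (k + m) t)) (le_trans (ler_normD _ _))//.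
  move: IH (c2 (k + m)%N t te); rewrite [(3 / 4) ^+ (k + m).+1]exprS.
  by move: ((3 / 4) ^+ k) ((3 / 4) ^+ (k + m)) => p q; lra.
(* Uniform in t and m: this gives both the convergence and the continuity of the limit. *)
have c4 k t m : `|t| < eps -> (k <= m)%N -> `|dyadic_power m t - dyadic_power k t| <= 4 * C * eps ^+ 2 * (3 / 4) ^+ k.
  move=> te km; rewrite -(subnKC km) (le_trans (c3 _ _ _ te))//.
  apply: (@le_trans _ _ (4 * C * t ^+ 2 * (3 / 4) ^+ k)).
    apply: ler_wpM2l; first by rewrite mulr_ge0 ?sqr_ge0// mulr_ge0// ltW.
    by rewrite gerBl exprn_ge0.
  rewrite ler_wpM2r ?exprn_ge0// ler_wpM2l// ?mulr_ge0// ?(ltW C0)//.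
  rewrite -(real_normK (num_real t)) ler_pXn2r// ?nnegrE//; exact: ltW.
pose H (t : R) : 'rV[R]_n := lim (dyadic_power k t @[k --> \oo]).
have cH t : `|t| < eps -> (fun k => dyadic_power k t) @ \oo --> H t.
  move=> te; apply/cauchy_cvgP/cauchy_exP => a a0.
  have [k kP] := geometric_small (4 * C * eps ^+ 2) a0.
  exists (dyadic_power k t); exists k => // m /= km; rewrite /= -ball_normE /= distrC.
  exact: le_lt_trans (c4 _ _ _ te km) kP.
have H4 k t : `|t| < eps -> `|H t - dyadic_power k t| <= 4 * C * eps ^+ 2 * (3 / 4) ^+ k.
  move=> te.
  have cn : (fun m => `|dyadic_power m t - dyadic_power k t|) @ \oo --> `|H t - dyadic_power k t|.
    by apply: cvg_norm; apply: cvgB; [exact: cH|exact: cvg_cst].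
  apply: (cvgr_to_le cn); exists k => // m /= km; exact: c4.
have H1 t : `|t| < eps -> `|H t - t *: X| <= C * t ^+ 2.
  move=> te.
  have cn : (fun m => `|dyadic_power m t - t *: X|) @ \oo --> `|H t - t *: X|.
    by apply: cvg_norm; apply: cvgB; [exact: cH|exact: cvg_cst].
  by apply: (cvgr_to_le cn); apply: nearW => m; exact: c1.
have Hs t : `|t| < eps -> `|H t| < rho by move=> te; exact: small (H1 t te).
have sqc (x : 'rV[R]_n) : `|x| < rho -> {for x, continuous local_sqr}.
  exact: (lipschitz_ball_continuous _ Lip).
have Hd t : `|t| < eps -> H t = local_sqr (H (t / 2)).
  move=> te.
  have th := half t te.
  have l1 : (fun k => dyadic_power k.+1 t) @ \oo --> H t by rewrite (cvg_shiftS (fun k => dyadic_power k t)); exact: cH.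
  have l2 : (fun k => dyadic_power k.+1 t) @ \oo --> local_sqr (H (t / 2)).
    exact: (cvg_comp _ _ (cH _ th) (sqc _ (Hs _ th))).
  exact: cvg_unique l1 l2.
have nte (t : R) : `|t| < eps -> \forall s \near t, `|s| < eps.
  exact: near_norm_lt.
have dc k (t : R) : `|t| < eps -> {for t, continuous (dyadic_power k)}.
  elim: k t => [|k IH] t te; first exact: scalel_continuous.
  have -> : dyadic_power k.+1 = local_sqr \o (dyadic_power k \o (fun t => t / 2)) by [].
  have th := half t te.
  apply: continuous_comp; last by apply: sqc; exact: sm.
  apply: continuous_comp; last exact: IH.
  by apply: cvgM; [exact: cvg_id|exact: cvg_cst].
have Hc (t : R) : `|t| < eps -> {for t, continuous H}.
  move=> te; apply/cvgrPdist_lt => a a0.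
  have a3 : 0 < a / 3 by rewrite divr_gt0.
  have [k kP] := geometric_small (4 * C * eps ^+ 2) a3.
  have /cvgrPdist_lt/(_ _ a3) h := dc k t te.
  near=> s.
  have se : `|s| < eps by near: s; exact: nte.
  have h1 := H4 k t te; have h2 := H4 k s se.
  have h3 : `|dyadic_power k t - dyadic_power k s| < a / 3 by near: s; exact: h.
  rewrite -(subrKA (dyadic_power k t)) (le_lt_trans (ler_normD _ _))//.
  rewrite -(subrKA (dyadic_power k s) (dyadic_power k t)).
  have h4 := ler_normD (dyadic_power k t - dyadic_power k s) (dyadic_power k s - H s).
  rewrite [`|dyadic_power k s - H s|]distrC in h4.
  lra.
exists eps => //; exists (P \o H).
  exists C; apply/near_normP; exists eps => // t; rewrite subr0 => te /=.
  have [d1 -> _] := dom _ (Hs t te); split=> //.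
  by rewrite [_ + H t]addrC addrK; exact: H1.
move=> t te; split.
  apply: continuous_comp; first exact: Hc.
  apply: (@continuous_comp _ _ _ (fun x => o + x) (chart_inv e)).
    exact: (cvgD (cvg_cst _) cvg_id).
  have [d1 E _] := dom _ (Hs t te); apply: chart_inv_continuous.
  by rewrite -E; exact: chart_img.
have th := half t te.
rewrite /= (Hd t te) /local_sqr /local_mul /=.
by have [_ _ d1] := dom _ (Hs _ th); rewrite param_oneK.
Unshelve. all: by end_near. Qed.

End ExpLocal.

Section ExpGlobal.
Context {R : realType} {G : topGroupType} {n : nat}.
Variable (M : smooth_structure R G n).
Hypothesis lieG : is_lie_group M.
Variable (e : chart R G n).
Hypotheses (Me : atlas M e) (e1 : chart_dom e 1%g).

Lemma expg_continuous (T : topologicalType) (a : T -> G) (t : T) (k : nat) :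
  {for t, continuous a} -> {for t, continuous (fun s => a s ^+ k)%g}.
Proof.
move=> ac; elim: k => [|k IH].
  rewrite (_ : (fun s => a s ^+ 0)%g = fun=> 1%g); first exact: cvg_cst.
  by apply/funext => s; rewrite expg0.
rewrite (_ : (fun s => a s ^+ k.+1)%g = fun s => (a s * a s ^+ k)%g); last first.
  by apply/funext => s; rewrite expgS.
have [mc _ _] := lieG.
exact: (cvg_comp _ _ (cvg_pair ac IH) (mc (a t, (a t ^+ k)%g))).
Qed.

Lemma small_dyadic (t d : R) : 0 < d -> exists k : nat, `|t / 2 ^+ k| < d.
Proof.
move=> d0; pose k := Num.truncn (`|t| / d); exists k.
rewrite normrM normfV normrX normr_nat ltr_pdivrMr ?exprn_gt0//.
rewrite mulrC -ltr_pdivrMr//.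
have /truncn_itv/andP[_ H] : 0 <= `|t| / d by rewrite divr_ge0// ltW.
apply: (lt_le_trans H); rewrite -natrX ler_nat.
exact: ltn_expl.
Qed.

Lemma small_dyadic_le (t d : R) (k l : nat) : (k <= l)%N -> `|t / 2 ^+ k| < d -> `|t / 2 ^+ l| < d.
Proof.
move=> kl; apply: le_lt_trans.
rewrite !normrM ler_wpM2l// !normfV !normrX normr_nat lef_pV2 ?posrE ?exprn_gt0//.
by rewrite ler_weXn2l// ler1n.
Qed.

Lemma dyadic_approx (s : R) : 0 <= s ->
  (fun k : nat => (Num.truncn (s * 2 ^+ k))%:R / 2 ^+ k) @ \oo --> s.
Proof.
move=> s0; apply/cvgrPdist_lt => a a0.
have [k kP] := small_dyadic 1 a0.
exists k => // l /= kl.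
have := small_dyadic_le kl kP; apply: le_lt_trans.
have p0 : 0 < (2 : R) ^+ l by rewrite exprn_gt0.
have /truncn_itv/andP[h1 h2] : 0 <= s * 2 ^+ l by rewrite mulr_ge0// ltW.
rewrite ger0_norm; last by rewrite subr_ge0 ler_pdivrMr.
rewrite ger0_norm; last by rewrite divr_ge0// ltW.
rewrite lerBlDr -mulrDl ler_pdivlMr// addrC.
by rewrite natr1; exact: ltW h2.
Qed.

(** Put sigma t = eta (t / 2 ^ k) ^ (2 ^ k) with k so large that t / 2 ^ k lies in the
domain of the local exponential eta; by the doubling relation the value does not depend
on k. Uniqueness of tangent curves gives eta (j t) = eta t ^ j near 0, hence
sigma (j t) = sigma t ^ j for all t, hence additivity on dyadic numbers, and by continuity
everywhere. *)
Lemma homomorphism_exists (X : 'rV[R]_n) : exists sigma : R -> G,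
  [/\ continuous sigma, forall s t, sigma (s + t) = (sigma s * sigma t)%g & tangent e X sigma].
Proof.
have [eps eps0 [eta teta etaP]] := local_exponential lieG Me e1 X.
have etaD t : `|t| < eps -> eta t = (eta (t / 2)%R * eta (t / 2)%R)%g by move=> /etaP[].
have etac t : `|t| < eps -> {for t, continuous eta} by move=> /etaP[].
have eta2 k t : `|t| < eps -> eta t = (eta (t / 2 ^+ k)%R ^+ (2 ^ k)%N)%g.
  elim: k t => [|k IH] t te; first by rewrite expr0 divr1 expg1.
  have th : `|t / 2| < eps by have := @small_dyadic_le t eps 0 1 isT; rewrite divr1 expr1; apply.
  rewrite (etaD _ te) (IH _ th) expnS expgnA exprS invfM mulrA.
  rewrite -expgMn//.
(* Some k for which t / 2 ^ k lies in the domain of eta. *)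
pose kf (t : R) := sval (cid (small_dyadic t eps0)).
have kfP t : `|t / 2 ^+ kf t| < eps by rewrite /kf; case: cid.
pose sigma (t : R) := (eta (t / 2 ^+ kf t)%R ^+ (2 ^ kf t)%N)%g.
have sigmaE k t : `|t / 2 ^+ k| < eps -> sigma t = (eta (t / 2 ^+ k)%R ^+ (2 ^ k)%N)%g.
  have main k1 k2 : (k1 <= k2)%N -> `|t / 2 ^+ k1| < eps ->
     (eta (t / 2 ^+ k1)%R ^+ (2 ^ k1)%N = eta (t / 2 ^+ k2)%R ^+ (2 ^ k2)%N)%g.
    move=> k12 h; rewrite (eta2 (k2 - k1)%N _ h) -expgnA -expnD subnK//.
    by rewrite -mulrA -invfM -exprD subnKC.
  move=> tk; rewrite /sigma; have [h|h] := leqP k (kf t).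
    exact/esym/main.
  by apply: main => //; exact: ltnW.
have sigma_loc t : `|t| < eps -> sigma t = eta t.
  by move=> te; rewrite (sigmaE 0%N) expr0 ?divr1// expg1.
have near_lt (d : R) (c : R) : 0 < d -> \forall t \near (0 : R), `|c * t| < d.
  move=> d0; have c0 : 0 < `|c| + 1 by rewrite ltr_wpDl.
  apply/near_normP; exists (d / (`|c| + 1)); first by rewrite divr_gt0.
  move=> z; rewrite subr0 ltr_pdivlMr// normrM; apply: le_lt_trans.
  by rewrite mulrC ler_wpM2l// lerDl.
have eta_dbl t : `|2 * t| < eps -> eta (2 * t) = (eta t * eta t)%g.
  by move=> te; rewrite (etaD _ te) [2 * t]mulrC mulfK ?pnatr_eq0.
have etaX j : \forall t \near (0 : R), eta (j%:R * t) = (eta t ^+ j)%g.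
  have tj : tangent e (j%:R *: X) (fun t => eta t ^+ j)%g.
    elim: j => [|j IH].
      rewrite scale0r; exists 0; near=> t; rewrite expg0; split=> //.
      by rewrite scaler0 !subrr normr0 mul0r.
    rewrite -natr1 scalerDl scale1r addrC.
    rewrite (_ : (fun t => eta t ^+ j.+1)%g = fun t => (eta t * eta t ^+ j)%g).
      exact: (tangentM lieG Me e1).
    by apply/funext => t; rewrite expgS.
  apply: (tangent_doubling_unique lieG Me e1 (tangentZ j%:R teta) tj).
    apply: filterS (near_lt eps (2 * j%:R) eps0) => t te.
    by rewrite mulrCA eta_dbl// mulrA.
  apply: filterS (near_lt eps 2 eps0) => t te.
  by rewrite eta_dbl// expgMn.
have etaV : \forall t \near (0 : R), eta (- t) = (eta t)^-1%g.
  have tV := tangentV lieG Me e1 teta.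
  have tN : tangent e (- X) (fun t => eta (- t)).
    have := tangentZ (-1) teta; rewrite scaleN1r.
    by congr (tangent _ _ _); apply/funext => t; rewrite mulN1r.
  apply: (tangent_doubling_unique lieG Me e1 tN tV).
    apply: filterS (near_lt eps 2 eps0) => t te.
    by rewrite -mulrN eta_dbl// mulrN normrN.
  apply: filterS (near_lt eps 2 eps0) => t te.
  by rewrite eta_dbl// invgM.
have sigmaX j t : sigma (j%:R * t) = (sigma t ^+ j)%g.
  have /near_normP[d d0 dP] := etaX j.
  have [k1 h1] := small_dyadic t d0.
  have [k2 h2] := small_dyadic t eps0.
  have [k3 h3] := small_dyadic (j%:R * t) eps0.
  pose k := maxn k1 (maxn k2 k3).
  have {}h1 : `|t / 2 ^+ k| < d by apply: small_dyadic_le h1; rewrite leq_maxl.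
  have {}h2 : `|t / 2 ^+ k| < eps by apply: small_dyadic_le h2; rewrite /k maxnCA leq_maxl.
  have {}h3 : `|j%:R * t / 2 ^+ k| < eps by apply: small_dyadic_le h3; rewrite /k maxnA leq_maxr.
  rewrite (sigmaE k _ h3) (sigmaE k _ h2) -mulrA dP ?subr0//.
  by rewrite -!expgnA mulnC.
have sigmaV t : sigma (- t) = (sigma t)^-1%g.
  have /near_normP[d d0 dP] := etaV.
  have [k1 h1] := small_dyadic t d0.
  have [k2 h2] := small_dyadic t eps0.
  pose k := maxn k1 k2.
  have {}h1 : `|t / 2 ^+ k| < d by apply: small_dyadic_le h1; rewrite leq_maxl.
  have {}h2 : `|t / 2 ^+ k| < eps by apply: small_dyadic_le h2; rewrite leq_maxr.
  rewrite (sigmaE k t h2) (sigmaE k) ?mulNr ?normrN//.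
  by rewrite dP ?subr0// expVgn.
have sigmac : continuous sigma.
  move=> t; have [k h] := small_dyadic t eps0.
  have nt : \forall s \near t, `|s / 2 ^+ k| < eps.
    have : (fun s : R => s / 2 ^+ k) @ t --> t / 2 ^+ k.
      by apply: cvgM; [exact: cvg_id|exact: cvg_cst].
    by move=> H; apply: (H [set x : R | `|x| < eps]); exact: (@near_norm_lt R R).
  have E : \forall s \near t, (eta (s / 2 ^+ k)%R ^+ (2 ^ k)%N)%g = sigma s.
    by apply: filterS nt => s hs; rewrite (sigmaE k).
  rewrite /continuous_at -(nbhs_singleton E).
  apply: (cvg_trans (near_eq_cvg E)).
  apply: (@expg_continuous _ (fun s : R => eta (s / 2 ^+ k)) t).
  apply: (@continuous_comp _ _ _ (fun s : R => s / 2 ^+ k) eta); last exact: etac.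
  by apply: cvgM; [exact: cvg_id|exact: cvg_cst].
have sigmaD0 s t : 0 <= s -> 0 <= t -> sigma (s + t) = (sigma s * sigma t)%g.
  move=> s0 t0.
  have [mc _ _] := lieG.
  pose a k := (Num.truncn (s * 2 ^+ k))%:R / (2 : R) ^+ k.
  pose b k := (Num.truncn (t * 2 ^+ k))%:R / (2 : R) ^+ k.
  have ab k : sigma (a k + b k) = (sigma (a k) * sigma (b k))%g.
    by rewrite /a /b -mulrDl -natrD !sigmaX expgnDr.
  have ca : a @ \oo --> s by exact: dyadic_approx.
  have cb : b @ \oo --> t by exact: dyadic_approx.
  have cab : (fun k => a k + b k) @ \oo --> s + t by exact: cvgD.
  have l1 : (fun k => sigma (a k + b k)) @ \oo --> sigma (s + t).
    exact: (cvg_comp _ _ cab (sigmac (s + t))).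
  have l2 : (fun k => sigma (a k + b k)) @ \oo --> (sigma s * sigma t)%g.
    rewrite (_ : (fun k => sigma (a k + b k)) = fun k => (sigma (a k) * sigma (b k))%g); last first.
      by apply/funext.
    have sa : (sigma \o a) @ \oo --> sigma s := cvg_comp _ _ ca (sigmac s).
    have sb : (sigma \o b) @ \oo --> sigma t := cvg_comp _ _ cb (sigmac t).
    exact: (cvg_comp _ _ (cvg_pair sa sb) (mc (sigma s, sigma t))).
  exact: (cvg_unique (manifold_hausdorff M) l1 l2).
exists sigma; split=> //.
  move=> s t.
  (* Up to inverting both sides; the mixed signs then reduce to nonnegative arguments by
   moving the negative one to the other side. *)
  wlog : s t / 0 <= s + t => [H|st].
    have [h|h] := leP 0 (s + t); first exact: H.
    have := H (- t) (- s); rewrite -opprD addrC oppr_ge0 => /(_ (ltW h)).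
    by rewrite !sigmaV -invgM => /invg_inj; rewrite addrC.
  have [s0|s0] := leP 0 s; have [t0|t0] := leP 0 t.
  - exact: sigmaD0.
  - have := sigmaD0 (s + t) (- t) st; rewrite addrK oppr_ge0 sigmaV => /(_ (ltW t0)) ->.
    by rewrite mulgVK.
  - have := sigmaD0 (- s) (s + t) _ st; rewrite addKr oppr_ge0 sigmaV => /(_ (ltW s0)) ->.
    by rewrite mulVKg.
  - by have := ltrD s0 t0; rewrite addr0 ltNge st.
have [C H] := teta; exists C.
have n0 : \forall t \near (0 : R), `|t| < eps.
  by apply: near_norm_lt; rewrite normr0.
apply: filterS2 n0 H => t te; by rewrite sigma_loc.
Unshelve. all: by end_near. Qed.

End ExpGlobal.

(** * Smoothness and uniqueness of one-parameter subgroups *)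

(** Bootstrapping: if x is of class C^k then so is V \o x, which is its derivative. *)
Lemma ode_smooth (R : realType) n (V : 'rV[R]_n -> 'rV[R]_n) (x : R -> 'rV[R]_n) (A : set R) B :
  open A -> open B -> (forall t, A t -> B (x t)) -> smooth_on V B ->
  (forall t, A t -> is_derive t 1 x (V (x t))) -> smooth_on x A.
Proof.
move=> oA oB AB sV dx.
have xc t : A t -> {for t, continuous x}.
  move=> At; apply: differentiable_continuous; apply/derivable1_diffP.
  by have [] := dx t At.
elim=> [|k IH]; first by split.
split=> // v.
have dv t : A t -> is_derive t v x (v *: V (x t)).
  move=> At; have [d1 d2] := dx t At.
  by have := is_derive_scalev v d1; rewrite d2 [v *: 1]mulr1.
split; first by move=> t /dv[].
have C1 : C_on k (V \o x) A by apply: (C_on_comp (framed_rV n) oA oB AB IH).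
have bl : bounded_linear (fun w : 'rV[R]_n => v *: w).
  split; first by move=> a y z; rewrite scalerDr scalerA mulrC -scalerA.
  exists (`|v| + 1); first by rewrite ltr_wpDl.
  by move=> y; rewrite normrZ ler_wpM2r// lerDl.
apply: (C_on_ext oA _ (C_on_linear_comp oA bl C1)) => t At /=.
by have [_ ->] := dv t At.
Qed.

Section Exp.
Context {R : realType} {G : topGroupType} {n : nat}.
Variable (M : smooth_structure R G n).
Hypothesis lieG : is_lie_group M.
Variable (e : chart R G n).
Hypotheses (Me : atlas M e) (e1 : chart_dom e 1%g).
Local Notation o := (e 1%g).

Lemma msmooth_curve (sigma : R -> G) t : smooth_curve M sigma -> msmooth M sigma t.
Proof.
move=> [sc ss]; split; first exact: sc.
move=> c Mc ct; apply: smooth_at_near_on (ss c Mc).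
by apply: sc; exact: near_chart_dom.
Qed.

Lemma tangent_derive X (a : R -> G) : tangent e X a -> is_derive (0 : R) 1 (e \o a) X.
Proof.
move=> ta; have [C H] := ta; have a0 := tangent0 e1 ta.
have [|d1 d2] := @differentiable_of_estimate _ _ _ (e \o a) (fun t => t *: X) 0 (bounded_linear_scalel X).
  move=> eps eps0.
  have n0 : \forall t \near (0 : R), `|t| < eps / (`|C| + 1).
    by apply: (@near_norm_lt R R); rewrite normr0 divr_gt0// ltr_wpDl.
  apply: filterS2 n0 H => t te [_ h]; rewrite subr0 /= a0.
  apply: (le_trans h); rewrite -(real_normK (num_real t)) expr2 mulrA ler_wpM2r//.
  move: te; rewrite ltr_pdivlMr ?ltr_wpDl// => te.
  rewrite (le_trans _ (ltW te))// mulrC ler_wpM2l//.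
  by rewrite (le_trans (ler_norm C))// lerDl.
split; first by apply/derivable1_diffP.
by rewrite deriveE// d2 scale1r.
Qed.

(** As sigma (t + u) = sigma t * sigma u, the velocity at t is the left translate of the
velocity at 0: a homomorphism is an integral curve of a left-invariant field. *)
Lemma homomorphism_derive X (sigma : R -> G) t (c : chart R G n) :
  (forall s t, sigma (s + t) = (sigma s * sigma t)%g) -> tangent e X sigma ->
  atlas M c -> chart_dom c (sigma t) ->
  is_derive t 1 (c \o sigma) (tangent_map e c (fun b => sigma t * b)%g 1%g X).
Proof.
move=> sD ts Mc ct; have s0 := tangent0 e1 ts.
have [d1 d2] := tangent_derive ts.
pose F z := c (sigma t * chart_inv e z)%g.
have sF : smooth_at F o.
  by have [_] := msmooth_lmul lieG (sigma t) Me (chart_img e1); apply => //=; rewrite chart_mapK// mulg1.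
have dF : differentiable F ((e \o sigma) 0).
  by rewrite /= s0; exact: smooth_at_diff (framed_rV n) sF.
have := is_derive_comp d1 dF; rewrite d2 /= s0 => D.
pose f (u : R) := c (sigma (t + u)).
have nE : \forall u \near (0 : R), (F \o (e \o sigma)) u = f u.
  have [C H] := ts; apply: filterS H => u [eu _].
  by rewrite /F/f/= chart_mapK// sD.
have [D1 D2] : is_derive (t - t) 1 f ('d F o X) by rewrite subrr; exact: near_eq_is_derive nE D.
have := is_derive_translate D1; rewrite D2.
congr (is_derive _ _ _ _); apply/funext => z.
by rewrite /f addrC subrK.
Qed.

Definition left_invariant_field (c : chart R G n) (X x : 'rV[R]_n) :=
  tangent_map e c (fun b => chart_inv c x * b)%g 1%g X.

Lemma left_invariant_field_smooth (c : chart R G n) X : atlas M c -> smooth_on (left_invariant_field c X) (c @` chart_dom c).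
Proof.
move=> Mc; apply: smooth_at_on => x cx.
pose N (z : 'rV[R]_n * 'rV[R]_n) := c (chart_inv c z.1 * chart_inv e z.2)%g.
have sN y : (c @` chart_dom c) y -> smooth_at N (y, o).
  move=> cy.
  have : msmooth M (fun z : 'rV[R]_n * 'rV[R]_n => chart_inv c z.1 * chart_inv e z.2)%g (y, o).
    apply: msmooth_mul => //.
      apply: (@msmooth_comp _ _ _ _ _ _ (fun z => z.1) (chart_inv c)); [exact: framed_rV| |exact: msmooth_chart_inv].
      exact: smooth_at_linear (bounded_linear_fst _ _).
    apply: (@msmooth_comp _ _ _ _ _ _ (fun z => z.2) (chart_inv e)); [exact: framed_rV| |].
      exact: smooth_at_linear (bounded_linear_snd _ _).
    by apply: msmooth_chart_inv => //; exact: chart_img.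
  case=> _; apply => //=; rewrite chart_mapK// mulg1; exact: chart_inv_dom.
apply: (@smooth_at_ext _ _ _ ('D_(0, X) N \o (fun y => (y, o)))).
  have : \forall y \near x, (c @` chart_dom c) y.
    by apply: open_nbhs_nbhs; split; [exact: chart_cod_open|].
  apply: filterS => y cy; rewrite /= derive_snd /left_invariant_field /tangent_map deriveE//.
  have [_] := msmooth_lmul lieG (chart_inv c y) Me (chart_img e1) => /(_ c Mc); rewrite chart_mapK// mulg1.
  by move=> /(_ (chart_inv_dom cy))/(smooth_at_diff (framed_rV n)).
apply: smooth_at_comp.
- exact: framed_rV2.
- by apply: smooth_at_pair; [exact: smooth_at_id|exact: smooth_at_cst].
- by apply: smooth_at_derive; exact: sN.
Qed.

Lemma homomorphism_smooth X (sigma : R -> G) : continuous sigma ->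
  (forall s t, sigma (s + t) = (sigma s * sigma t)%g) -> tangent e X sigma ->
  smooth_curve M sigma.
Proof.
move=> sc sD ts; split=> // c Mc.
apply: (@ode_smooth _ _ (left_invariant_field c X) _ _ (c @` chart_dom c)).
- apply: open_comp; last exact: chart_dom_open.
  by move=> t _; exact: sc.
- exact: chart_cod_open.
- by move=> t ct; exact: chart_img.
- exact: left_invariant_field_smooth.
- move=> t ct; rewrite /left_invariant_field /= chart_mapK//; exact: homomorphism_derive.
Qed.

Lemma one_param_tang X sigma : one_parameter_subgroup M e X sigma ->
  sigma 0 = 1%g /\ tangent e X sigma.
Proof.
move=> [ss sD sX].
have s0 : sigma 0 = 1%g.
  have : sigma (0 + 0) = (sigma 0 * sigma 0)%g by exact: sD.
  by rewrite addr0 => /(congr1 (fun a => (sigma 0)^-1 * a)%g); rewrite mulKg mulVg.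
split=> //; rewrite -sX derive1E; apply: (smooth_tangent Me) => //.
exact: msmooth_curve.
Qed.

(** Two such subgroups agree near 0 by [tangent_doubling_unique], and 2 ^ k-th powers
propagate this to all times. *)
Lemma one_param_unique X s1 s2 t : one_parameter_subgroup M e X s1 ->
  one_parameter_subgroup M e X s2 -> s1 t = s2 t.
Proof.
move=> o1 o2; have [_ t1] := one_param_tang o1; have [_ t2] := one_param_tang o2.
have [[_ D1 _] [_ D2 _]] := (o1, o2).
have dbl (s : R -> G) : (forall a b, s (a + b) = (s a * s b)%g) -> forall u, s (2 * u) = (s u * s u)%g.
  by move=> sD u; rewrite mulr_natl mulr2n sD.
have := tangent_doubling_unique lieG Me e1 t1 t2.
case/(_ _ _)/near_normP.
- by near=> u; exact: dbl.
- by near=> u; exact: dbl.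
move=> d d0 dP; have [k hk] := small_dyadic t d0.
have pw (s : R -> G) : (forall a b, s (a + b) = (s a * s b)%g) -> s t = (s (t / 2 ^+ k)%R ^+ (2 ^ k)%N)%g.
  move=> sD; elim: k {hk} => [|k IH]; first by rewrite divr1 expg1.
  rewrite IH expnS expgnA; congr (_ ^+ _)%g.
  have -> : t / 2 ^+ k = t / 2 ^+ k.+1 + t / 2 ^+ k.+1 by rewrite exprSr invfM mulrA -splitr.
  by rewrite sD.
by rewrite (pw s1 D1) (pw s2 D2) dP// subr0.
Unshelve. all: by end_near. Qed.

Lemma one_param_scale X sigma (t : R) : one_parameter_subgroup M e X sigma ->
  one_parameter_subgroup M e (t *: X) (fun u => sigma (t * u)).
Proof.
move=> os; have [s0 ts] := one_param_tang os; have [ss sD _] := os.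
have ts' : tangent e (t *: X) (fun u => sigma (t * u)) by exact: tangentZ.
have sD' a b : sigma (t * (a + b)) = (sigma (t * a)%R * sigma (t * b)%R)%g by rewrite mulrDr sD.
have sc : continuous (fun u => sigma (t * u)).
  move=> u; apply: (@continuous_comp _ _ _ (fun u => t * u) sigma); last exact: ss.1.
  by apply: cvgM; [exact: cvg_cst|exact: cvg_id].
split=> //; first exact: homomorphism_smooth ts'.
by rewrite derive1E; have [_ ->] := tangent_derive ts'.
Qed.

(** The value chosen by [lie_exp] at t X is the value at time 1 of some subgroup with
velocity t X; by uniqueness this is the reparametrized sigma. *)
Lemma lie_exp_curve (X : 'rV[R]_n) : exists sigma : R -> G,
  [/\ one_parameter_subgroup M e X sigma, tangent e X sigma &
      forall t, lie_exp M e (t *: X) = sigma t].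
Proof.
have [sigma [sc sD ts]] := homomorphism_exists lieG Me e1 X.
have os : one_parameter_subgroup M e X sigma.
  split=> //; first exact: homomorphism_smooth ts.
  by rewrite derive1E; have [_ ->] := tangent_derive ts.
exists sigma; split=> // t.
rewrite /lie_exp; case: xgetP => [a -> [tau ot ->]|].
  by rewrite (one_param_unique 1 ot (one_param_scale t os)) mulr1.
move=> /(_ (sigma t)) H; exfalso; apply: H.
exists (fun u => sigma (t * u)); first exact: one_param_scale.
by rewrite mulr1.
Qed.

End Exp.

(** * Homogeneous functions and the geodesic spray *)

Lemma near_neq0 (R : realType) (V : normedModType R) (y : V) :
  y != 0 -> \forall w \near y, w != 0.
Proof.
move=> y0; apply/near_normP; exists `|y|; first by rewrite normr_gt0.
by move=> z; apply: contraTneq => ->; rewrite sub0r normrN ltxx.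
Qed.

Lemma sum_kronecker (R : pzSemiRingType) n (a b : 'I_n -> R) k :
  \sum_j (a j + b j * (j == k)%:R) = \sum_j a j + b k.
Proof.
rewrite big_split/=; apply: congr1; rewrite (bigD1 k)//= eqxx mulr1 big1 ?addr0//.
by move=> j /negbTE ->; rewrite mulr0.
Qed.

Lemma christoffel_contract (R : comPzRingType) n (h : R) (p : 'I_n -> 'I_n -> R)
    (g : 'I_n -> R) (u v w : 'I_n -> 'I_n -> 'I_n -> R) :
  \sum_j \sum_k p j k * (h * \sum_s g s * (u s j k - v s j k + w s j k)) =
  h * \sum_s g s * (\sum_j \sum_k p j k * u s j k - \sum_j \sum_k p j k * v s j k
     + \sum_j \sum_k p j k * w s j k).
Proof.
transitivity (\sum_j \sum_k \sum_s h * (g s *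
    (p j k * u s j k - p j k * v s j k + p j k * w s j k))).
  apply: eq_bigr => j _; apply: eq_bigr => k _.
  by rewrite mulrCA mulr_sumr mulr_sumr; apply: eq_bigr => s _; ring.
under eq_bigr do rewrite exchange_big.
rewrite exchange_big mulr_sumr; apply: eq_bigr => s _.
under eq_bigr do rewrite -mulr_sumr -mulr_sumr big_split/= sumrB.
by rewrite -mulr_sumr -mulr_sumr big_split/= sumrB.
Qed.

Lemma half_sub_half (R : numFieldType) (a b c p q : R) :
  a = 2^-1 * p -> b = q -> c = 2^-1 * p -> a - b + c = p - q.
Proof. by move=> -> -> ->; field. Qed.

Section Homog.
Context {R : realType} {n : nat}.
Local Notation V := 'rV[R]_n.
Local Notation ee i := (delta_mx 0 i : V).
Implicit Types (g : V -> R) (y v : V).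

Lemma derive1_line g y v : derive1 (fun t : R => g (y + t *: v)) 0 = 'D_v g y.
Proof.
rewrite derive1E /derive.
have -> : (fun h : R => h^-1 *: (((fun t : R => g (y + t *: v)) \o shift 0) (h *: (1 : R)) - g (y + (0 : R) *: v)))
    = (fun h => h^-1 *: ((g \o shift y) (h *: v) - g y)).
  apply/funext => h /=; rewrite scale0r !addr0 [h *: 1]mulr1.
  by rewrite [y + _]addrC.
by [].
Qed.

Lemma fundamental_formE (f : V -> R) y u v :
  fundamental_form f y u v = 2^-1 * 'D_u ('D_v (fun z => f z ^+ 2)) y.
Proof.
rewrite /fundamental_form.
have -> : (fun s : R => derive1 (fun t : R => f (y + s *: u + t *: v) ^+ 2) 0) =
   (fun s : R => 'D_v (fun z => f z ^+ 2) (y + s *: u)).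
  by apply/funext => s; rewrite (derive1_line (fun z => f z ^+ 2)).
exact: (congr1 ( *%R 2^-1) (derive1_line _ y u)).
Qed.

Lemma derive_sumv (W : normedModType R) (f : W -> R) z (I : Type) (r : seq I) (a : I -> R) (w : I -> W) :
  differentiable f z -> 'D_(\sum_(i <- r) a i *: w i) f z = \sum_(i <- r) a i * 'D_(w i) f z.
Proof.
move=> df; rewrite deriveE// linear_sum; apply: eq_bigr => i _.
by rewrite linearZ/= (deriveE _ df).
Qed.

Lemma derive_rowE g y v : differentiable g y -> 'D_v g y = \sum_i v 0 i * 'D_(ee i) g y.
Proof. by move=> dg; rewrite [in LHS](row_sum_delta v) derive_sumv. Qed.

Lemma derive_sumf (W : normedModType R) n' (f : 'I_n' -> W -> R) (a : 'I_n' -> R) z w :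
  (forall i, derivable (f i) z w) ->
  'D_w (fun z => \sum_i a i * f i z) z = \sum_i a i * 'D_w (f i) z.
Proof.
move=> df.
have -> : (fun z => \sum_i a i * f i z) = \sum_i (fun z => a i *: f i z).
  by apply/funext => x; rewrite fct_sumE.
rewrite derive_sum; last by move=> i; exact: derivableZ.
by apply: eq_bigr => i _; exact: deriveZ.
Qed.

(** Differentiate g (t y) = t ^ d g y at t = 1. *)
Lemma euler g y (d : nat) : differentiable g y ->
  (forall t : R, 0 < t -> g (t *: y) = t ^+ d * g y) ->
  'D_y g y = d%:R * g y.
Proof.
move=> dg H.
have D := @is_derive_line _ _ _ g 0 y 1; rewrite scale1r add0r in D.
have [_ D2] := D (diff_derivable dg).
rewrite -D2.
have E : \forall t \near (1 : R), g (0 + t *: y) = g y * t ^+ d.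
  have : \forall t \near (1 : R), 0 < t.
    apply/near_normP; exists 1 => // z; rewrite distrC => h.
    by have := le_lt_trans (ler_norm _) h; lra.
  by apply: filterS => t t0; rewrite add0r H// mulrC.
rewrite (near_eq_derive _ E).
have -> : (fun t : R => g y * t ^+ d) = (g y) *: (fun t : R => t ^+ d) by [].
rewrite deriveZ; last exact: exprn_derivable.
rewrite exp_derive expr1n -[LHS]/(g y * (d%:R * 1 * 1)).
by rewrite !mulr1 mulrC.
Qed.

Lemma homog_derive g y v (d : nat) (t : R) : 0 < t ->
  (forall z, g (t *: z) = t ^+ d.+1 * g z) -> derivable g y v -> derivable g (t *: y) v ->
  'D_v g (t *: y) = t ^+ d * 'D_v g y.
Proof.
move=> t0 H dg dgt.
have D1 : 'D_v (fun z => g (t *: z)) y = t ^+ d.+1 * 'D_v g y.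
  have -> : (fun z => g (t *: z)) = (t ^+ d.+1) *: g by apply/funext => z; rewrite H.
  exact: deriveZ.
have D2 : 'D_v (fun z => g (t *: z)) y = t * 'D_v g (t *: y).
  have [_] := is_derive_scalev t dgt.
  have -> : 'D_(t *: v) g (t *: y) = 'D_v (fun z => g (t *: z)) y; last by [].
  rewrite /derive; congr (lim _).
  have -> : (fun h : R => h^-1 *: ((g \o shift (t *: y)) (h *: (t *: v)) - g (t *: y))) =
     (fun h : R => h^-1 *: (((fun z => g (t *: z)) \o shift y) (h *: v) - g (t *: y))).
    by apply/funext => h /=; rewrite [t *: (_ + _)]scalerDr !scalerA [h * t]mulrC.
  by [].
apply: (@mulfI _ t); first by rewrite gt_eqF.
by rewrite -D2 D1 exprS mulrA.
Qed.

End Homog.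

Section Spray.
Context {R : realType} {n : nat}.
Local Notation V := 'rV[R]_n.
Local Notation ee i := (delta_mx 0 i : V).
Variable F : V -> V -> R.
Variable A : set V.
Hypothesis oA : open A.
(** The squared norm as one function on V * V, so that derivatives in x and in y commute
by the symmetry of second derivatives. *)
Definition energy (z : V * V) := F z.1 z.2 ^+ 2.
Local Notation E := energy.
Definition partial_y (i : 'I_n) (f : V * V -> R) (z : V * V) : R := derive f z (0, ee i).
Definition partial_x (i : 'I_n) (f : V * V -> R) (z : V * V) : R := derive f z (ee i, 0).
Local Notation Dy := partial_y.
Local Notation Dx := partial_x.
Hypothesis sE : forall x y, A x -> y != 0 -> smooth_at E (x, y).
Hypothesis hF : forall x y (t : R), A x -> 0 < t -> F x (t *: y) = t * F x y.
Hypothesis pF : forall x y u, A x -> y != 0 -> u != 0 -> 0 < fundamental_form (F x) y u u.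

Let fVV : framed (V * V)%type := framed_prod (framed_rV n) (framed_rV n).

Lemma partial_yE i f x y : Dy i f (x, y) = 'D_(ee i) (fun z => f (x, z)) y.
Proof. exact: derive_snd. Qed.

Lemma partial_xE i f x y : Dx i f (x, y) = 'D_(ee i) (fun z => f (z, y)) x.
Proof. exact: derive_fst. Qed.

Lemma partial_y_def i f z : Dy i f z = 'D_(0, ee i) f z.
Proof. by []. Qed.

Lemma smooth_partial_y i f z : smooth_at f z -> smooth_at (Dy i f) z.
Proof. exact: smooth_at_derive. Qed.

Lemma partial_yC i j f z : smooth_at f z -> Dy i (Dy j f) z = Dy j (Dy i f) z.
Proof. exact: (smooth_at_derive_symR (0, ee i) (0, ee j) fVV). Qed.

Lemma near_partial_y i f g z : (\forall w \near z, f w = g w) -> Dy i f z = Dy i g z.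
Proof. exact: near_eq_derive. Qed.

Lemma metricE i j x y : metric F i j x y = 2^-1 * Dy i (Dy j E) (x, y).
Proof.
rewrite /metric fundamental_formE partial_yE.
have -> : (fun z => Dy j E (x, z)) = 'D_(ee j) (fun z => F x z ^+ 2).
  by apply/funext => z; rewrite partial_yE.
by [].
Qed.

Lemma smooth_snd (f : V * V -> R) x y : smooth_at f (x, y) -> smooth_at (fun z => f (x, z)) y.
Proof.
move=> sf; apply: (@smooth_at_compR _ _ _ (fun z => (x, z)) f) => //.
by apply: smooth_at_pair; [exact: smooth_at_cst|exact: smooth_at_id].
Qed.

Lemma smooth_fst (f : V * V -> R) x y : smooth_at f (x, y) -> smooth_at (fun z => f (z, y)) x.
Proof.
move=> sf; apply: (@smooth_at_compR _ _ _ (fun z => (z, y)) f) => //.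
by apply: smooth_at_pair; [exact: smooth_at_id|exact: smooth_at_cst].
Qed.

Lemma sum_Dy (f : V * V -> R) x y : smooth_at f (x, y) ->
  \sum_j y 0 j * Dy j f (x, y) = 'D_y (fun z => f (x, z)) y.
Proof.
move=> sf; rewrite derive_rowE; last exact: smooth_at_diffR (framed_rV n) (smooth_snd sf).
by apply: eq_bigr => j _; rewrite partial_yE.
Qed.

Lemma homogE x y (t : R) : A x -> 0 < t -> E (x, t *: y) = t ^+ 2 * E (x, y).
Proof. by move=> Ax t0; rewrite /E/= hF// exprMn. Qed.

Lemma homogDE x y i (t : R) : A x -> y != 0 -> 0 < t -> Dy i E (x, t *: y) = t ^+ 1 * Dy i E (x, y).
Proof.
move=> Ax y0 t0; rewrite !partial_yE; apply: homog_derive => //.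
- by move=> z; exact: homogE.
- exact: smooth_at_derivable (smooth_snd (sE Ax y0)).
- apply: smooth_at_derivable (smooth_snd (sE Ax _)).
  by rewrite scaler_eq0 negb_or y0 gt_eqF.
Qed.

Lemma euler0 (x y : V) : A x -> y != 0 -> \sum_j y 0 j * Dy j E (x, y) = 2 * E (x, y).
Proof.
move=> Ax y0; rewrite sum_Dy; last exact: sE.
rewrite (@euler _ _ _ _ 2)//; first exact: smooth_at_diffR (framed_rV n) (smooth_snd (sE Ax y0)).
by move=> t t0; exact: homogE.
Qed.

Lemma euler1 (x y : V) i : A x -> y != 0 -> \sum_j y 0 j * Dy j (Dy i E) (x, y) = Dy i E (x, y).
Proof.
move=> Ax y0; have s1 := smooth_partial_y i (sE Ax y0).
rewrite sum_Dy// (@euler _ _ _ _ 1) ?mul1r//.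
  exact: smooth_at_diffR (framed_rV n) (smooth_snd s1).
by move=> t t0; exact: homogDE.
Qed.

Local Opaque partial_y partial_x.

(** Differentiating [euler1] once more in y: the derivative of the factors y_j reproduces
the right-hand side, so the remaining sum vanishes. Up to a constant it is the Cartan
tensor contracted with y. *)
Lemma euler2 (x y : V) i k : A x -> y != 0 -> \sum_j y 0 j * Dy k (Dy i (Dy j E)) (x, y) = 0.
Proof.
move=> Ax y0.
have ny : \forall w \near (x, y), A w.1 /\ w.2 != 0.
  have n1 : \forall w \near x, A w by exact: open_nbhs_nbhs.
  have n2 : \forall w \near y, w != 0 by exact: near_neq0.
  by exists ([set w | A w], [set w | w != 0]) => //=; split.
have sw : \forall w \near (x, y), smooth_at E w by exact: smooth_at_near (sE Ax y0).
have s1 := sE Ax y0.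
have s2 j := smooth_partial_y j s1.
have s3 i j := smooth_partial_y i (s2 j).
pose c j (w : V * V) : R := w.2 0 j.
have H : \forall w \near (x, y), \sum_j c j w * Dy i (Dy j E) w = Dy i E w.
  apply: filterS2 ny sw => -[x' y'] /= [Ax' y'0] s'.
  apply: etrans _ (euler1 i Ax' y'0).
  apply: eq_bigr => j _.
  rewrite (partial_yC i j s').
  by [].
have := near_partial_y k H.
have sc j w : smooth_at (c j) w.
  exact: smooth_at_linear (bounded_linear_comp (bounded_linear_snd _ _) (bounded_linear_coord j)).
have Dc j : Dy k (c j) (x, y) = (j == k)%:R.
  rewrite partial_yE; have -> : (fun z => c j (x, z)) = fun z : V => z 0 j by [].
  have d : differentiable (fun z : V => z 0 j) y by exact: differentiable_coord.
  by rewrite -derive_coord ?derive_id ?mxE//.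
rewrite partial_y_def.
have -> : (fun w : V * V => \sum_j c j w * Dy i (Dy j E) w) = \sum_j (fun w => c j w * Dy i (Dy j E) w).
  by apply/funext => w; rewrite fct_sumE.
rewrite derive_sum; last first.
  by move=> j; apply: smooth_at_derivable; apply: smooth_atM.
have P j : 'D_(0, 'e_k) (fun w => c j w * Dy i (Dy j E) w) (x, y) =
     y 0 j * Dy k (Dy i (Dy j E)) (x, y) + Dy i (Dy j E) (x, y) * (j == k)%:R.
  rewrite -Dc !partial_y_def deriveM; [by []|exact: smooth_at_derivable|exact: smooth_at_derivable].
under eq_bigr do rewrite P.
rewrite sum_kronecker (partial_yC i k s1) => h; apply: (addIr (Dy k (Dy i E) (x, y))).
by apply: etrans h _; rewrite add0r.
Qed.

Lemma metric_sym (x y : V) i j : A x -> y != 0 -> metric F i j x y = metric F j i x y.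
Proof. by move=> Ax y0; rewrite !metricE (partial_yC _ _ (sE Ax y0)). Qed.

Lemma smooth_metric (x y : V) i j : A x -> y != 0 ->
  smooth_at (fun z : V * V => metric F i j z.1 z.2) (x, y).
Proof.
move=> Ax y0; apply: (@smooth_at_ext _ _ _ (fun z : V * V => 2^-1 * Dy i (Dy j E) z)).
  by apply: (@nearW _ (nbhs (x, y))) => -[? ?]; rewrite metricE.
apply: smooth_atM; first exact: smooth_at_cst.
by do 2!apply: smooth_partial_y; exact: sE.
Qed.

Lemma metric_contract (x y : V) s : A x -> y != 0 ->
  \sum_j y 0 j * metric F s j x y = 2^-1 * Dy s E (x, y).
Proof.
move=> Ax y0; rewrite -(euler1 s Ax y0) mulr_sumr; apply: eq_bigr => j _.
by rewrite metricE (partial_yC _ _ (sE Ax y0)) mulrCA.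
Qed.

Lemma metric_contract2 (x y : V) : A x -> y != 0 ->
  \sum_j y 0 j * \sum_k y 0 k * metric F j k x y = E (x, y).
Proof.
move=> Ax y0; under eq_bigr do rewrite metric_contract// mulrCA.
by rewrite -mulr_sumr euler0// mulKf.
Qed.

Lemma dyE m s j (x y : V) : A x -> y != 0 ->
  dy m (metric F s j) x y = 2^-1 * Dy m (Dy s (Dy j E)) (x, y).
Proof.
move=> Ax y0; rewrite /dy [in RHS]partial_yE.
have -> : metric F s j x = 2^-1 *: (fun z => Dy s (Dy j E) (x, z)).
  by apply/funext => z; rewrite metricE.
apply: deriveZ; apply: smooth_at_derivable; apply: smooth_snd.
by do 2!apply: smooth_partial_y; exact: sE.
Qed.

Lemma dy_contract m s (x y : V) : A x -> y != 0 ->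
  \sum_j y 0 j * dy m (metric F s j) x y = 0.
Proof.
move=> Ax y0; under eq_bigr do rewrite dyE// mulrCA.
by rewrite -mulr_sumr euler2// mulr0.
Qed.

Lemma dy_sym m s j (x y : V) : A x -> y != 0 ->
  dy m (metric F s j) x y = dy m (metric F j s) x y.
Proof.
move=> Ax y0; apply: near_eq_derive.
by apply: filterS (near_neq0 y0) => z z0; exact: metric_sym.
Qed.

Lemma near_A x : A x -> \forall z \near x, A z.
Proof. by move=> Ax; exact: open_nbhs_nbhs. Qed.

Lemma derivable_metric_x s j (x y v : V) : A x -> y != 0 ->
  derivable (fun x' => metric F s j x' y) x v.
Proof.
move=> Ax y0; apply: smooth_at_derivable.
exact: (smooth_fst (f := fun z => metric F s j z.1 z.2) (smooth_metric s j Ax y0)).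
Qed.

Lemma dx_sym k s j (x y : V) : A x -> y != 0 ->
  dx k (metric F s j) x y = dx k (metric F j s) x y.
Proof.
move=> Ax y0; apply: near_eq_derive.
by apply: filterS (near_A Ax) => z z0; exact: metric_sym.
Qed.

Lemma dx_contract k s (x y : V) : A x -> y != 0 ->
  \sum_j y 0 j * dx k (metric F s j) x y = 2^-1 * Dx k (Dy s E) (x, y).
Proof.
move=> Ax y0; rewrite /dx -(@derive_sumf _ _ _ (fun j x' => metric F s j x' y) (fun j => y 0 j)); last first.
  by move=> j; exact: derivable_metric_x.
have H : \forall x' \near x, \sum_j y 0 j * metric F s j x' y = 2^-1 * Dy s E (x', y).
  by apply: filterS (near_A Ax) => z Az; exact: metric_contract.
rewrite (near_eq_derive _ H) [in RHS]partial_xE.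
have -> : (fun x' => 2^-1 * Dy s E (x', y)) = 2^-1 *: (fun x' => Dy s E (x', y)) by [].
apply: deriveZ; apply: smooth_at_derivable; apply: smooth_fst.
by apply: smooth_partial_y; exact: sE.
Qed.

Lemma dx_contract2 s (x y : V) : A x -> y != 0 ->
  \sum_j y 0 j * \sum_k y 0 k * dx s (metric F j k) x y = Dx s E (x, y).
Proof.
move=> Ax y0; rewrite partial_xE.
have H : \forall x' \near x, \sum_j y 0 j * \sum_k y 0 k * metric F j k x' y = E (x', y).
  by apply: filterS (near_A Ax) => z Az; exact: metric_contract2.
rewrite -(near_eq_derive _ H) derive_sumf; last first.
  move=> j.
  have -> : (fun z => \sum_k y 0 k * metric F j k z y) = \sum_k (fun z => y 0 k *: metric F j k z y).
    by apply/funext => z; rewrite fct_sumE.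
  by apply: derivable_sum => k; apply: derivableZ; exact: derivable_metric_x.
apply: eq_bigr => j _; congr (_ * _).
by rewrite derive_sumf// => k; exact: derivable_metric_x.
Qed.

Lemma delta_dxE k f x y : delta_dx F k f x y =
  dx k f x y - \sum_m nonlinear_connection F m k x y * dy m f x y.
Proof. by []. Qed.

Lemma delta_dx_congr k f f' x y : dx k f x y = dx k f' x y ->
  (forall m, dy m f x y = dy m f' x y) -> delta_dx F k f x y = delta_dx F k f' x y.
Proof. by rewrite !delta_dxE => -> H; under eq_bigr do rewrite H. Qed.

Local Opaque delta_dx dx dy metric.

(** Each correction N dg/dy in a delta/delta x is killed by contraction with y
([dy_contract]), so that the Chern coefficients may be computed with the coordinate
derivatives dx of the metric. These contract to derivatives of E. *)
Lemma chern_contract i (x y : V) : A x -> y != 0 ->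
  \sum_j \sum_k y 0 j * y 0 k * chern_coefficient F i j k x y =
  2^-1 * \sum_s inverse_metric F i s x y *
    (\sum_k y 0 k * Dx k (Dy s E) (x, y) - Dx s E (x, y)).
Proof.
move=> Ax y0.
pose N m k := nonlinear_connection F m k x y.
(* The three sums of delta-derivatives in the Chern coefficients, contracted with y y. *)
have S1 s : \sum_j \sum_k y 0 j * y 0 k * delta_dx F k (metric F s j) x y =
    2^-1 * \sum_k y 0 k * Dx k (Dy s E) (x, y).
  rewrite exchange_big mulr_sumr; apply: eq_bigr => k _.
  rewrite mulrCA -dx_contract// mulr_sumr.
  transitivity (\sum_j y 0 k * (y 0 j * dx k (metric F s j) x y) -
     \sum_j \sum_m y 0 k * N m k * (y 0 j * dy m (metric F s j) x y)).
    rewrite -sumrB; apply: eq_bigr => j _; rewrite !delta_dxE mulrBr; congr (_ - _); first by ring.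
    rewrite mulr_sumr; apply: eq_bigr => m _; rewrite /N; ring.
  rewrite exchange_big [X in _ - X]big1 ?subr0// => m _.
  by rewrite -mulr_sumr dy_contract// mulr0.
have S2 s : \sum_j \sum_k y 0 j * y 0 k * delta_dx F s (metric F j k) x y = Dx s E (x, y).
  rewrite -dx_contract2//; apply: eq_bigr => j _.
  transitivity (\sum_k y 0 j * (y 0 k * dx s (metric F j k) x y) -
     \sum_k \sum_m y 0 j * N m s * (y 0 k * dy m (metric F j k) x y)).
    rewrite -sumrB; apply: eq_bigr => k _; rewrite !delta_dxE mulrBr; congr (_ - _); first by ring.
    rewrite mulr_sumr; apply: eq_bigr => m _; rewrite /N; ring.
  rewrite [X in _ - X]exchange_big/= [X in _ - X]big1; first by rewrite subr0 -mulr_sumr.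
  by move=> m _; rewrite -mulr_sumr dy_contract// mulr0.
have S3 s : \sum_j \sum_k y 0 j * y 0 k * delta_dx F j (metric F k s) x y =
    2^-1 * \sum_k y 0 k * Dx k (Dy s E) (x, y).
  apply: etrans _ (S1 s); apply: etrans (exchange_big _ _ _ _ _ _) _.
  apply: eq_bigr => j _; apply: eq_bigr => k _.
  rewrite (mulrC (y 0 k)); apply: (congr1 ( *%R (y 0 j * y 0 k))).
  apply: delta_dx_congr => [|m]; first exact: dx_sym.
  exact: dy_sym.
apply: etrans (christoffel_contract _ _ _ (fun s j k => delta_dx F k (metric F s j) x y)
  (fun s j k => delta_dx F s (metric F j k) x y) (fun s j k => delta_dx F j (metric F k s) x y)) _.
apply: (congr1 ( *%R _)); apply: eq_bigr => s _; apply: (congr1 ( *%R _)).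
exact: (half_sub_half (S1 s) (S2 s) (S3 s)).
Qed.

Definition metric_mx (x y : V) := \matrix_(k, l) metric F k l x y.

Lemma metric_form (x y u : V) : A x -> y != 0 ->
  (u *m metric_mx x y *m u^T) 0 0 = fundamental_form (F x) y u u.
Proof.
move=> Ax y0; pose g z := E (x, z).
have sg z : z != 0 -> smooth_at g z by move=> z0; exact: smooth_snd (sE Ax z0).
have H : \forall z \near y, 'D_u g z = \sum_l u 0 l * 'D_(ee l) g z.
  apply: filterS (near_neq0 y0) => z z0; apply: derive_rowE.
  exact: smooth_at_diffR (framed_rV n) (sg z z0).
have sD l : smooth_at ('D_(ee l) g) y by apply: smooth_at_derive; exact: sg.
rewrite fundamental_formE -[fun z => F x z ^+ 2]/g (near_eq_derive _ H).
rewrite (@derive_sumf _ _ _ (fun l => 'D_(ee l) g) (fun l => u 0 l)); last first.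
  by move=> l; exact: smooth_at_derivable.
rewrite mxE mulr_sumr; apply: eq_bigr => l _.
rewrite derive_rowE; last exact: smooth_at_diffR (framed_rV n) (sD l).
rewrite mxE [_^T _ _]mxE mulrC mulrCA; congr (_ * _).
rewrite mulr_sumr; apply: eq_bigr => k _; rewrite mxE metricE partial_yE mulrCA.
suff -> : (fun z => Dy l E (x, z)) = 'D_(ee l) g by [].
by apply/funext => z; rewrite partial_yE.
Qed.

Lemma metric_unit (x y : V) : A x -> y != 0 -> metric_mx x y \in unitmx.
Proof.
move=> Ax y0; rewrite -row_free_unit -kermx_eq0; apply/rowV0P => v /sub_kermxP v0.
apply/eqP; apply: contraT => vn0.
by have := pF Ax y0 vn0; rewrite -metric_form// v0 mul0mx mxE ltxx.
Qed.

(** The metric matrix is invertible, and its contraction with the acceleration gives the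
second fibre derivatives of E. *)
Lemma spray_equation (x y a : V) : A x -> y != 0 ->
  (forall i, a 0 i + \sum_j \sum_k y 0 j * y 0 k * chern_coefficient F i j k x y = 0) <->
  (forall s, \sum_i a 0 i * Dy i (Dy s E) (x, y) + \sum_k y 0 k * Dx k (Dy s E) (x, y) = Dx s E (x, y)).
Proof.
move=> Ax y0.
pose b : 'cV[R]_n := \col_s (2^-1 * (\sum_k y 0 k * Dx k (Dy s E) (x, y) - Dx s E (x, y))).
have U := metric_unit Ax y0.
transitivity (a^T + invmx (metric_mx x y) *m b = 0).
  split=> [H|H i].
    apply/colP => i; rewrite !mxE -[RHS](H i) chern_contract//; congr (_ + _).
    by rewrite mulr_sumr; apply: eq_bigr => s _; rewrite mxE mulrCA.
  transitivity ((a^T + invmx (metric_mx x y) *m b) i 0); last by rewrite H mxE.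
  rewrite !mxE chern_contract//; congr (_ + _).
  by rewrite mulr_sumr; apply: eq_bigr => s _; rewrite mxE mulrCA.
transitivity (metric_mx x y *m a^T + b = 0).
  split=> H.
    have := congr1 (mulmx (metric_mx x y)) H.
    by rewrite mulmxDr mulmxA mulmxV// mul1mx mulmx0.
  have := congr1 (mulmx (invmx (metric_mx x y))) H.
  by rewrite mulmxDr mulmxA mulVmx// mul1mx mulmx0.
have Es s : (metric_mx x y *m a^T + b) s 0 =
   2^-1 * (\sum_i a 0 i * Dy i (Dy s E) (x, y) + \sum_k y 0 k * Dx k (Dy s E) (x, y) - Dx s E (x, y)).
  rewrite [LHS]mxE [b s 0]mxE -[in RHS]addrA [in RHS]mulrDr mxE.
  apply: (congr1 (fun z => z + _)).
  rewrite mulr_sumr; apply: eq_bigr => i _; rewrite !mxE metricE (partial_yC _ _ (sE Ax y0)); ring.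
split=> [H s|H].
  have := Es s; rewrite H mxE => /esym/eqP; rewrite mulf_eq0 invr_eq0 pnatr_eq0/= subr_eq0.
  by move/eqP.
by apply/colP => s; rewrite Es H subrr mulr0 mxE.
Qed.

End Spray.

(** * The Euler-Lagrange equation and the first variation *)

Section EulerLagrange.
Context {R : realType} {n : nat}.
Local Notation V := 'rV[R]_n.
Local Notation ee i := (delta_mx 0 i : V).
Implicit Types (f : V * V -> R) (x y w : V).

Lemma derive_fibre f x y w : smooth_at f (x, y) ->
  'D_(0, w) f (x, y) = \sum_s w 0 s * partial_y s f (x, y).
Proof.
move=> sf; rewrite derive_snd derive_rowE; last first.
  exact: smooth_at_diffR (framed_rV n) (smooth_snd sf).
by apply: eq_bigr => i _; rewrite partial_yE.
Qed.

Lemma derive_base f x y w : smooth_at f (x, y) ->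
  'D_(w, 0) f (x, y) = \sum_s w 0 s * partial_x s f (x, y).
Proof.
move=> sf; rewrite derive_fst derive_rowE; last first.
  exact: smooth_at_diffR (framed_rV n) (smooth_fst sf).
by apply: eq_bigr => i _; rewrite partial_xE.
Qed.

Lemma derive_pair_split f x y u w : smooth_at f (x, y) ->
  'd f (x, y) (u, w) = 'D_(u, 0) f (x, y) + 'D_(0, w) f (x, y).
Proof.
move=> sf; have df := smooth_at_diffR (framed_prod (framed_rV n) (framed_rV n)) sf.
rewrite !deriveE// -linearD; apply: (congr1 ('d f (x, y))).
by apply: injective_projections; rewrite /= ?addr0 ?add0r.
Qed.

Lemma derive_curve (f : V * V -> R) (x y : R -> V) t :
  derivable x t 1 -> derivable y t 1 -> smooth_at f (x t, y t) ->
  is_derive t (1 : R) (fun t => f (x t, y t))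
    ('D_('D_1 x t, 0) f (x t, y t) + 'D_(0, 'D_1 y t) f (x t, y t)).
Proof.
move=> dx dy sf.
have df := smooth_at_diffR (framed_prod (framed_rV n) (framed_rV n)) sf.
have [d1 d2] := is_derive_pair dx dy.
have := is_derive_comp (f := fun t => (x t, y t)) d1 df.
by rewrite d2 derive_pair_split.
Qed.

Lemma derive_curve_sum (f : V * V -> R) (x y : R -> V) t :
  derivable x t 1 -> derivable y t 1 -> smooth_at f (x t, y t) ->
  is_derive t (1 : R) (fun t => f (x t, y t))
    (\sum_k 'D_1 x t 0 k * partial_x k f (x t, y t) +
     \sum_i 'D_1 y t 0 i * partial_y i f (x t, y t)).
Proof.
by move=> dx dy sf; rewrite -derive_base// -derive_fibre//; exact: derive_curve.
Qed.

Lemma derive_dot (W : R -> V) (p : 'I_n -> R -> R) (t : R) :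
  derivable W t 1 -> (forall s, derivable (p s) t 1) ->
  'D_1 (fun t => \sum_s W t 0 s * p s t) t =
  \sum_s 'D_1 W t 0 s * p s t + \sum_s W t 0 s * 'D_1 (p s) t.
Proof.
move=> dW dp.
have dWs s : derivable (fun t => W t 0 s) t 1 by exact: (derivable_mxP W t 1).1.
have -> : (fun t => \sum_s W t 0 s * p s t) = \sum_s (fun t => W t 0 s * p s t).
  by apply/funext => u; rewrite fct_sumE.
rewrite derive_sum; last by move=> s; exact: derivableM.
rewrite -big_split/=; apply: eq_bigr => s _.
apply: etrans (deriveM (dWs s) (dp s)) _; rewrite (derive_coord s dW) addrC.
by rewrite [X in _ + X]mulrC.
Qed.

End EulerLagrange.

Section TwoParameters.
Context {R : realType} {n : nat}.
Variable Psi : R * R -> 'rV[R]_n.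
Let fRR : framed (R * R)%type := framed_prod framed_R framed_R.

Lemma smooth_at_slice1 (t s : R) : smooth_at Psi (t, s) -> smooth_at (fun z => Psi (z, s)) t.
Proof.
move=> sP; apply: (@smooth_at_comp _ _ _ _ (fun z : R => (z, s)) Psi t fRR _ sP).
by apply: smooth_at_pair; [exact: smooth_at_id|exact: smooth_at_cst].
Qed.

Lemma smooth_at_slice2 (t s : R) : smooth_at Psi (t, s) -> smooth_at (fun z => Psi (t, z)) s.
Proof.
move=> sP; apply: (@smooth_at_comp _ _ _ _ (fun z : R => (t, z)) Psi s fRR _ sP).
by apply: smooth_at_pair; [exact: smooth_at_cst|exact: smooth_at_id].
Qed.

(** The velocity of the variation field is the variation of the velocity. *)
Lemma mixed_derivatives (t s : R) : smooth_at Psi (t, s) ->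
  'D_1 (fun z => 'D_(1, 0) Psi (t, z)) s = 'D_1 (fun z => 'D_(0, 1) Psi (z, s)) t.
Proof.
move=> sP; apply: etrans (derive_fst ('D_(0, 1) Psi) t s 1).
apply: etrans (esym (derive_snd ('D_(1, 0) Psi) t s 1)) _.
exact: smooth_at_derive_sym.
Qed.

End TwoParameters.

Section EL.
Context {R : realType} {n : nat}.
Local Notation V := 'rV[R]_n.
Local Notation ee i := (delta_mx 0 i : V).
Variable F : V -> V -> R.
Variable A : set V.
Hypothesis oA : open A.
Local Notation E := (energy F).
Hypothesis sE : forall x y, A x -> y != 0 -> smooth_at E (x, y).
Hypothesis hF : forall x y (t : R), A x -> 0 < t -> F x (t *: y) = t * F x y.
Hypothesis pF : forall x y u, A x -> y != 0 -> u != 0 -> 0 < fundamental_form (F x) y u u.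
Variables (x : R -> V) (t0 : R).
Hypothesis sx : smooth_at x t0.
Hypothesis Ax : A (x t0).
Hypothesis x'0 : 'D_1 x t0 != 0.

Lemma near_smooth_energy : \forall t \near t0, smooth_at E (x t, 'D_1 x t).
Proof.
have cx := smooth_at_continuous sx.
have cx' := smooth_at_continuous (smooth_at_derive (1 : R) sx).
have n1 : \forall t \near t0, A (x t) by apply: cx; exact: open_nbhs_nbhs.
have n2 : \forall t \near t0, 'D_1 x t != 0 by exact: (cx' [set v | v != 0] (near_neq0 x'0)).
by apply: filterS2 n1 n2 => t; exact: sE.
Qed.

Lemma derive_momentum_i s :
  is_derive t0 (1 : R) (fun t => partial_y s E (x t, 'D_1 x t))
   (\sum_k 'D_1 x t0 0 k * partial_x k (partial_y s E) (x t0, 'D_1 x t0) +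
    \sum_i 'D_1 ('D_1 x) t0 0 i * partial_y i (partial_y s E) (x t0, 'D_1 x t0)).
Proof.
have ss := smooth_partial_y s (sE Ax x'0).
apply: (@derive_curve_sum R n (partial_y s E) x ('D_1 x)) => //; first exact: smooth_at_derivable.
exact: smooth_at_derivable (smooth_at_derive (1 : R) sx).
Qed.

Lemma derive_momentum w :
  'D_1 (fun t => 'D_(0, w) E (x t, 'D_1 x t)) t0 =
  \sum_s w 0 s * 'D_1 (fun t => partial_y s E (x t, 'D_1 x t)) t0.
Proof.
have H : \forall t \near t0, 'D_(0, w) E (x t, 'D_1 x t) =
    \sum_s w 0 s * partial_y s E (x t, 'D_1 x t).
  by apply: filterS near_smooth_energy => t; exact: derive_fibre.
rewrite (near_eq_derive _ H) (derive_sumf (fun s => w 0 s))// => s.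
by have [] := derive_momentum_i s.
Qed.

Lemma euler_lagrange :
  (forall i, 'D_1 ('D_1 x) t0 0 i + \sum_j \sum_k 'D_1 x t0 0 j * 'D_1 x t0 0 k *
     chern_coefficient F i j k (x t0) ('D_1 x t0) = 0) <->
  (forall w, 'D_1 (fun t => 'D_(0, w) E (x t, 'D_1 x t)) t0 =
     'D_(w, 0) E (x t0, 'D_1 x t0)).
Proof.
rewrite (spray_equation oA sE hF pF ('D_1 ('D_1 x) t0) Ax x'0).
split=> H.
  move=> w; rewrite derive_momentum derive_base; last exact: sE.
  apply: eq_bigr => s _; apply: (congr1 ( *%R (w 0 s))); apply: etrans _ (H s).
  have [_ D] := derive_momentum_i s; apply: etrans D _; exact: addrC.
move=> s; apply: etrans _ (H (ee s)); have [_ D] := derive_momentum_i s.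
by apply: etrans (esym D); exact: addrC.
Qed.

(** The s-derivative of the energy splits, by the chain rule and the symmetry of mixed
derivatives, into the base derivative along the variation field and the momentum paired
with the velocity of that field. Constancy of the momentum paired with the field trades
the latter for minus the derivative of the momentum. *)
Lemma first_variation (Psi : R * R -> V) (qs : R -> R) (K : R) :
  smooth_at Psi (t0, 0) ->
  (forall t, Psi (t, 0) = x t) ->
  (\forall s \near (0 : R), E (Psi (t0, s), 'D_(1, 0) Psi (t0, s)) = qs s) ->
  (\forall t \near t0, 'D_(0, 'D_(0, 1) Psi (t, 0)) E (x t, 'D_1 x t) = K) ->
  let w := 'D_(0, 1) Psi (t0, 0) in
  'D_(w, 0) E (x t0, 'D_1 x t0) - 'D_1 (fun t => 'D_(0, w) E (x t, 'D_1 x t)) t0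
  = 'D_1 qs 0.
Proof.
move=> sP Px Pq PK w.
pose W t := 'D_(0, 1) Psi (t, 0).
have x'E t : 'D_1 x t = 'D_(1, 0) Psi (t, 0).
  by rewrite derive_fst; have -> : (fun z => Psi (z, 0)) = x by apply/funext.
have sPt : smooth_at ('D_(1, 0) Psi) (t0, 0) by exact: smooth_at_derive.
have sPs : smooth_at ('D_(0, 1) Psi) (t0, 0) by exact: smooth_at_derive.
have xE := Px t0.
have D1 : 'D_1 qs 0 = 'D_(w, 0) E (x t0, 'D_1 x t0) + 'D_(0, 'D_1 W t0) E (x t0, 'D_1 x t0).
  rewrite -(near_eq_derive _ Pq).
  have d1 : derivable (fun s => Psi (t0, s)) (0 : R) 1.
    exact: smooth_at_derivable (smooth_at_slice2 sP).
  have d2 : derivable (fun s => 'D_(1, 0) Psi (t0, s)) (0 : R) 1.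
    exact: smooth_at_derivable (smooth_at_slice2 sPt).
  have sE0 : smooth_at E (Psi (t0, 0), 'D_(1, 0) Psi (t0, 0)).
    by rewrite -x'E xE; exact: sE.
  have [_ ->] := derive_curve d1 d2 sE0.
  have w2 := mixed_derivatives sP.
  by rewrite -(derive_snd Psi) -/w -x'E xE w2.
have sW : smooth_at W t0 := smooth_at_slice1 sPs.
(* The derivative of the constant momentum along the variation field. *)
have D2 : 0 = 'D_(0, 'D_1 W t0) E (x t0, 'D_1 x t0) +
    'D_1 (fun t => 'D_(0, w) E (x t, 'D_1 x t)) t0.
  have H : \forall t \near t0, \sum_s W t 0 s * partial_y s E (x t, 'D_1 x t) = K.
    by apply: filterS2 PK near_smooth_energy => t <- st; rewrite derive_fibre.
  rewrite -[LHS](@derive_cst _ _ _ K t0 (1 : R)).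
  rewrite -(near_eq_derive _ H).
  rewrite (derive_dot (smooth_at_derivable sW)); last first.
    by move=> s; have [] := derive_momentum_i s.
  by rewrite derive_momentum (derive_fibre _ (sE Ax x'0)).
by rewrite D1 -[LHS]addr0 D2 addrA addrAC subrK.
Qed.

End EL.

(** * Left-invariant metrics *)

Section MaurerCartan.
Context {R : realType} {G : topGroupType} {n : nat}.
Local Notation V := 'rV[R]_n.
Variable (M : smooth_structure R G n).
Hypothesis lieG : is_lie_group M.
Variable e : chart R G n.
Hypotheses (Me : atlas M e) (e1 : chart_dom e 1%g).
Implicit Types (c : chart R G n) (x y : V).

(** Left translation of tangent vectors to the identity. In a chart the left-invariant
metric is F composed with this form. *)
Definition maurer_cartan c x y : V :=
  tangent_map c e (fun b => (chart_inv c x)^-1 * b)%g (chart_inv c x) y.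
Local Notation omega := maurer_cartan.

(** The curve itself may be translated before it is differentiated; this is how the form
is evaluated on explicit curves. *)
Lemma maurer_cartan_curve (W : normedModType R) (a : W -> G) (v w : W) c :
  framed W -> atlas M c -> msmooth M a v -> chart_dom c (a v) ->
  omega c (c (a v)) ('D_w (c \o a) v) = 'D_w (fun u => e ((a v)^-1 * a u)%g) v.
Proof.
move=> fW Mc sa cv; rewrite /maurer_cartan chart_mapK//.
have [] := @tangent_chain _ _ _ _ _ M M _ (fun b => (a v)^-1 * b)%g a v w c e fW Mc Me sa.
- exact: (msmooth_lmul lieG _ Mc (chart_img cv)).
- by [].
- by rewrite mulVg.
- by move=> _ <-.
Qed.

Lemma maurer_cartan_linear c x (k : R) y y' :
  omega c x (k *: y + y') = k *: omega c x y + omega c x y'.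
Proof. exact: linearP. Qed.

Lemma maurer_cartanZ c x (k : R) y : omega c x (k *: y) = k *: omega c x y.
Proof. exact: linearZ. Qed.

(** The tangent map of the inverse translation is a left inverse. *)
Lemma maurer_cartan_inj c x y : atlas M c -> (c @` chart_dom c) x ->
  omega c x y = 0 -> y = 0.
Proof.
move=> Mc cx w0; set a := chart_inv c x.
have ca : chart_dom c a by exact: chart_inv_dom.
have xE : c a = x by exact: chart_invK.
have := @tangent_map_comp _ _ _ _ _ _ _ M M M (fun b => a^-1 * b)%g (fun b => a * b)%g a c e c y
  Mc Me Mc.
rewrite -/a xE mulVg mulg1 => /(_ _ _ ca e1 ca).
rewrite -/(maurer_cartan c x y) w0 [X in _ = X]linear0.
have -> : (fun b => a * b)%g \o (fun b => a^-1 * b)%g = id.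
  by apply/funext => b /=; rewrite mulgA mulgV mul1g.
rewrite (tangent_mapE (M' := M))// ?xE; last exact: msmooth_chart_inv.
have -> : 'D_y (c \o id \o chart_inv c) x = y.
  have H : \forall z \near x, id z = (c \o id \o chart_inv c) z.
    have := near_chart_img ca; rewrite xE; apply: filterS => z cz /=; by rewrite chart_invK.
  by rewrite -(near_eq_derive _ H) derive_id.
by apply; [exact: msmooth_lmul|exact: (msmooth_lmul lieG _ Me (chart_img e1))].
Qed.

(** The form is the differential in the second variable, along the diagonal, of
a^-1 * b read in charts. *)
Lemma maurer_cartan_smooth c x y : atlas M c -> (c @` chart_dom c) x ->
  smooth_at (fun z : V * V => omega c z.1 z.2) (x, y).
Proof.
move=> Mc cx.
pose N (z : V * V) := e ((chart_inv c z.1)^-1 * chart_inv c z.2)%g.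
have sN x' : (c @` chart_dom c) x' -> smooth_at N (x', x').
  move=> cx'.
  have : msmooth M (fun z : V * V => (chart_inv c z.1)^-1 * chart_inv c z.2)%g (x', x').
    apply: msmooth_mul => //.
      apply: msmooth_inv => //.
      apply: (@msmooth_comp _ _ _ _ _ _ (fun z => z.1) (chart_inv c)); [exact: framed_rV| |exact: msmooth_chart_inv].
      exact: smooth_at_linear (bounded_linear_fst _ _).
    apply: (@msmooth_comp _ _ _ _ _ _ (fun z => z.2) (chart_inv c)); [exact: framed_rV| |exact: msmooth_chart_inv].
    exact: smooth_at_linear (bounded_linear_snd _ _).
  by case=> _; apply => //=; rewrite mulVg.
pose Z (z : V * V) : (V * V) * (V * V) := ((z.1, z.1), (0, z.2)).
have sZ z : smooth_at Z z.
  have s1 : smooth_at (fun z : V * V => z.1) z by exact: smooth_at_linear (bounded_linear_fst _ _).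
  have s2 : smooth_at (fun z : V * V => z.2) z by exact: smooth_at_linear (bounded_linear_snd _ _).
  apply: smooth_at_pair; first exact: smooth_at_pair.
  by apply: smooth_at_pair => //; exact: smooth_at_cst.
have f4 : framed ((V * V) * (V * V))%type := framed_prod framed_rV2 framed_rV2.
have sD := smooth_at_diff_apply (0, y) framed_rV2 (sN _ cx).
have := @smooth_at_comp _ _ _ _ Z _ (x, y) f4 (sZ (x, y)) sD; apply: smooth_at_ext.
have n1 : \forall z \near (x, y), (c @` chart_dom c) z.1.
  exists ([set z | (c @` chart_dom c) z], setT) => /=; last by move=> z [].
  split; last exact: filterT.
  by apply: open_nbhs_nbhs; split; [exact: chart_cod_open|].
apply: filterS n1 => -[x' y'] /= cx'.
rewrite -deriveE; last exact: smooth_at_diff framed_rV2 (sN _ cx').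
rewrite derive_snd /maurer_cartan.
have ca : chart_dom c (chart_inv c x') by exact: chart_inv_dom.
rewrite (tangent_mapE (M' := M))// ?mulVg// chart_invK//.
exact: msmooth_lmul.
Qed.

End MaurerCartan.

Section Minkowski.
Context {R : realType} {n : nat}.
Local Notation V := 'rV[R]_n.
Variable F : V -> R.
Hypothesis mF : minkowski_norm F.

Definition sqnorm (z : V) := F z ^+ 2.

Lemma sqnorm_smooth z : z != 0 -> smooth_at sqnorm z.
Proof.
move=> z0; have [_ _ sF _ _] := mF.
have sFz : smooth_at F z.
  by apply: smooth_at_near_on sF; exact: near_neq0.
exact: smooth_atM.
Qed.

Lemma fundamental_form_linear (L : V -> V) y u v :
  (forall (k : R) z z', L (k *: z + z') = k *: L z + L z') ->
  fundamental_form (fun z => F (L z)) y u v = fundamental_form F (L y) (L u) (L v).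
Proof.
move=> lL; rewrite /fundamental_form.
have E s t : L (y + s *: u + t *: v) = L y + s *: L u + t *: L v.
  by rewrite addrC lL [y + _]addrC lL addrC [X in X + _]addrC.
have -> : (fun s : R => derive1 (fun t : R => F (L (y + s *: u + t *: v)) ^+ 2) 0) =
  (fun s : R => derive1 (fun t : R => F (L y + s *: L u + t *: L v) ^+ 2) 0).
  apply/funext => s; have -> : (fun t : R => F (L (y + s *: u + t *: v)) ^+ 2) =
    (fun t : R => F (L y + s *: L u + t *: L v) ^+ 2) by apply/funext => t; rewrite E.
  by [].
by [].
Qed.

End Minkowski.

Section LeftInvariant.
Context {R : realType} {G : topGroupType} {n : nat}.
Local Notation V := 'rV[R]_n.
Variable (M : smooth_structure R G n).
Hypothesis lieG : is_lie_group M.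
Variable e : chart R G n.
Hypotheses (Me : atlas M e) (e1 : chart_dom e 1%g).
Variable F : V -> R.
Hypothesis mF : minkowski_norm F.
Variable c : chart R G n.
Hypothesis Mc : atlas M c.
Local Notation Fc := (left_invariant_finsler e F c).
Local Notation omega := (maurer_cartan e c).
Local Notation A := (c @` chart_dom c).

Lemma left_invariantE x y : Fc x y = F (omega x y).
Proof. by []. Qed.

Lemma omega_neq0 x y : A x -> y != 0 -> omega x y != 0.
Proof. by move=> Ax; apply: contra_neq; exact: (maurer_cartan_inj lieG Me e1 Mc Ax). Qed.

Lemma left_invariant_smooth x y : A x -> y != 0 -> smooth_at (energy Fc) (x, y).
Proof.
move=> Ax y0.
apply: (@smooth_at_compR _ _ _ (fun z : V * V => omega z.1 z.2) (sqnorm F)).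
- exact: framed_rV.
- exact: (maurer_cartan_smooth lieG Me e1 _ Mc Ax).
- by apply: sqnorm_smooth => //; exact: omega_neq0.
Qed.

Lemma left_invariant_homog x y (t : R) : A x -> 0 < t -> Fc x (t *: y) = t * Fc x y.
Proof.
move=> Ax t0; rewrite !left_invariantE maurer_cartanZ.
by have [_ _ _ H _] := mF; apply: H; exact: ltW.
Qed.

Lemma left_invariant_pos x y u : A x -> y != 0 -> u != 0 ->
  0 < fundamental_form (Fc x) y u u.
Proof.
move=> Ax y0 u0.
rewrite (@fundamental_form_linear _ _ F (omega x)); last first.
  by move=> k z z'; exact: maurer_cartan_linear.
by have [_ _ _ _ P] := mF; apply: P; exact: omega_neq0.
Qed.

Lemma left_invariant_derive_y x y w : A x -> y != 0 ->
  'D_(0, w) (energy Fc) (x, y) = 'd (sqnorm F) (omega x y) (omega x w).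
Proof.
move=> Ax y0; rewrite derive_snd.
have bl : bounded_linear (omega x).
  apply: bounded_linear_diff; apply: smooth_at_diff; first exact: framed_rV.
  have := msmooth_lmul lieG (chart_inv c x)^-1%g Mc Ax.
  case=> _ /(_ e Me) /=; rewrite mulVg chart_invK//; exact.
have ds : differentiable (sqnorm F) (omega x y).
  by apply: smooth_at_diffR (framed_rV n) _; apply: sqnorm_smooth => //; exact: omega_neq0.
have dw : derivable (omega x) y w by apply: smooth_at_derivable; exact: smooth_at_linear.
have [_ D] := is_derive_comp dw ds.
apply: etrans D _; apply: (congr1 ('d (sqnorm F) (omega x y))).
have [_ D] := is_derive_linear_comp bl (@derivable_id _ _ y w).
by apply: etrans D _; rewrite derive_id.
Qed.

End LeftInvariant.

(** * Variations of a one-parameter subgroup *)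

Section GeodesicVector.
Context {R : realType} {G : topGroupType} {n : nat}.
Local Notation V := 'rV[R]_n.
Variable (M : smooth_structure R G n).
Hypothesis lieG : is_lie_group M.
Variable e : chart R G n.
Hypotheses (Me : atlas M e) (e1 : chart_dom e 1%g).
Variable F : V -> R.
Hypothesis mF : minkowski_norm F.
Variables (X : V) (sigma : R -> G).
Hypothesis X0 : X != 0.
Hypothesis sc : smooth_curve M sigma.
Hypothesis sM : forall s t, sigma (s + t) = (sigma s * sigma t)%g.
Hypothesis sX : tangent e X sigma.

Lemma sigma_smooth t : msmooth M sigma t.
Proof. exact: msmooth_curve. Qed.

Lemma sigma0 : sigma 0 = 1%g.
Proof. by have := tangent0 e1 sX. Qed.

Lemma sigmaVD t u : ((sigma t)^-1 * sigma u)%g = sigma (u - t).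
Proof.
have {1}-> : u = t + (u - t) by rewrite addrC subrK.
by rewrite sM mulgA mulVg mul1g.
Qed.

Lemma sigma_shift_smooth t : msmooth M (fun u => sigma (u - t)) t.
Proof.
apply: (@msmooth_comp _ _ _ M _ _ (fun u : R => u - t) sigma t).
- exact: framed_R.
- by apply: smooth_atD; [exact: smooth_at_id|exact: smooth_at_cst].
- exact: sigma_smooth.
Qed.

Lemma sigma_shift_derive t : 'D_1 (fun u => e (sigma (u - t))) t = X.
Proof.
have [d D] : is_derive (t + - t) (1 : R) (e \o sigma) X by rewrite subrr; exact: tangent_derive.
by have [_ ->] := is_derive_translate d.
Qed.

(** (sigma t h)^-1 (sigma u h) = h^-1 sigma (u - t) h. *)
Lemma velocity_conj (h : G) t :
  'D_1 (fun u => e ((sigma t * h)^-1 * (sigma u * h))%g) t = Ad e h^-1%g X.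
Proof.
have s0 : sigma (t - t) = 1%g by rewrite subrr sigma0.
have := @tangent_chain _ _ _ _ _ M M _ (fun x => h^-1 * x * h^-1^-1)%g
  (fun u => sigma (u - t)) t 1 e e framed_R Me Me (sigma_shift_smooth t).
rewrite s0; case=> //.
- have := msmooth_lmul lieG h^-1%g Me (chart_img e1).
  by move=> s1; apply: msmooth_mul => //; exact: msmooth_cst.
- by rewrite mulg1 mulgV.
move=> _; rewrite /Ad sigma_shift_derive => <-.
have -> : (fun u => e ((sigma t * h)^-1 * (sigma u * h))%g) =
  e \o (fun x => h^-1 * x * h^-1^-1)%g \o (fun u => sigma (u - t)).
  by apply/funext => u /=; rewrite -sigmaVD invgM invgK !mulgA.
by [].
Qed.

Section Chart.
Variable c : chart R G n.
Hypothesis Mc : atlas M c.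
Local Notation Fc := (left_invariant_finsler e F c).
Local Notation E := (energy Fc).
Local Notation omega := (maurer_cartan e c).
Local Notation A := (c @` chart_dom c).

Lemma omega_velocity t : chart_dom c (sigma t) ->
  omega (c (sigma t)) ('D_1 (c \o sigma) t) = X.
Proof.
move=> ct; rewrite (maurer_cartan_curve lieG Me e1 _ framed_R Mc (sigma_smooth t) ct).
rewrite -[RHS](sigma_shift_derive t).
have -> // : (fun u => e ((sigma t)^-1 * sigma u)%g) = (fun u => e (sigma (u - t))).
by apply/funext => u; rewrite sigmaVD.
Qed.

Lemma velocity_neq0 t : chart_dom c (sigma t) -> 'D_1 (c \o sigma) t != 0.
Proof.
move=> ct; apply: contra_neq X0 => D0.
by rewrite -(omega_velocity ct) D0 -[0 in LHS](scale0r 0) maurer_cartanZ scale0r.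
Qed.

Lemma curve_smooth t : chart_dom c (sigma t) -> smooth_at (c \o sigma) t.
Proof. by move=> ct; apply: (sigma_smooth t).2. Qed.

(** The variation sigma t * k s is by right multiplication, whereas the metric is
left-invariant: translated to 1, its velocity is Ad (k s)^-1 X and its variation field is
k'(0), both independent of t. Hence the momentum of sigma paired with the field is
constant, and [first_variation] applies. *)
Lemma euler_lagrange_defect (k : R -> G) t : chart_dom c (sigma t) -> msmooth M k 0 -> k 0 = 1%g ->
  let w := 'D_1 (fun s => c (sigma t * k s)%g) 0 in
  'D_(w, 0) E (c (sigma t), 'D_1 (c \o sigma) t)
  - 'D_1 (fun u => 'D_(0, w) E (c (sigma u), 'D_1 (c \o sigma) u)) t
  = 'D_1 (fun s => sqnorm F (Ad e (k s)^-1%g X)) 0.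
Proof.
move=> ct sk k0 w.
pose g (z : R * R) := (sigma z.1 * k z.2)%g.
have sg : msmooth M g (t, 0).
  apply: msmooth_mul => //.
    apply: (@msmooth_comp _ _ _ M _ _ (fun z : R * R => z.1) sigma); [exact: framed_R| |exact: sigma_smooth].
    exact: smooth_at_linear (bounded_linear_fst _ _).
  apply: (@msmooth_comp _ _ _ M _ _ (fun z : R * R => z.2) k); [exact: framed_R| |exact: sk].
  exact: smooth_at_linear (bounded_linear_snd _ _).
have sP : smooth_at (c \o g) (t, 0).
  by apply: sg.2 => //; rewrite /g /= k0 mulg1.
have nt : \forall u \near t, chart_dom c (sigma u).
  exact: msmooth_near_dom (sigma_smooth t) ct.
have ns : \forall s \near (0 : R), chart_dom c (sigma t * k s)%g.
  apply: (msmooth_near_dom (M := M)); last by rewrite k0 mulg1.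
  by apply: msmooth_mul => //; exact: msmooth_cst.
have wE : w = 'D_(0, 1) (c \o g) (t, 0) by rewrite derive_snd.
rewrite wE.
apply: (@first_variation R n Fc A _ _ (c \o sigma) t _ _ _ (c \o g) _
  ('d (sqnorm F) X ('D_1 (fun s => e (k s)) 0))).
- exact: chart_cod_open.
- by move=> x y Ax y0; exact: (left_invariant_smooth lieG Me e1 mF Mc Ax y0).
- exact: curve_smooth.
- exact: chart_img.
- exact: velocity_neq0.
- exact: sP.
- by move=> u; rewrite /g /= k0 mulg1.
- apply: filterS ns => s cs; rewrite derive_fst /energy left_invariantE /sqnorm.
  have sgs : msmooth M (fun u => sigma u * k s)%g t.
    by apply: msmooth_mul => //; [exact: sigma_smooth|exact: msmooth_cst].
  have := maurer_cartan_curve lieG Me e1 (1 : R) framed_R Mc sgs cs.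
  by rewrite velocity_conj => ->.
- apply: filterS nt => u cu; rewrite (left_invariant_derive_y lieG Me e1 mF Mc); last 2 first.
  + exact: chart_img.
  + exact: velocity_neq0.
  rewrite omega_velocity// derive_snd; congr ('d _ X _).
  have sks : msmooth M (fun s => sigma u * k s)%g 0.
    by apply: msmooth_mul => //; exact: msmooth_cst.
  have cu0 : chart_dom c (sigma u * k 0)%g by rewrite k0 mulg1.
  have := maurer_cartan_curve lieG Me e1 (1 : R) framed_R Mc sks cu0.
  rewrite k0 mulg1 => ->.
  have -> // : (fun s => e ((sigma u)^-1 * (sigma u * k s))%g) = (fun s => e (k s)).
  by apply/funext => s; rewrite mulgA mulVg mul1g.
Qed.

End Chart.

(** A curve k can be chosen so that the variation has any prescribed direction at
sigma t, so stationarity gives the Euler-Lagrange equation at every t. In the other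
direction, the equation at t = 0 alone suffices. *)
Lemma geodesic_iff_stationary :
  geodesic_on M (left_invariant_finsler e F) [set t | 0 <= t] sigma <->
  (forall k : R -> G, msmooth M k 0 -> k 0 = 1%g ->
    'D_1 (fun s => sqnorm F (Ad e (k s)^-1%g X)) 0 = 0).
Proof.
have EL c t : atlas M c -> chart_dom c (sigma t) ->
    (forall i, derive1n 2 (c \o sigma) t 0 i + \sum_j \sum_k
      derive1 (c \o sigma) t 0 j * derive1 (c \o sigma) t 0 k *
      chern_coefficient (left_invariant_finsler e F c) i j k (c (sigma t)) (derive1 (c \o sigma) t) = 0)
    <->
    (forall w, 'D_1 (fun u => 'D_(0, w) (energy (left_invariant_finsler e F c))
         (c (sigma u), 'D_1 (c \o sigma) u)) t =
       'D_(w, 0) (energy (left_invariant_finsler e F c)) (c (sigma t), 'D_1 (c \o sigma) t)).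
  move=> Mc ct.
  have d1 : derive1 (c \o sigma) = 'D_1 (c \o sigma) by apply/funext => u; rewrite derive1E.
  have d2 : derive1n 2 (c \o sigma) t = 'D_1 ('D_1 (c \o sigma)) t.
    by rewrite /= d1 derive1E.
  rewrite d1 d2.
  have sE x y : (c @` chart_dom c) x -> y != 0 ->
      smooth_at (energy (left_invariant_finsler e F c)) (x, y).
    by move=> Ax y0; exact: (left_invariant_smooth lieG Me e1 mF Mc Ax y0).
  have hF x y (r : R) : (c @` chart_dom c) x -> 0 < r ->
      left_invariant_finsler e F c x (r *: y) = r * left_invariant_finsler e F c x y.
    by move=> Ax r0; exact: (left_invariant_homog e mF y Ax r0).
  have pF x y u : (c @` chart_dom c) x -> y != 0 -> u != 0 ->
      0 < fundamental_form (left_invariant_finsler e F c x) y u u.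
    by move=> Ax y0 u0; exact: (left_invariant_pos lieG Me e1 mF Mc Ax y0 u0).
  have L := (euler_lagrange (@chart_cod_open _ _ _ c) sE hF pF (curve_smooth Mc ct) (chart_img ct) (velocity_neq0 Mc ct)).
  exact L.
split=> [[_ H] k sk k0|H].
  have [c Mc c0] := atlas_cover M (sigma 0).
  have [_ /(EL c 0 Mc c0) Hw] := H 0 (lexx _) c Mc c0.
  by rewrite -(euler_lagrange_defect Mc c0 sk k0)/= Hw subrr.
split=> // t _ c Mc ct; split.
  by rewrite derive1E; exact: velocity_neq0.
apply/(EL c t Mc ct) => w.
(* sigma t * k s is the straight line through sigma t with direction w in the chart c. *)
pose k s := ((sigma t)^-1 * chart_inv c (c (sigma t) + s *: w))%g.
have sk : msmooth M k 0.
  apply: msmooth_mul => //; first exact: msmooth_cst.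
  apply: (@msmooth_comp _ _ _ M _ _ (fun s : R => c (sigma t) + s *: w) (chart_inv c)).
  - exact: framed_rV.
  - exact: smooth_at_line.
  - by rewrite scale0r addr0; apply: msmooth_chart_inv => //; exact: chart_img.
have k0 : k 0 = 1%g by rewrite /k scale0r addr0 chart_mapK// mulVg.
have := euler_lagrange_defect Mc ct sk k0; rewrite (H k sk k0) /=.
have -> : 'D_1 (fun s => c (sigma t * k s)%g) 0 = w.
  have nE : \forall s \near (0 : R), c (sigma t) + s *: w = c (sigma t * k s)%g.
    have lc := smooth_at_continuous (smooth_at_line (c (sigma t)) w 0).
    have : \forall s \near (0 : R), (c @` chart_dom c) (c (sigma t) + s *: w).
      by apply: lc; rewrite scale0r addr0; exact: near_chart_img.
    by apply: filterS => s cs; rewrite /k mulgA mulgV mul1g chart_invK.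
  rewrite -(near_eq_derive _ nE).
  have [_ ->] := @is_derive_line _ _ _ id (c (sigma t)) w 0 (@derivable_id _ _ _ _).
  exact: derive_id.
by move/eqP; rewrite subr_eq0 eq_sym => /eqP.
Qed.

End GeodesicVector.

(** * The adjoint action and the restricted norm *)

Section Adjoint.
Context {R : realType} {G : topGroupType} {n : nat}.
Local Notation V := 'rV[R]_n.
Variable (M : smooth_structure R G n).
Hypothesis lieG : is_lie_group M.
Variable e : chart R G n.
Hypotheses (Me : atlas M e) (e1 : chart_dom e 1%g).

Lemma msmooth_conj (a : G) : msmooth M ((fun x => a * x * a^-1)%g \o chart_inv e) (e 1%g).
Proof.
apply: msmooth_mul => //; last exact: msmooth_cst.
exact: (msmooth_lmul lieG _ Me (chart_img e1)).
Qed.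

Lemma conj1 (a : G) : (a * 1 * a^-1)%g = 1%g.
Proof. by rewrite mulg1 mulgV. Qed.

Lemma Ad1 y : Ad e 1%g y = y.
Proof.
rewrite /Ad (tangent_mapE (M' := M))// ?conj1//; last exact: msmooth_conj.
have H : \forall z \near e 1%g, id z = (e \o (fun x => 1 * x * 1^-1)%g \o chart_inv e) z.
  apply: filterS (near_chart_img e1) => z cz /=.
  by rewrite mul1g invg1 mulg1 chart_invK.
by rewrite -(near_eq_derive _ H) derive_id.
Qed.

Lemma AdM (a b : G) y : Ad e (a * b)%g y = Ad e a (Ad e b y).
Proof.
have := @tangent_map_comp _ _ _ _ _ _ _ M M M (fun x => b * x * b^-1)%g
  (fun x => a * x * a^-1)%g 1%g e e e y Me Me Me (msmooth_conj b).
rewrite !conj1 => /(_ (msmooth_conj a) e1 e1 e1); rewrite /Ad => <-.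
have -> // : (fun x => a * b * x * (a * b)^-1)%g =
  (fun x => a * x * a^-1)%g \o (fun x => b * x * b^-1)%g.
by apply/funext => x /=; rewrite invgM !mulgA.
Qed.

Lemma AdVK (a : G) y : Ad e a^-1%g (Ad e a y) = y.
Proof. by rewrite -AdM mulVg Ad1. Qed.

Lemma Ad_smooth (c : chart R G n) x y : atlas M c -> (c @` chart_dom c) x ->
  smooth_at (fun z => Ad e (chart_inv c z) y) x.
Proof.
move=> Mc cx.
pose N (z : V * V) := e (chart_inv c z.1 * chart_inv e z.2 * (chart_inv c z.1)^-1)%g.
have sN : smooth_at N (x, e 1%g).
  have s1 : msmooth M (fun z : V * V => chart_inv c z.1) (x, e 1%g).
    apply: (@msmooth_comp _ _ _ _ _ _ (fun z => z.1) (chart_inv c)); [exact: framed_rV| |exact: msmooth_chart_inv].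
    exact: smooth_at_linear (bounded_linear_fst _ _).
  have : msmooth M (fun z : V * V => chart_inv c z.1 * chart_inv e z.2 * (chart_inv c z.1)^-1)%g (x, e 1%g).
    apply: msmooth_mul => //; last exact: msmooth_inv.
    apply: msmooth_mul => //.
    apply: (@msmooth_comp _ _ _ _ _ _ (fun z => z.2) (chart_inv e)); [exact: framed_rV| |].
      exact: smooth_at_linear (bounded_linear_snd _ _).
    exact: msmooth_chart_inv (chart_img e1).
  by case=> _; apply => //=; rewrite chart_mapK// mulg1 mulgV.
apply: (@smooth_at_ext _ _ _ ('D_(0, y) N \o (fun z => (z, e 1%g)))).
  apply: (@nearW _ (nbhs x)) => z; rewrite /= derive_snd /Ad (tangent_mapE (M' := M))// ?conj1//.
  exact: msmooth_conj.
apply: smooth_at_comp.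
- exact: framed_rV2.
- by apply: smooth_at_pair; [exact: smooth_at_id|exact: smooth_at_cst].
- exact: smooth_at_derive.
Qed.

(** The representative chosen in a coset differs from a by a right factor that fixes U. *)
Lemma rhoE U (a : G) : rho (lcoset (isotropy e U) a) = Ad e a U.
Proof.
rewrite /rho; set r := lcoset_repr _.
have E : lcoset_set (isotropy e U) a = lcoset_set (isotropy e U) r.
  by rewrite /r /lcoset_repr; case: cid.
have : lcoset_set (isotropy e U) a a.
  by exists 1%g; [exact: Ad1|rewrite mulg1].
by rewrite E => -[h Uh <-]; rewrite AdM Uh.
Qed.

End Adjoint.

(** A point y near P x lifts to some z with |z - x| at most C |y - P x|, so an error
o(|z - x|) of phi is an error o(|y - P x|) of Q. *)
Lemma differential_descends (R : realType) (n m : nat) (P : 'rV[R]_n -> 'rV[R]_m)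
    (Q : 'rV[R]_m -> R) (phi : 'rV[R]_n -> R) (x : 'rV[R]_n) :
  smooth_at P x -> (forall w, exists v, 'd P x v = w) ->
  (\forall z \near x, Q (P z) = phi z) ->
  differentiable phi x -> (forall v, 'd phi x v = 0) ->
  differentiable Q (P x) /\ forall v, 'd Q (P x) v = 0.
Proof.
move=> sP oP QP dphi dphi0.
have [C C0 HC] := local_surjectivity sP oP.
have QPx : Q (P x) = phi x := nbhs_singleton QP.
pose L := fun _ : 'rV[R]_m => 0 : R.
have bL : bounded_linear L.
  split; first by move=> a u v; rewrite /L scaler0 addr0.
  by exists 1 => // u; rewrite normr0 mul1r.
suff [d D] : differentiable Q (P x) /\ 'd Q (P x) = L :> ('rV[R]_m -> R).
  by split => // v; rewrite D.
apply: differentiable_of_estimate => // eps eps0.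
have eC0 : 0 < eps / C by exact: divr_gt0.
have : \forall z \near x, Q (P z) = phi z /\ `|phi z - phi x| <= eps / C * `|z - x|.
  apply: filterS2 QP (differentiable_estimate dphi eC0) => z E.
  by rewrite dphi0 subr0.
move=> /near_normP[d d0 Hd].
have n1 : \forall y \near P x, `|y - P x| < d / C.
  by apply/near_normP; exists (d / C) => //; exact: divr_gt0.
apply: filterS2 HC n1 => y [z <- zy] yd.
have [|E est] := Hd z.
  by rewrite (le_lt_trans zy)// mulrC -ltr_pdivlMr.
rewrite E QPx subr0 (le_trans est)// -mulrA.
by rewrite ler_wpM2l ?(ltW eps0)// ler_pdivrMl.
Qed.

Section Quotient.
Context {R : realType} {G : topGroupType} {n : nat}.
Local Notation V := 'rV[R]_n.
Variable (M : smooth_structure R G n).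
Hypothesis lieG : is_lie_group M.
Variable e : chart R G n.
Hypotheses (Me : atlas M e) (e1 : chart_dom e 1%g).
Variable F : V -> R.
Hypothesis mF : minkowski_norm F.
Variables (U : V) (m : nat) (MU : smooth_structure R (lcosets (isotropy e U)) m).
Hypothesis canMU : canonical_structure M MU.
Variable g : G.
Hypothesis U0 : Ad e g U != 0.
Local Notation pi := (lcoset (isotropy e U)).
Local Notation q := (restricted_norm F (U := U)).

Lemma restricted_normE a : q (pi a) = sqnorm F (Ad e a U).
Proof. by rewrite /restricted_norm (rhoE lieG Me e1). Qed.

(** Ad (k s)^-1 (Ad g U) is rho at the coset of (k s)^-1 * g, a curve through the
coset of g. *)
Lemma stationary_of_critical : critical_point MU q (pi g) ->
  forall k : R -> G, msmooth M k 0 -> k 0 = 1%g ->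
    'D_1 (fun s => sqnorm F (Ad e (k s)^-1%g (Ad e g U))) 0 = 0.
Proof.
move=> H k sk k0.
have [c' Mc' c'g] := atlas_cover MU (pi g).
have [dq dq0] := H c' Mc' c'g.
pose b s := ((k s)^-1 * g)%g.
have b0 : b 0 = g by rewrite /b k0 invg1 mul1g.
have sb : msmooth M b 0.
  by apply: msmooth_mul => //; [exact: msmooth_inv|exact: msmooth_cst].
have spb := msmooth_map canMU.1 sb.
have c'b : chart_dom c' ((pi \o b) 0) by rewrite /= b0.
have nE : \forall s \near (0 : R), ((q \o chart_inv c') \o (c' \o (pi \o b))) s =
    sqnorm F (Ad e (k s)^-1%g (Ad e g U)).
  apply: filterS (msmooth_near_dom spb c'b) => s cs.
  by rewrite /= chart_mapK// restricted_normE /b (AdM lieG Me e1).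
rewrite -(near_eq_derive _ nE).
have sg : smooth_at (c' \o (pi \o b)) 0 by apply: spb.2.
have dq' : differentiable (q \o chart_inv c') ((c' \o (pi \o b)) 0) by rewrite /= b0.
have [_ ->] := is_derive_comp (smooth_at_derivable (v := 1 : R) sg) dq'.
by rewrite /= b0 dq0.
Qed.

(** With a s the straight line in a chart at g, the curve k s = g * (a s)^-1 turns the
hypothesis into the vanishing of the differential of a |-> F (Ad a U) ^ 2 at g. *)
Lemma critical_of_stationary :
  (forall k : R -> G, msmooth M k 0 -> k 0 = 1%g ->
    'D_1 (fun s => sqnorm F (Ad e (k s)^-1%g (Ad e g U))) 0 = 0) ->
  critical_point MU q (pi g).
Proof.
move=> H c' Mc' c'g.
have [c Mc cg] := atlas_cover M g.
pose phi z := sqnorm F (Ad e (chart_inv c z) U).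
have sphi : smooth_at phi (c g).
  apply: (@smooth_at_compR _ _ _ (fun z => Ad e (chart_inv c z) U) (sqnorm F)).
  - exact: framed_rV.
  - exact: (Ad_smooth lieG Me e1 U Mc (chart_img cg)).
  - by rewrite chart_mapK//; exact: (sqnorm_smooth mF U0).
have dphi : differentiable phi (c g) := smooth_at_diffR (framed_rV n) sphi.
have dphi0 v : 'd phi (c g) v = 0.
  rewrite -deriveE//.
  pose k s := (g * (chart_inv c (c g + s *: v))^-1)%g.
  have k0 : k 0 = 1%g by rewrite /k scale0r addr0 chart_mapK// mulgV.
  have sk : msmooth M k 0.
    apply: msmooth_mul => //; first exact: msmooth_cst.
    apply: msmooth_inv => //.
    apply: (@msmooth_comp _ _ _ M _ _ (fun s : R => c g + s *: v) (chart_inv c)).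
    - exact: framed_rV.
    - exact: smooth_at_line.
    - by rewrite scale0r addr0; apply: msmooth_chart_inv => //; exact: chart_img.
  rewrite -[RHS](H k sk k0).
  have -> : (fun s => sqnorm F (Ad e (k s)^-1%g (Ad e g U))) = (fun s => phi (c g + s *: v)).
    apply/funext => s; rewrite /phi /k invgM invgK (AdM lieG Me e1).
    by rewrite (AdVK lieG Me e1).
  have := @is_derive_line _ _ _ phi (c g) v 0; rewrite scale0r addr0.
  by move=> /(_ (smooth_at_derivable sphi)) [_ ->].
pose P := c' \o pi \o chart_inv c.
have sP : smooth_at P (c g) by exact: (smooth_map_at canMU.1).
have P0 : P (c g) = c' (pi g) by rewrite /P /= chart_mapK.
have nP : \forall z \near c g, (q \o chart_inv c') (P z) = phi z.
  have sci : msmooth M (chart_inv c) (c g) := msmooth_chart_inv Mc (chart_img cg).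
  have := msmooth_near_dom (msmooth_map canMU.1 sci).
  move=> /(_ c') /=; rewrite chart_mapK// => /(_ c'g); apply: filterS => z cz.
  by apply: etrans (restricted_normE _); apply: (congr1 q); exact: chart_mapK.
rewrite -P0; exact: (differential_descends sP (canMU.2 g c c' Mc Mc' cg c'g) nP dphi dphi0).
Qed.

End Quotient.

Theorem theorem4p1 (R : realType) (G : topGroupType) (n : nat)
    (M : smooth_structure R G n) (lieG : is_lie_group M)
    (connG : connected [set: G])
    (e : chart R G n) (atlas_e : atlas M e) (e1 : chart_dom e 1%g)
    (F : 'rV[R]_n -> R) (mF : minkowski_norm F)
    (X : 'rV[R]_n) (X0 : X != 0)
    (U : 'rV[R]_n) (XU : Ad_orbit e U X)
    (m : nat) (MU : smooth_structure R (lcosets (isotropy e U)) m)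
    (canMU : canonical_structure M MU)
    (g : G) (gX : rho (lcoset (isotropy e U) g) = X) :
  geodesic_vector M e F X <->
  critical_point MU (restricted_norm F (U := U)) (lcoset (isotropy e U) g).
Proof.
have [sigma [[sc sM _] sX sE]] := lie_exp_curve lieG atlas_e e1 X.
have XE : X = Ad e g U by rewrite -gX (rhoE lieG atlas_e e1).
have GE : geodesic_vector M e F X <->
    geodesic_on M (left_invariant_finsler e F) [set t | 0 <= t] sigma.
  have -> : sigma = (fun t => lie_exp M e (t *: X)) by apply/funext => t; rewrite sE.
  by split=> [[]|].
apply: (iff_trans GE).
apply: (iff_trans (geodesic_iff_stationary lieG atlas_e e1 mF X0 sc sM sX)).
have U0 : Ad e g U != 0 by rewrite -XE.
rewrite XE; split=> H.
  exact: (critical_of_stationary lieG atlas_e e1 mF canMU U0 H).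
exact: (stationary_of_critical lieG atlas_e e1 canMU H).
Qed.
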